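(* Let $p\ge 0$ be a fixed integer and suppose $T/\sqrt{N}\to\infty$ as $N\to\infty$. Let $\epsilon_1,\dots,\epsilon_N$ be independent random vectors with $\epsilon_i\sim N_T(\mathbf 0,\sigma_i^2 I_T)$, $\sigma_i>0$, for each $i$. Define $$Q_N=\sqrt{\frac{2}{N(N-1)}}\sum_{i=1}^{N-1}\sum_{j=i+1}^N\frac{(T-p)\hat\rho_{ij}^2-\mu_{Nij}}{v_{Nij}},$$ where $$\mu_{Nij}=\frac{1}{T-p}\mathrm{tr}(P_iP_j),\qquad v_{Nij}^2=a_{1N}[\mathrm{tr}(P_iP_j)]^2+2a_{2N}\,\mathrm{tr}[(P_iP_j)^2]\quad (v_{Nij}>0),$$ $$a_{1N}=a_{2N}-\frac{1}{(T-p)^2},\qquad a_{2N}=3\left[\frac{(T-p-8)(T-p+2)+24}{(T-p+2)(T-p-2)(T-p-4)}\right]^2$$ (these are well defined for all large $N$). Then $Q_N$ converges in distribution to $N(0,1)$ as $N\to\infty$.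
   Context: A prime denotes transpose and $\|\cdot\|$ is the Euclidean norm. For each $N$, $T=T_N>p$ is an integer depending on $N$. For $i=1,\dots,N$, $x_i$ is a non-random real $T\times p$ matrix (it may depend on $N$) with $x_i'x_i$ invertible, and $P_i=I_T-x_i(x_i'x_i)^{-1}x_i'$; when $p=0$, $P_i=I_T$. For random vectors $\epsilon_i=(\epsilon_{i1},\dots,\epsilon_{iT})'\in\mathbb R^T$ (the errors in the linear regressions $y_i=x_i\beta_i+\epsilon_i$, whose OLS residual vectors are $P_i\epsilon_i$), the sample correlation coefficients of the residuals are $$\hat\rho_{ij}=\frac{\epsilon_i'P_iP_j\epsilon_j}{\|P_i\epsilon_i\|\,\|P_j\epsilon_j\|}.$$ $N_T(\mathbf 0,\sigma^2I_T)$ is the $T$-dimensional normal distribution with mean $\mathbf 0$ and covariance $\sigma^2I_T$. *)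

(* Defs.v *)
From HB Require Import structures.
From mathcomp Require Import all_boot all_order all_algebra.
From mathcomp Require Import all_classical all_reals all_analysis measurable_realfun.

Set Implicit Arguments.
Unset Strict Implicit.
Unset Printing Implicit Defensive.

Import Order.TTheory GRing.Theory Num.Theory.
Import numFieldNormedType.Exports.

Local Open Scope classical_set_scope.
Local Open Scope ring_scope.

(* Mutual independence of a finite family of random elements, with the product
   rule required on every subfamily [J]. *)
Definition mutually_independent d d' (R : realType) (Om : measurableType d)
    (P : probability Om R) (E : measurableType d') (I : finType)
    (X : I -> {RV P >-> E}) : Prop :=
  forall (J : {set I}) (B : I -> set E), (forall i, measurable (B i)) ->
    P (\bigcap_(i in [set` J]) X i @^-1` B i) =
    (\prod_(i in J) P (X i @^-1` B i))%E.

Definition cvg_in_distribution (R : realType) (d : nat -> measure_display)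
    (Om : forall n, measurableType (d n)) (P : forall n, probability (Om n) R)
    (X : forall n, {RV (P n) >-> R}) (mu : set R -> \bar R) : Prop :=
  let F := fun x : R => mu `]-oo, x]%classic in
  forall x : R, {for x, continuous F} -> cdf (X n) x @[n --> \oo] --> F x.

(* R^n carries the product Borel sigma-algebra through the library's structure
   on n-tuples; matrix algebra is done on the corresponding column vectors. *)
Definition col_of_tuple (R : Type) n (t : n.-tuple R) : 'cV[R]_n :=
  \col_k tnth t k.

(* Integral of a nonnegative function on R^n against Lebesgue measure, written
   as an iterated integral (Tonelli). *)
Fixpoint lebesgue_integral_tuple (R : realType) n :
    (n.-tuple R -> \bar R) -> \bar R :=
  match n with
  | 0 => fun f => f [tuple]
  | m.+1 => fun f => (\int[lebesgue_measure]_(x in [set: R])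
      lebesgue_integral_tuple (fun t : m.-tuple R => f [tuple of x :: t]))%E
  end.

(* Density of N_n(m, S), for S symmetric positive definite. *)
Definition mvnormal_pdf (R : realType) n (m : 'cV[R]_n) (S : 'M[R]_n)
    (x : 'cV[R]_n) : R :=
  (Num.sqrt ((2 * pi) ^+ n * \det S))^-1 *
  expR (- ((x - m)^T *m invmx S *m (x - m)) 0 0 / 2).

Definition mvnormal_prob (R : realType) n (m : 'cV[R]_n) (S : 'M[R]_n)
    (B : set (n.-tuple R)) : \bar R :=
  lebesgue_integral_tuple
    (fun t => (mvnormal_pdf m S (col_of_tuple t) * \1_B t)%:E).

Definition has_mvnormal_distribution d (R : realType) (Om : measurableType d)
    (P : probability Om R) n (X : {RV P >-> n.-tuple R})
    (m : 'cV[R]_n) (S : 'M[R]_n) : Prop :=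
  forall B : set (n.-tuple R), measurable B ->
    distribution P X B = mvnormal_prob m S B.

Definition eucl_norm (R : realType) n (v : 'cV[R]_n) : R :=
  Num.sqrt (\sum_k v k 0 ^+ 2).

(* For p = 0 the subtracted product is the zero matrix. *)
Definition residual_maker (R : realType) T p (x : 'M[R]_(T, p)) : 'M[R]_T :=
  1%:M - x *m invmx (x^T *m x) *m x^T.

Definition residual_corr (R : realType) T (Pi Pj : 'M[R]_T) (ei ej : 'cV[R]_T)
    : R :=
  (ei^T *m Pi *m Pj *m ej) 0 0 / (eucl_norm (Pi *m ei) * eucl_norm (Pj *m ej)).

(* In the next definitions [m] stands for T - p. *)
Definition a2 (R : realType) (m : R) : R :=
  3 * (((m - 8) * (m + 2) + 24) / ((m + 2) * (m - 2) * (m - 4))) ^+ 2.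

Definition a1 (R : realType) (m : R) : R := a2 m - 1 / m ^+ 2.

Definition mu_rho (R : realType) T (m : R) (Pi Pj : 'M[R]_T) : R :=
  1 / m * \tr (Pi *m Pj).

Definition v_rho_sqr (R : realType) T (m : R) (Pi Pj : 'M[R]_T) : R :=
  a1 m * (\tr (Pi *m Pj)) ^+ 2 +
  2 * a2 m * \tr ((Pi *m Pj) *m (Pi *m Pj)).

Definition v_rho (R : realType) T (m : R) (Pi Pj : 'M[R]_T) : R :=
  Num.sqrt (v_rho_sqr m Pi Pj).

Definition Q_stat (R : realType) (Om : Type) (N T p : nat)
    (x : 'I_N -> 'M[R]_(T, p)) (eps : 'I_N -> Om -> T.-tuple R) (w : Om) : R :=
  let m : R := T%:R - p%:R in
  let P i := residual_maker (x i) in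
  let rho i j := residual_corr (P i) (P j)
    (col_of_tuple (eps i w)) (col_of_tuple (eps j w)) in
  Num.sqrt (2 / (N%:R * (N%:R - 1))) *
  \sum_(i < N) \sum_(j < N | (i < j)%N)
    (m * rho i j ^+ 2 - mu_rho m (P i) (P j)) / v_rho m (P i) (P j).

Section Q_stat_measurable.
Context d (R : realType) (Om : measurableType d) (Pr : probability Om R).
Variables (N T p : nat) (x : 'I_N -> 'M[R]_(T, p)).
Variable eps : 'I_N -> {RV Pr >-> T.-tuple R}.

Let measurable_mulcol n (A : 'M[R]_(n, T)) (i : 'I_N) (k : 'I_n) :
  measurable_fun [set: Om] (fun w => (A *m col_of_tuple (eps i w)) k 0).
Proof.
under eq_fun do rewrite mxE.
apply: measurable_sum => l.
apply: measurable_funM; first exact: measurable_cst.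
under eq_fun do rewrite mxE.
apply: (@measurableT_comp _ _ _ _ _ _ (fun t : T.-tuple R => tnth t l)).
  exact: measurable_tnth.
exact: measurable_funPT.
Qed.

Let measurable_norm (A : 'M[R]_T) (i : 'I_N) :
  measurable_fun [set: Om] (fun w => eucl_norm (A *m col_of_tuple (eps i w))).
Proof.
rewrite (_ : (fun _ => _) = (fun w =>
    (\sum_k (A *m col_of_tuple (eps i w)) k 0 ^+ 2) `^ 2^-1)); last first.
  by apply/funext => w; rewrite powR12_sqrt ?sumr_ge0// => k _; exact: sqr_ge0.
apply: (@measurableT_comp _ _ _ _ _ _ (@powR R ^~ 2^-1)).
  exact: measurable_powR.
apply: measurable_sum => k; apply: measurable_funX; exact: measurable_mulcol.
Qed.

Let measurable_corr (A B : 'M[R]_T) (i j : 'I_N) :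
  measurable_fun [set: Om] (fun w => residual_corr A B
    (col_of_tuple (eps i w)) (col_of_tuple (eps j w))).
Proof.
apply: measurable_funM.
  under eq_fun do rewrite -mulmxA mxE.
  apply: measurable_sum => k; apply: measurable_funM;
    last exact: measurable_mulcol.
  rewrite (_ : (fun _ => _) =
    (fun w => (A^T *m col_of_tuple (eps i w)) k 0)).
    exact: measurable_mulcol.
  apply/funext => w; rewrite [LHS]mxE [RHS]mxE.
  by apply: eq_bigr => l _; rewrite !mxE mulrC.
rewrite (_ : (fun _ => _) = (fun w =>
    (eucl_norm (A *m col_of_tuple (eps i w)) *
     eucl_norm (B *m col_of_tuple (eps j w))) `^ (-1))); last first.
  by apply/funext => w; rewrite powR_inv1 ?mulr_ge0 ?sqrtr_ge0.
apply: (@measurableT_comp _ _ _ _ _ _ (@powR R ^~ (-1))).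
  exact: measurable_powR.
by apply: measurable_funM; exact: measurable_norm.
Qed.

Lemma measurable_Q_stat : measurable_fun [set: Om] (Q_stat x eps).
Proof.
apply: measurable_funM; first exact: measurable_cst.
apply: measurable_sum => i; under eq_fun do rewrite -big_filter.
apply: measurable_sum => j.
apply: measurable_funM; last exact: measurable_cst.
apply: measurable_funB; last exact: measurable_cst.
apply: measurable_funM; first exact: measurable_cst.
by apply: measurable_funX; exact: measurable_corr.
Qed.

HB.instance Definition _ :=
  isMeasurableFun.Build _ _ _ _ (Q_stat x eps) measurable_Q_stat.

End Q_stat_measurable.

(* Main.v *)
(* Write m = T - p, w_i for the unit vector along P_i eps_i and
   W_i = w_i w_i' - P_i / m, a centred random matrix independent of the others.
   With <A, B> = tr(A' B),
     m rho_ij^2 - mu_ij = m <W_i, W_j> + <W_i, P_j> + <W_j, P_i>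
   exactly, and v_ij^2 = 2 + O(1/m) uniformly. Since <W_i, I> = 0 almost surely
   and |I - P_j|^2 = p, the terms <W_i, P_j> are as small as 1/m in L^2; the
   W_i being centred and independent, they add up to O(N / m^2) in mean square,
   which is where T / sqrt N -> oo is used. What remains is the completely
   degenerate quadratic form S = b sum_(i<j) <W_i, W_j>,
   b^2 = m^2 / (N (N - 1)). The direction w_i is uniform on a sphere, whence
   E<W_i, A>^2 <= (2 / m^2) |A|^2 and E<W_i, A>^4 <= (108 / m^4) |A|^4, and
   a leave-one-out version of Stein's method gives E[S f(S)] - E[f'(S)] -> 0
   for f with bounded Lipschitz derivative. Solving Stein's equation for smooth
   approximations of indicators of half-lines then yields the limit law. *)

Require Import Defs.
From HB Require Import structures.
From mathcomp Require Import all_boot all_order all_algebra.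
From mathcomp Require Import all_classical all_reals all_analysis.
From mathcomp Require Import measurable_realfun ring lra.

Import Order.TTheory GRing.Theory Num.Theory.
Import numFieldNormedType.Exports.

Local Open Scope classical_set_scope.
Local Open Scope ring_scope.

Set Implicit Arguments.
Unset Strict Implicit.
Unset Printing Implicit Defensive.

(** * Bounded measurable functions and independence *)

(** A degenerate quadratic form in independent vectors need not be asymptotically normal: for
    vectors of bounded dimension the limit can be of chi-square type. Normality holds here because
    the covariance operator of each W_i is at most 2 / m^2 while |W_i| stays near 1, so that the
    conditional variances of the leave-one-out parts concentrate, with fluctuation of order sqrt(1/N
    + 2/m^2). The form S thus needs only m -> oo and N -> oo. As the W_i are bounded, the Stein
    argument runs entirely on bounded measurable functions, and independence reaches it only through
    [mean_factor]. The uniform law on the sphere is never constructed: the moments of w_i come from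
    Gaussian integration by parts applied to quadratic forms divided by powers of |P_i eps_i|^2 +
    delta, with delta -> 0. The event P_i eps_i = 0, where division yields 0, is kept in all
    identities, and a first-moment computation shows that it has probability 0. *)

Lemma big_fun_ind (T I : Type) (R : Type) (op : R -> R -> R) (idx : R)
    (K : (T -> R) -> Prop) (r : seq I) (P : pred I) (F : I -> T -> R) :
  K (fun=> idx) ->
  (forall U V, K U -> K V -> K (fun t => op (U t) (V t))) ->
  (forall i, P i -> K (F i)) -> K (fun t => \big[op/idx]_(i <- r | P i) F i t).
Proof.
move=> K0 Kop KF; elim: r => [|a r IH].
  by rewrite (_ : (fun t => _) = fun=> idx)//; apply/funext => t; rewrite big_nil.
have [Pa|nPa] := boolP (P a).
  rewrite (_ : (fun t => _) = fun t => op (F a t) (\big[op/idx]_(i <- r | P i) F i t)).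
    by apply: Kop => //; exact: KF.
  by apply/funext => t; rewrite big_cons Pa.
rewrite (_ : (fun t => _) = fun t => \big[op/idx]_(i <- r | P i) F i t)//.
by apply/funext => t; rewrite big_cons (negbTE nPa).
Qed.

Section bounded_measurable.
Context d (T : measurableType d) (R : realType).
Implicit Types U V : T -> R.

(** Everything in the Stein argument is bounded because the centred directions lie in the unit ball;
    in this class integrability is automatic and expectations are linear without side conditions. *)
Definition bm U := measurable_fun [set: T] U /\ exists C, forall t, `|U t| <= C.

Lemma bm_cst c : bm (fun _ => c).
Proof. by split; [exact: measurable_cst|exists `|c|]. Qed.

Lemma bmD U V : bm U -> bm V -> bm (fun t => U t + V t).
Proof.
move=> [mU [C UC]] [mV [D VD]]; split; first exact: measurable_funD.
by exists (C + D) => t; rewrite (le_trans (ler_normD _ _))// lerD.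
Qed.

Lemma bmM U V : bm U -> bm V -> bm (fun t => U t * V t).
Proof.
move=> [mU [C UC]] [mV [D VD]]; split; first exact: measurable_funM.
by exists (C * D) => t; rewrite normrM ler_pM.
Qed.

Lemma bmN U : bm U -> bm (fun t => - U t).
Proof.
move=> [mU [C UC]]; split; first exact: measurableT_comp.
by exists C => t; rewrite normrN.
Qed.

Lemma bmB U V : bm U -> bm V -> bm (fun t => U t - V t).
Proof. by move=> bU bV; apply: bmD => //; exact: bmN. Qed.

Lemma bmX U n : bm U -> bm (fun t => U t ^+ n).
Proof.
move=> bU; elim: n => [|n IH].
  by under eq_fun do rewrite expr0; exact: bm_cst.
by under eq_fun do rewrite exprS; exact: bmM.
Qed.

Lemma bm_norm U : bm U -> bm (fun t => `|U t|).
Proof.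
move=> [mU [C UC]]; split; first exact: measurableT_comp.
by exists C => t; rewrite normr_id.
Qed.

Lemma bm_sum (I : Type) (r : seq I) (P : pred I) (F : I -> T -> R) :
  (forall i, P i -> bm (F i)) -> bm (fun t => \sum_(i <- r | P i) F i t).
Proof.
by move=> bF; apply: (big_fun_ind (K := bm)) => //; [exact: bm_cst|exact: bmD].
Qed.

(** The values of [U] stay in a compact interval, on which the extreme value theorem bounds [f]. *)
Lemma bm_comp_cont (f : R -> R) U : continuous f -> bm U ->
  bm (fun t => f (U t)).
Proof.
move=> cf [mU [C UC]]; split.
  by apply: (@measurableT_comp _ _ _ _ _ _ f) => //; exact: continuous_measurable_fun.
have C0 : 0 <= `|C| := normr_ge0 C.
have le : - `|C| <= `|C| by rewrite (le_trans _ C0)// oppr_le0.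
have cfn : {within `[- `|C|, `|C|], continuous (fun x => `|f x|)}.
  apply: continuous_subspaceT => x; apply: continuous_comp; first exact: cf.
  exact: norm_continuous.
have [c _ cmax] := EVT_max le cfn.
exists `|f c| => t; apply: cmax; rewrite in_itv/= -ler_norml.
by rewrite (le_trans (UC t))// ler_norm.
Qed.

End bounded_measurable.

Section function_of.
Context d d' (T : measurableType d) (E : measurableType d') (R : realType).
Variable Y : T -> E.
Hypothesis mY : measurable_fun [set: T] Y.
Implicit Types U V : T -> R.

(** Bounded measurability with respect to the sigma-algebra generated by [Y], in factorized
    (Doob-Dynkin) form; the explicit [phi] is what Fubini needs later. *)
Definition fnof U := exists2 phi : E -> R, bm phi & forall t, U t = phi (Y t).

Lemma fnof_bm U : fnof U -> bm U.
Proof.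
move=> [phi [mphi [C phiC]] UE]; split; last by exists C => t; rewrite UE.
by rewrite (funext UE); exact: measurableT_comp.
Qed.

Lemma fnof_cst c : fnof (fun _ => c).
Proof. by exists (fun _ => c) => //; exact: bm_cst. Qed.

Lemma fnofD U V : fnof U -> fnof V -> fnof (fun t => U t + V t).
Proof.
move=> [f bf fE] [g bg gE]; exists (fun t => f t + g t); first exact: bmD.
by move=> t; rewrite fE gE.
Qed.

Lemma fnofM U V : fnof U -> fnof V -> fnof (fun t => U t * V t).
Proof.
move=> [f bf fE] [g bg gE]; exists (fun t => f t * g t); first exact: bmM.
by move=> t; rewrite fE gE.
Qed.

Lemma fnof_sum (I : Type) (r : seq I) (P : pred I) (F : I -> T -> R) :
  (forall i, P i -> fnof (F i)) -> fnof (fun t => \sum_(i <- r | P i) F i t).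
Proof.
by move=> bF; apply: (big_fun_ind (K := fnof)) => //; [exact: fnof_cst|exact: fnofD].
Qed.

Lemma fnof_comp_cont (f : R -> R) U : continuous f -> fnof U ->
  fnof (fun t => f (U t)).
Proof.
move=> cf [g bg gE]; exists (fun t => f (g t)); first exact: bm_comp_cont.
by move=> t; rewrite gE.
Qed.

End function_of.

(** * Expectations of bounded random variables *)

Section mean.
Context d (T : measurableType d) (R : realType) (P : probability T R).
Implicit Types U V : T -> R.

Definition mean U := \int[P]_t U t.

Lemma bm_integrable U : bm U -> P.-integrable [set: T] (EFin \o U).
Proof.
move=> [mU [C UC]]; apply: measurable_bounded_integrable => //.
  by rewrite (le_lt_trans (probability_le1 P measurableT))// ltry.
exists C; split; first exact: num_real.
by move=> x Cx t _ /=; exact: le_trans (UC t) (ltW Cx).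
Qed.

Lemma eq_mean U V : (forall t, U t = V t) -> mean U = mean V.
Proof. by move=> /funext ->. Qed.

Lemma mean_cst c : mean (fun _ => c) = c.
Proof.
transitivity (c * fine (P [set: T])); first exact: Rintegral_cst.
by rewrite probability_setT mulr1.
Qed.

Lemma meanD U V : bm U -> bm V -> mean (fun t => U t + V t) = mean U + mean V.
Proof. by move=> bU bV; apply: RintegralD => //; exact: bm_integrable. Qed.

Lemma meanB U V : bm U -> bm V -> mean (fun t => U t - V t) = mean U - mean V.
Proof. by move=> bU bV; apply: RintegralB => //; exact: bm_integrable. Qed.

Lemma meanZ c U : bm U -> mean (fun t => c * U t) = c * mean U.
Proof. by move=> bU; apply: RintegralZl => //; exact: bm_integrable. Qed.

Lemma mean_sum (I : Type) (r : seq I) (Q : pred I) (F : I -> T -> R) :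
  (forall i, Q i -> bm (F i)) ->
  mean (fun t => \sum_(i <- r | Q i) F i t) = \sum_(i <- r | Q i) mean (F i).
Proof.
move=> bF; elim: r => [|a r IH].
  rewrite big_nil -[RHS]mean_cst; apply: eq_mean => t; exact: big_nil.
rewrite big_cons; case: ifPn => Qa.
  rewrite -IH -meanD; [|exact: bF|exact: bm_sum].
  by apply: eq_mean => t; rewrite big_cons Qa.
by rewrite -IH; apply: eq_mean => t; rewrite big_cons (negbTE Qa).
Qed.

Lemma ler_mean U V : bm U -> bm V -> (forall t, U t <= V t) -> mean U <= mean V.
Proof. by move=> bU bV UV; apply: le_Rintegral => //; exact: bm_integrable. Qed.

Lemma mean_ge0 U : (forall t, 0 <= U t) -> 0 <= mean U.
Proof. by move=> U0; apply: Rintegral_ge0 => t _. Qed.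

Lemma mean_le_cst U c : bm U -> (forall t, U t <= c) -> mean U <= c.
Proof.
by move=> bU Uc; rewrite -[leRHS](mean_cst c) ler_mean//; exact: bm_cst.
Qed.

Lemma ler_norm_mean U : bm U -> `|mean U| <= mean (fun t => `|U t|).
Proof. by move=> bU; apply: le_normr_Rintegral => //; exact: bm_integrable. Qed.

(** This is nonnegativity of the variance of [|U|], whose mean is [m]. *)
Lemma mean_norm_le_sqrt U : bm U ->
  mean (fun t => `|U t|) <= Num.sqrt (mean (fun t => U t ^+ 2)).
Proof.
move=> bU; set m := mean _.
have m0 : 0 <= m by exact: mean_ge0.
rewrite -(ger0_norm m0) -sqrtr_sqr ler_wsqrtr//.
have bn : bm (fun t => `|U t|) by exact: bm_norm.
have : 0 <= mean (fun t => (`|U t| - m) ^+ 2) by apply: mean_ge0 => t; exact: sqr_ge0.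
rewrite (@eq_mean _ (fun t => U t ^+ 2 - (2 * m * `|U t| - m ^+ 2))); last first.
  by move=> t; rewrite -(real_normK (num_real (U t))); ring.
rewrite meanB; [|exact: bmX|]; last by apply: bmB; [apply: bmM => //|]; exact: bm_cst.
rewrite meanB; [|by apply: bmM => //; exact: bm_cst|exact: bm_cst].
by rewrite meanZ// mean_cst -/m; lra.
Qed.

End mean.

(** The positive and negative parts are transported separately, so measurability of [f] is
    enough. *)
Lemma integral_distribution_measurable d d' (R : realType)
    (Om : measurableType d) (E : measurableType d') (P : probability Om R)
    (X : {RV P >-> E}) (f : E -> \bar R) : measurable_fun [set: E] f ->
  (\int[distribution P X]_y f y = \int[P]_w f (X w))%E.
Proof.
move=> mf; rewrite integralE [RHS]integralE.
rewrite !ge0_integral_distribution//;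
  [|exact: measurable_funeneg|exact: measurable_funepos].
by congr (_ - _)%E; apply: eq_integral => w _ /=; rewrite ?funeposE ?funenegE.
Qed.

(** * Independence of one entry from all the others *)

Section leave_one_out.
Context d d' (R : realType) (Om : measurableType d) (P : probability Om R)
  (E : measurableType d') (n : nat) (X : 'I_n -> {RV P >-> E}) (e0 : E).

(* [e0] stands in for the missing i-th entry, so that the type does not depend
   on [i]. *)
Definition others (i : 'I_n) (w : Om) : n.-tuple E :=
  [tuple if k == i then e0 else X k w | k < n].

Lemma tnth_others i j w : j != i -> tnth (others i w) j = X j w.
Proof. by move=> ji; rewrite tnth_mktuple (negbTE ji). Qed.

Lemma measurable_others i : measurable_fun [set: Om] (others i).
Proof.
apply/measurable_fun_tnthP => k.
rewrite (_ : _ \o _ = if k == i then fun=> e0 else X k).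
  by case: ifP => _; [exact: measurable_cst|exact: measurable_funPT].
by apply/funext => w /=; rewrite tnth_mktuple; case: ifP.
Qed.

HB.instance Definition _ i :=
  isMeasurableFun.Build _ _ _ _ (others i) (measurable_others i).

Definition split_at i (w : Om) : E * n.-tuple E := (X i w, others i w).

Lemma measurable_split_at i : measurable_fun [set: Om] (split_at i).
Proof.
by apply/measurable_fun_pairP; split; [exact: measurable_funPT|exact: measurable_others].
Qed.

HB.instance Definition _ i :=
  isMeasurableFun.Build _ _ _ _ (split_at i) (measurable_split_at i).

Hypothesis indep : mutually_independent X.

(** A pi-system of rectangles, shown below to generate the product sigma-algebra on pairs (entry,
    tuple). *)
Let rect : set (set (E * n.-tuple E)) :=
  [set S | exists A (B : 'I_n -> set E), [/\ measurable A, forall k, measurable (B k) &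
    S = [set z | A z.1 /\ forall k, B k (tnth z.2 k)]]].

Let rectI : setI_closed rect.
Proof.
move=> _ _ [A [B [mA mB ->]]] [A' [B' [mA' mB' ->]]].
exists (A `&` A'), (fun k => B k `&` B' k); split.
- exact: measurableI.
- by move=> k; exact: measurableI.
- apply/seteqP; split => z /=.
    by move=> [[Az Bz] [Az' Bz']]; split.
  by move=> [[Az Az'] BB]; split; split => // k; have [] := BB k.
Qed.

Let rect_measurable : measurable = <<s rect >>.
Proof.
apply/seteqP; split; last first.
  apply: smallest_sub; first exact: sigma_algebra_measurable.
  move=> _ [A [B [mA mB ->]]].
  rewrite (_ : mkset _ = (fst @^-1` A) `&`
    \bigcap_(k in [set: 'I_n]) (snd @^-1` ((@tnth n E ^~ k) @^-1` B k))).
    apply: measurableI.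
      by rewrite -[X in measurable X]setTI; exact: measurable_fst.
    apply: fin_bigcap_measurable => // k _.
    rewrite -[X in measurable X]setTI; apply: measurable_snd => //.
    by rewrite -[X in measurable X]setTI; exact: measurable_tnth.
  apply/seteqP; split => z /=; first by move=> [Az Bz]; split => // k _; exact: Bz.
  by move=> [Az Bz]; split => // k; exact: Bz.
move=> S mS.
have mid : measurable_fun [set: g_sigma_algebraType rect] (id : g_sigma_algebraType rect -> E * n.-tuple E).
  apply/measurable_fun_pairP; split.
    move=> _ A mA; rewrite setTI; apply: sub_sigma_algebra.
    exists A, (fun=> setT); split => //.
    by apply/seteqP; split => z //= [].
  apply/measurable_fun_tnthP => k _ A mA; rewrite setTI; apply: sub_sigma_algebra.
  exists setT, (fun j => if j == k then A else setT); split => //.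
    by move=> j; case: ifP.
  apply/seteqP; split => z /=.
    by move=> Az; split => // j; case: eqP => // ->.
  by move=> [_ /(_ k)]; rewrite eqxx.
by have := mid measurableT _ mS; rewrite setTI.
Qed.

Let indep_full (B : 'I_n -> set E) : (forall k, measurable (B k)) ->
  P (\bigcap_k (X k @^-1` B k)) = (\prod_k P (X k @^-1` B k))%E.
Proof.
move=> mB; have := indep [set: 'I_n]%SET mB.
rewrite (_ : [set` [set: 'I_n]%SET] = [set: 'I_n]); last first.
  by apply/seteqP; split => k //= _; rewrite inE.
by move=> ->; apply: eq_bigl => k; rewrite inE.
Qed.

(** Both measures are evaluated on the rectangles of [rect], where mutual independence factors them;
    uniqueness on a generating pi-system does the rest. *)
Lemma distribution_split_at i S : measurable S ->
  (distribution P (X i) \x distribution P (others i))%E S =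
  distribution P (split_at i) S.
Proof.
move=> mS; apply: (measure_unique rect (fun=> setT)) => //.
- by move=> k; exists setT, (fun=> setT); split => //; apply/seteqP; split.
- by apply: bigcup_const; exists 0%N.
- move=> _ [A [B [mA mB ->]]].
  pose C := [set t : n.-tuple E | forall k, B k (tnth t k)].
  have mC : measurable C.
    rewrite (_ : C = \bigcap_(k in [set: 'I_n]) ((@tnth n E ^~ k) @^-1` B k)); last first.
      by apply/seteqP; split => t /=; [move=> Ct k _; exact: Ct|move=> Ct k; exact: Ct].
    apply: fin_bigcap_measurable => // k _.
    by rewrite -[X in measurable X]setTI; exact: measurable_tnth.
  rewrite (_ : mkset _ = A `*` C); last by [].
  transitivity (distribution P (X i) A * distribution P (others i) C)%E.
    exact: product_measure1E.
  transitivity (P (X i @^-1` A) * P (others i @^-1` C))%E; first by [].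
  transitivity (P (split_at i @^-1` (A `*` C))); last by [].
  pose B1 k := if k == i then A else B k.
  pose B2 k := if k == i then setT else B k.
  have mB1 k : measurable (B1 k) by rewrite /B1; case: ifP.
  have mB2 k : measurable (B2 k) by rewrite /B2; case: ifP.
  (* The [i]-th entry of [others i] is the constant [e0]: if it misses [B i], both sides are 0;
     otherwise the condition is void and [B i] may be replaced by the whole space. *)
  have [Be0|nBe0] := pselect (B i e0); last first.
    have -> : others i @^-1` C = set0.
      by apply/seteqP; split => w //= /(_ i); rewrite tnth_mktuple eqxx.
    have -> : split_at i @^-1` (A `*` C) = set0.
      by apply/seteqP; split => w //= [_ /(_ i)]; rewrite /= tnth_mktuple eqxx.
    by rewrite !measure0 mule0.
  have -> : split_at i @^-1` (A `*` C) = \bigcap_k (X k @^-1` B1 k).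
    apply/seteqP; split => w /=.
      move=> [/= Aw Cw] k _; rewrite /B1; have := Cw k.
      by rewrite tnth_mktuple; case: eqP => // ->.
    move=> Bw; split => /=; first by have := Bw i I; rewrite /B1 eqxx.
    by move=> k; rewrite tnth_mktuple; have := Bw k I; rewrite /B1; case: eqP => // ->.
  have -> : others i @^-1` C = \bigcap_k (X k @^-1` B2 k).
    apply/seteqP; split => w /=.
      move=> Cw k _; rewrite /B2; have := Cw k.
      by rewrite tnth_mktuple; case: eqP => // ->.
    by move=> Bw k; rewrite tnth_mktuple; have := Bw k I; rewrite /B2; case: eqP => // ->.
  rewrite !indep_full// (bigD1 i)//= [in RHS](bigD1 i)//= /B1 /B2 eqxx preimage_setT.
  rewrite probability_setT mul1e; congr (_ * _)%E.
  by apply: eq_bigr => k /negbTE ->.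
- move=> k; rewrite -setXTT.
  apply: (@le_lt_trans _ _ (distribution P (X i) setT *
    distribution P (others i) setT)%E); last by rewrite !probability_setT mule1 ltry.
  by rewrite le_eqVlt; apply/orP; left; apply/eqP; exact: product_measure1E.
Qed.

(** Fubini for the product law; it takes the place of conditioning on all entries but the [i]-th. *)
Lemma integral_split_at i (f : E * n.-tuple E -> \bar R) :
  measurable_fun [set: E * n.-tuple E] f ->
  P.-integrable [set: Om] (f \o split_at i) ->
  (\int[P]_w f (split_at i w) =
   \int[P]_w \int[distribution P (X i)]_x f (x, others i w))%E.
Proof.
move=> mf intf.
have intp : (distribution P (X i) \x distribution P (others i))%E.-integrable setT f.
  have : (distribution P (split_at i)).-integrable setT f.
    by apply: integrable_pushforward => //; exact: measurable_split_at.
  move=> /integrableP[_ fy]; apply/integrableP; split => //; apply: le_lt_trans fy.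
  rewrite le_eqVlt; apply/orP; left; apply/eqP.
  by apply: eq_measure_integral => S mS _; exact: distribution_split_at.
transitivity (\int[distribution P (split_at i)]_z f z)%E.
  by rewrite integral_distribution.
transitivity (\int[(distribution P (X i) \x distribution P (others i))]_z f z)%E.
  by apply/esym/eq_measure_integral => S mS _; exact: distribution_split_at.
rewrite -integral21_prod_meas1// integral_distribution_measurable//.
exact: (measurable_fubini_G intp).
Qed.

Lemma mean_factor i (phi : E -> R) (g : n.-tuple E -> R) : bm phi -> bm g ->
  mean P (fun w => phi (X i w) * g (others i w)) =
  mean P (fun w => phi (X i w)) * mean P (fun w => g (others i w)).
Proof.
move=> bphi bg; have [mphi _] := bphi; have [mg _] := bg.
have bphiX : bm (fun w => phi (X i w)).
  by apply: (fnof_bm (Y := X i)); [exact: measurable_funPT|exists phi].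
have bgX : bm (fun w => g (others i w)).
  by apply: (fnof_bm (Y := others i)); [exact: measurable_others|exists g].
pose f (z : E * n.-tuple E) := (phi z.1 * g z.2)%:E.
have mf : measurable_fun [set: E * n.-tuple E] f.
  apply/measurable_EFinP; apply: measurable_funM.
    by apply: measurableT_comp => //; exact: measurable_fst.
  by apply: measurableT_comp => //; exact: measurable_snd.
have intf : P.-integrable [set: Om] (f \o split_at i).
  exact: (bm_integrable P (bmM bphiX bgX)).
rewrite {1}/mean /Rintegral (_ : (\int[P]_w _)%E = (\int[P]_w f (split_at i w))%E)//.
rewrite (integral_split_at mf intf).
have inner w : (\int[distribution P (X i)]_x f (x, others i w) =
    (mean P (fun v => phi (X i v)) * g (others i w))%:E)%E.
  rewrite integral_distribution_measurable.
  - rewrite /f/= EFinM; under eq_integral do rewrite EFinM.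
    rewrite integralZr//; last exact: (bm_integrable P bphiX).
    congr (_ * _)%E; rewrite /mean /Rintegral fineK//.
    exact: integrable_fin_num (bm_integrable P bphiX).
  - by apply: measurableT_comp => //; exact: pair2_measurable.
under eq_integral do rewrite inner.
by rewrite -(meanZ P _ bgX).
Qed.

End leave_one_out.

(** * Stein's method for quadratic forms in independent vectors *)

Section inner_product.
Context (R : realType).

Definition ip (D : finType) (u v : D -> R) : R := \sum_k u k * v k.

(** Squares and fourth powers of inner products become inner products of iterated tensor squares, so
    a decoupling lemma for bilinear expressions covers moments of degree two and four as well. *)
Definition tensor_sq (D : finType) (u : D -> R) : D * D -> R :=
  fun p => u p.1 * u p.2.

Lemma ipC (D : finType) (u v : D -> R) : ip u v = ip v u.
Proof. by apply: eq_bigr => k _; rewrite mulrC. Qed.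

Lemma ip_ge0 (D : finType) (u : D -> R) : 0 <= ip u u.
Proof. by apply: sumr_ge0 => k _; rewrite -expr2 sqr_ge0. Qed.

Lemma ip_tensor_sq (D : finType) (u v : D -> R) :
  ip u v ^+ 2 = ip (tensor_sq u) (tensor_sq v).
Proof.
rewrite expr2 /ip big_distrlr/= pair_bigA/=.
by apply: eq_bigr => p _; rewrite /tensor_sq; ring.
Qed.

End inner_product.

Section apply_kernel.
Context (R : realType) (D : finType).

Definition mulv (G : D -> D -> R) (v : D -> R) : D -> R := fun a => ip (G a) v.

Lemma ip_mulv_tr (G : D -> D -> R) (u v : D -> R) :
  ip u (mulv G v) = ip v (mulv (fun a c => G c a) u).
Proof.
rewrite /ip /mulv /ip; under eq_bigr do rewrite mulr_sumr.
rewrite exchange_big/=; apply: eq_bigr => c _; rewrite mulr_sumr.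
by apply: eq_bigr => a _; ring.
Qed.

End apply_kernel.

(** * Independent centred vectors in the unit ball with small covariance operators *)

Section quadratic_form_sum.
Context d d1 d2 (R : realType) (Om : measurableType d) (P : probability Om R)
  (E1 : measurableType d1) (E2 : measurableType d2) (N : nat) (D : finType).
Variables (Y : 'I_N -> Om -> E1) (Zo : 'I_N -> Om -> E2).
Variable (X : 'I_N -> Om -> D -> R).
Hypothesis mY : forall i, measurable_fun [set: Om] (Y i).
Hypothesis mZo : forall i, measurable_fun [set: Om] (Zo i).
Hypothesis XY : forall i k, fnof (Y i) (fun w => X i w k).
Hypothesis XZo : forall i j k, j != i -> fnof (Zo i) (fun w => X j w k).
Hypothesis indep : forall i (V U : Om -> R), fnof (Y i) V -> fnof (Zo i) U ->
  mean P (fun w => V w * U w) = mean P V * mean P U.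
Hypothesis X_le1 : forall i w, ip (X i w) (X i w) <= 1.
Hypothesis X_mean0 : forall i k, mean P (fun w => X i w k) = 0.
Variables (kappa kappa4 : R).
Hypothesis kappa_gt0 : 0 < kappa.
Hypothesis kappa_le1 : kappa <= 1.
Hypothesis X_mean2 : forall i z, mean P (fun w => ip (X i w) z ^+ 2) <= kappa * ip z z.
Hypothesis X_mean4 : forall i z,
  mean P (fun w => ip (X i w) z ^+ 4) <= kappa4 * ip z z ^+ 2.

Let kappa_ge0 : 0 <= kappa. Proof. exact: ltW. Qed.

Let bmX_ i k : bm (fun w => X i w k).
Proof. exact: (fnof_bm (@mY i)). Qed.

Lemma fnof_ip d0 (E : measurableType d0) (V : Om -> E) (A : finType)
    (u v : Om -> A -> R) :
  (forall k, fnof V (fun w => u w k)) -> (forall k, fnof V (fun w => v w k)) ->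
  fnof V (fun w => ip (u w) (v w)).
Proof. by move=> fu fv; apply: fnof_sum => k _; exact: fnofM. Qed.

Lemma fnof_tensor_sq d0 (E : measurableType d0) (V : Om -> E) (A : finType)
    (u : Om -> A -> R) : (forall k, fnof V (fun w => u w k)) ->
  forall p, fnof V (fun w => tensor_sq (u w) p).
Proof. by move=> fu p; exact: fnofM. Qed.

Lemma bm_ip (A : finType) (u v : Om -> A -> R) :
  (forall k, bm (fun w => u w k)) -> (forall k, bm (fun w => v w k)) ->
  bm (fun w => ip (u w) (v w)).
Proof. by move=> fu fv; apply: bm_sum => k _; exact: bmM. Qed.

Lemma mean_ip_cst (A : finType) (phi : Om -> A -> R) z :
  (forall k, bm (fun w => phi w k)) ->
  mean P (fun w => ip (phi w) z) = ip (fun k => mean P (fun w => phi w k)) z.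
Proof.
move=> bphi; rewrite mean_sum => [|k _]; last by apply: bmM => //; exact: bm_cst.
apply: eq_bigr => k _; rewrite mulrC -meanZ//.
by apply: eq_mean => w; rewrite mulrC.
Qed.

(** Conditional expectation given the other vectors, written as a double mean: [phi] is averaged
    over [v] while [U] is frozen at [w]. Bilinearity of [ip] reduces it to [indep], coordinate by
    coordinate. *)
Lemma mean_decouple i (A : finType) (phi U : Om -> A -> R) :
  (forall k, fnof (Y i) (fun w => phi w k)) ->
  (forall k, fnof (Zo i) (fun w => U w k)) ->
  mean P (fun w => ip (phi w) (U w)) =
  mean P (fun w => mean P (fun v => ip (phi v) (U w))).
Proof.
move=> fphi fU.
have bphi k : bm (fun w => phi w k) by exact: (fnof_bm (@mY i)).
have bU k : bm (fun w => U w k) by exact: (fnof_bm (@mZo i)).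
rewrite mean_sum => [|k _]; last exact: bmM.
rewrite (eq_mean P (V := fun w => \sum_k mean P (fun v => phi v k) * U w k)).
  rewrite mean_sum => [|k _]; last by apply: bmM => //; exact: bm_cst.
  by apply: eq_bigr => k _; rewrite (indep (fphi k) (fU k)) meanZ.
by move=> w; rewrite mean_ip_cst.
Qed.

Lemma mean_lin0 i (U : Om -> D -> R) :
  (forall k, fnof (Zo i) (fun w => U w k)) ->
  mean P (fun w => ip (X i w) (U w)) = 0.
Proof.
move=> fU; rewrite (mean_decouple (i := i))//; first last.
rewrite (eq_mean P (V := fun=> 0)) ?mean_cst// => w.
by rewrite mean_ip_cst// /ip big1// => k _; rewrite X_mean0 mul0r.
Qed.

(** Tensor squares make the expression bilinear, so [mean_decouple] applies; the weight [V] is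
    absorbed into the factor that does not involve the [i]-th vector. *)
Lemma mean_ip2 i (U : Om -> D -> R) (V : Om -> R) :
  (forall k, fnof (Zo i) (fun w => U w k)) -> fnof (Zo i) V ->
  mean P (fun w => ip (X i w) (U w) ^+ 2 * V w) =
  mean P (fun w => mean P (fun v => ip (X i v) (U w) ^+ 2) * V w).
Proof.
move=> fU fV.
transitivity (mean P (fun w => ip (tensor_sq (X i w))
    (fun p => tensor_sq (U w) p * V w))).
  apply: eq_mean => w; rewrite ip_tensor_sq /ip mulr_suml.
  by apply: eq_bigr => p _; rewrite mulrA.
rewrite (mean_decouple (i := i)); first last.
- by move=> p; apply: fnofM => //; exact: fnof_tensor_sq.
- exact: fnof_tensor_sq.
apply: eq_mean => w; rewrite mean_ip_cst; last by move=> p; exact: bmM.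
rewrite (eq_mean P (V := fun v => ip (tensor_sq (X i v)) (tensor_sq (U w)))).
  rewrite mean_ip_cst; last by move=> p; exact: bmM.
  by rewrite /ip mulr_suml; apply: eq_bigr => p _; rewrite mulrA.
by move=> v; rewrite ip_tensor_sq.
Qed.

(** The inner mean is a fixed quadratic form in [U], with the second moments of [X j] as
    coefficients. *)
Lemma fnof_mean_ip2 j (U : Om -> D -> R) d0 (E : measurableType d0) (W : Om -> E) :
  (forall k, fnof W (fun w => U w k)) ->
  fnof W (fun w => mean P (fun v => ip (X j v) (U w) ^+ 2)).
Proof.
move=> fU; rewrite (_ : (fun _ => _) = fun w => ip
    (fun p => mean P (fun v => tensor_sq (X j v) p)) (tensor_sq (U w))).
  by apply: fnof_ip => p; [exact: fnof_cst|exact: fnof_tensor_sq].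
apply/funext => w; rewrite -mean_ip_cst; last by move=> p; exact: bmM.
by apply: eq_mean => v; rewrite ip_tensor_sq.
Qed.

Lemma mean_ip2_le i (U : Om -> D -> R) :
  (forall k, fnof (Zo i) (fun w => U w k)) ->
  mean P (fun w => ip (X i w) (U w) ^+ 2) <= kappa * mean P (fun w => ip (U w) (U w)).
Proof.
move=> fU; have bU : bm (fun w => ip (U w) (U w)).
  by apply: (fnof_bm (@mZo i)); exact: fnof_ip.
rewrite (eq_mean P (V := fun w => ip (X i w) (U w) ^+ 2 * 1)); last first.
  by move=> w; rewrite mulr1.
rewrite (mean_ip2 fU); last exact: fnof_cst.
rewrite -meanZ//; apply: ler_mean.
- apply: bmM; last exact: bm_cst.
  apply: (fnof_bm (@mZo i)); exact: fnof_mean_ip2.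
- by apply: bmM => //; exact: bm_cst.
- by move=> w; rewrite mulr1 X_mean2.
Qed.

Lemma mean_ip4_le i (U : Om -> D -> R) :
  (forall k, fnof (Zo i) (fun w => U w k)) ->
  mean P (fun w => ip (X i w) (U w) ^+ 4) <=
  kappa4 * mean P (fun w => ip (U w) (U w) ^+ 2).
Proof.
move=> fU; have bU : bm (fun w => ip (U w) (U w)).
  by apply: (fnof_bm (@mZo i)); exact: fnof_ip.
have ip4 (u v : D -> R) : ip u v ^+ 4 =
    ip (tensor_sq (tensor_sq u)) (tensor_sq (tensor_sq v)).
  by rewrite -!ip_tensor_sq -exprM.
rewrite (eq_mean P (V := fun w =>
  ip (tensor_sq (tensor_sq (X i w))) (tensor_sq (tensor_sq (U w))))) => [|w]; last exact: ip4.
have fZ : forall p, fnof (Zo i) (fun w => tensor_sq (tensor_sq (U w)) p).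
  by apply: fnof_tensor_sq; exact: fnof_tensor_sq.
have fX : forall p, fnof (Y i) (fun w => tensor_sq (tensor_sq (X i w)) p).
  by apply: fnof_tensor_sq; exact: fnof_tensor_sq.
rewrite (mean_decouple fX fZ).
rewrite -meanZ; last exact: bmX.
apply: ler_mean.
- rewrite (_ : (fun _ => _) = fun w => ip
    (fun p => mean P (fun v => tensor_sq (tensor_sq (X i v)) p)) (tensor_sq (tensor_sq (U w)))).
    apply: bm_ip => p; first exact: bm_cst.
    exact: (fnof_bm (@mZo i)).
  by apply/funext => w; rewrite mean_ip_cst// => p; apply: (fnof_bm (@mY i)).
- by apply: bmM; [exact: bm_cst|exact: bmX].
- move=> w; apply: le_trans (X_mean4 i (U w)).
  by rewrite le_eqVlt; apply/orP; left; apply/eqP/eq_mean => v; rewrite ip4.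
Qed.

Lemma fnof_mulv d0 (E : measurableType d0) (W : Om -> E) G (U : Om -> D -> R) :
  (forall k, fnof W (fun w => U w k)) ->
  forall k, fnof W (fun w => mulv G (U w) k).
Proof. by move=> fU k; apply: fnof_ip => // l; exact: fnof_cst. Qed.

(** * Variance of a degenerate bilinear sum *)

Section degenerate_sum.
Variable G : 'I_N -> 'I_N -> D -> D -> R.

Let u (p : 'I_N * 'I_N) w := ip (X p.1 w) (mulv (G p.1 p.2) (X p.2 w)).

Let bu p : bm (u p).
Proof.
apply: bm_ip => // k; rewrite /mulv; apply: bm_ip => // l; exact: bm_cst.
Qed.

Let fu i p : p.1 != i -> p.2 != i -> fnof (Zo i) (u p).
Proof.
move=> p1 p2; apply: fnof_ip => k; first exact: XZo.
by apply: fnof_mulv => l; exact: XZo.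
Qed.

Let mean_u0 i (U : Om -> D -> R) V :
  (forall k, fnof (Zo i) (fun w => U w k)) -> fnof (Zo i) V ->
  mean P (fun w => ip (X i w) (U w) * V w) = 0.
Proof.
move=> fU fV; rewrite -(@mean_lin0 i (fun w k => U w k * V w)); last first.
  by move=> k; exact: fnofM.
apply: eq_mean => w; rewrite /ip mulr_suml.
by apply: eq_bigr => k _; rewrite mulrA.
Qed.

(** If [q] misses one index of [p], the product is linear in a centred vector that occurs nowhere
    else in it. *)
Let mean_uu0 p q : p.1 != p.2 ->
  (q.1 != p.1) && (q.2 != p.1) || (q.1 != p.2) && (q.2 != p.2) ->
  mean P (fun w => u p w * u q w) = 0.
Proof.
move=> p12 /orP[/andP[q1 q2]|/andP[q1 q2]].
  apply: mean_u0; last exact: fu.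
  by apply: fnof_mulv => k; apply: XZo; rewrite eq_sym.
rewrite -(@mean_u0 p.2 (fun w => mulv (fun a c => G p.1 p.2 c a) (X p.1 w)) (u q)).
- by apply: eq_mean => w; rewrite /u ip_mulv_tr.
- by apply: fnof_mulv => k; apply: XZo.
- exact: fu.
Qed.

Let pair_or_swap (p q : 'I_N * 'I_N) : p.1 != p.2 -> q.1 != q.2 ->
  ~~ ((q.1 != p.1) && (q.2 != p.1) || (q.1 != p.2) && (q.2 != p.2)) ->
  (q == p) || (q == (p.2, p.1)).
Proof.
case: p q => [p1 p2] [q1 q2] /=; rewrite !xpair_eqE.
move=> p12 q12.
have [e1|n1] := eqVneq q1 p1; have [e2|n2] := eqVneq q2 p2;
have [e3|n3] := eqVneq q1 p2; have [e4|n4] := eqVneq q2 p1; subst;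
  rewrite ?eqxx ?andbF ?orbF //= in p12 q12 *.
Qed.

(** Only [q = p] and the swapped pair can correlate with [p]. As the kernel is arbitrary, the
    swapped term is a different variable; bounding each product by the average of two second moments
    yields the factor 2. *)
Lemma mean_degenerate_sum :
  mean P (fun w => (\sum_(p : 'I_N * 'I_N | p.1 != p.2) u p w) ^+ 2) <=
  2 * \sum_(p : 'I_N * 'I_N | p.1 != p.2) mean P (fun w => u p w ^+ 2).
Proof.
pose e p := mean P (fun w => u p w ^+ 2).
have e0 p : 0 <= e p by apply: mean_ge0 => w; exact: sqr_ge0.
pose sw (p : 'I_N * 'I_N) := (p.2, p.1).
rewrite (eq_mean P (V := fun w => \sum_(p : 'I_N * 'I_N | p.1 != p.2)
    \sum_(q : 'I_N * 'I_N | q.1 != q.2) u p w * u q w)) => [|w]; last first.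
  by rewrite expr2 big_distrlr.
rewrite mean_sum => [|p _]; last by apply: bm_sum => q _; exact: bmM.
apply: (@le_trans _ _ (\sum_(p : 'I_N * 'I_N | p.1 != p.2)
    \sum_(q : 'I_N * 'I_N | q.1 != q.2)
      ((q == p)%:R + (q == sw p)%:R) * ((e p + e q) / 2))).
  apply: ler_sum => p p12; rewrite mean_sum => [|q _]; last exact: bmM.
  apply: ler_sum => q q12.
  have eh : 0 <= (e p + e q) / 2 by rewrite divr_ge0// addr_ge0.
  have [z|nz] := boolP ((q.1 != p.1) && (q.2 != p.1) || (q.1 != p.2) && (q.2 != p.2)).
    by rewrite mean_uu0// mulr_ge0.
  have c1 : 1 <= (q == p)%:R + (q == sw p)%:R :> R.
    have := pair_or_swap p12 q12 nz; rewrite -/(sw p).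
    by case: (q == p); case: (q == sw p) => //= _; rewrite ?addr0 ?add0r// lerDl.
  apply: (@le_trans _ _ ((e p + e q) / 2)); last by rewrite ler_peMl.
  rewrite /e -meanD; [|exact: bmX|exact: bmX].
  rewrite mulrC -meanZ; last by apply: bmD; exact: bmX.
  apply: ler_mean; first exact: bmM.
    by apply: bmM; [exact: bm_cst|apply: bmD; exact: bmX].
  by move=> w; have := sqr_ge0 (u p w - u q w); lra.
have sumq p : p.1 != p.2 -> \sum_(q : 'I_N * 'I_N | q.1 != q.2)
      ((q == p)%:R + (q == sw p)%:R) * ((e p + e q) / 2) =
    e p + (e p + e (sw p)) / 2.
  move=> p12; under eq_bigr do rewrite mulrDl.
  rewrite big_split/= (bigD1 p)//= eqxx mul1r big1 => [|q /andP[_ /negbTE ->]]; last by rewrite mul0r.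
  rewrite addr0 (bigD1 (sw p)) => [|/=]; last by rewrite eq_sym.
  rewrite eqxx mul1r big1 => [|q /andP[_ /negbTE ->]]; last by rewrite mul0r.
  by rewrite /= addr0; lra.
rewrite (eq_bigr _ sumq) big_split/= -mulr_suml big_split/=.
have -> : \sum_(p : 'I_N * 'I_N | p.1 != p.2) e (sw p) =
    \sum_(p : 'I_N * 'I_N | p.1 != p.2) e p.
  rewrite [RHS](reindex_inj (h := sw)).
    by apply: eq_bigl => p /=; rewrite eq_sym.
  by move=> [a c] [a' c'] [-> ->].
rewrite -/(e _); lra.
Qed.

End degenerate_sum.

Lemma mean_offdiag_sq_le (G : 'I_N -> 'I_N -> D -> D -> R) p : p.1 != p.2 ->
  mean P (fun w => ip (X p.1 w) (mulv (G p.1 p.2) (X p.2 w)) ^+ 2) <=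
  kappa * mean P (fun w => ip (mulv (G p.1 p.2) (X p.2 w)) (mulv (G p.1 p.2) (X p.2 w))).
Proof.
move=> p12; apply: mean_ip2_le => k; apply: fnof_mulv => l.
by apply: XZo; rewrite eq_sym.
Qed.

Lemma mean_weighted_sum_le (a : 'I_N * 'I_N -> R) :
  mean P (fun w => (\sum_(p : 'I_N * 'I_N | p.1 != p.2) a p * ip (X p.1 w) (X p.2 w)) ^+ 2)
  <= 2 * kappa * \sum_(p : 'I_N * 'I_N | p.1 != p.2) a p ^+ 2.
Proof.
pose G i j (k l : D) := a (i, j) * (k == l)%:R.
have GE i j z k : mulv (G i j) z k = a (i, j) * z k.
  rewrite /mulv /ip (bigD1 k)//= /G eqxx mulr1 big1 ?addr0// => l /negbTE lk.
  by rewrite eq_sym lk mulr0 mul0r.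
have ipG i j (u z : D -> R) : ip u (mulv (G i j) z) = a (i, j) * ip u z.
  by rewrite /ip mulr_sumr; apply: eq_bigr => k _; rewrite GE; ring.
rewrite (eq_mean P (V := fun w => (\sum_(p : 'I_N * 'I_N | p.1 != p.2)
    ip (X p.1 w) (mulv (G p.1 p.2) (X p.2 w))) ^+ 2)) => [|w]; last first.
  by congr (_ ^+ 2); apply: eq_bigr => -[i j] _; rewrite ipG.
apply: le_trans (mean_degenerate_sum _) _.
rewrite -mulrA ler_pM2l// mulr_sumr; apply: ler_sum => p p12.
apply: le_trans (mean_offdiag_sq_le _ p12) _; rewrite ler_pM2l//.
apply: mean_le_cst => [|w].
  by apply: bm_ip => k; apply: bm_ip => // l; exact: bm_cst.
have -> : ip (mulv (G p.1 p.2) (X p.2 w)) (mulv (G p.1 p.2) (X p.2 w)) =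
    a p ^+ 2 * ip (X p.2 w) (X p.2 w).
  by rewrite ipG ipC ipG -surjective_pairing; ring.
by rewrite ler_piMr// sqr_ge0.
Qed.

Definition cov i (k l : D) : R := mean P (fun w => X i w k * X i w l).

Lemma mean_ip_ip i y z :
  mean P (fun w => ip (X i w) y * ip (X i w) z) = ip y (mulv (cov i) z).
Proof.
rewrite (eq_mean P (V := fun w => \sum_k \sum_l (y k * z l) * (X i w k * X i w l))) => [|w]; last first.
  rewrite /ip big_distrlr/=; apply: eq_bigr => k _; apply: eq_bigr => l _; ring.
rewrite mean_sum => [|k _]; last first.
  by apply: bm_sum => l _; apply: bmM; [exact: bm_cst|exact: bmM].
apply: eq_bigr => k _; rewrite mean_sum => [|l _]; last first.
  by apply: bmM; [exact: bm_cst|exact: bmM].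
rewrite /mulv /ip mulr_sumr; apply: eq_bigr => l _.
by rewrite meanZ ?/cov; [ring|exact: bmM].
Qed.

Definition cov_sum (A : pred 'I_N) (k l : D) : R := \sum_(i | A i) cov i k l.

Lemma mulv_cov_sum A y z :
  ip y (mulv (cov_sum A) z) = \sum_(i | A i) ip y (mulv (cov i) z).
Proof.
rewrite /ip exchange_big/=; apply: eq_bigr => k _; rewrite -mulr_sumr; congr (_ * _).
rewrite /mulv /ip exchange_big/=; apply: eq_bigr => l _.
by rewrite /cov_sum mulr_suml.
Qed.

Let Nk : R := N%:R * kappa.

Hypothesis N_gt0 : (0 < N)%N.

Let Nk_gt0 : 0 < Nk. Proof. by rewrite mulr_gt0// ltr0n. Qed.

Lemma sum_le_card (A : pred 'I_N) (F : 'I_N -> R) c : 0 <= c ->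
  (forall i, F i <= c) -> \sum_(i | A i) F i <= N%:R * c.
Proof.
move=> c0 Fc; apply: (@le_trans _ _ (\sum_(i | A i) c)); first exact: ler_sum.
rewrite big_mkcond/= (@le_trans _ _ (\sum_(i < N) c))//.
  by apply: ler_sum => i _; case: ifP.
by rewrite sumr_const card_ord mulr_natl.
Qed.

Lemma ip_cov_sum_le A z : ip z (mulv (cov_sum A) z) <= Nk * ip z z.
Proof.
rewrite mulv_cov_sum /Nk -mulrA; apply: sum_le_card => [|i].
  by rewrite mulr_ge0// ip_ge0.
by rewrite -mean_ip_ip; under eq_mean do rewrite -expr2; exact: X_mean2.
Qed.

Lemma ip_cov_sum_ge0 A z : 0 <= ip z (mulv (cov_sum A) z).
Proof.
rewrite mulv_cov_sum; apply: sumr_ge0 => i _; rewrite -mean_ip_ip.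
by apply: mean_ge0 => w; rewrite -expr2 sqr_ge0.
Qed.

(** A nonnegative operator with quadratic form at most [Nk] has norm at most [Nk]. With [y] the
    image of [z], a weighted AM-GM inequality inside each mean gives |y|^2 <= (|y|^2 + Nk^2 |z|^2) /
    2, and |y|^2 is absorbed on the left. *)
Lemma norm_cov_sum_le A z :
  ip (mulv (cov_sum A) z) (mulv (cov_sum A) z) <= Nk ^+ 2 * ip z z.
Proof.
set y := mulv _ z.
have h : ip y y <= N%:R * (kappa * ((Nk^-1 * ip y y + Nk * ip z z) / 2)).
  rewrite [leLHS](mulv_cov_sum A y z); apply: sum_le_card => [|i].
    apply: mulr_ge0 => //; apply: divr_ge0 => //.
    by apply: addr_ge0; apply: mulr_ge0; rewrite ?ip_ge0// ?invr_ge0 ltW.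
  rewrite -mean_ip_ip.
  have bi (t : D -> R) : bm (fun w => ip (X i w) t).
    by apply: bm_ip => // k; exact: bm_cst.
  apply: (@le_trans _ _ (mean P (fun w =>
      Nk^-1 / 2 * ip (X i w) y ^+ 2 + Nk / 2 * ip (X i w) z ^+ 2))).
    apply: ler_mean => [||w]; first exact: bmM.
      by apply: bmD; apply: bmM; (exact: bm_cst || exact: bmX).
    set s := ip _ y; set t := ip _ z.
    have : 0 <= Nk^-1 / 2 * (s - Nk * t) ^+ 2.
      by apply: mulr_ge0; [rewrite divr_ge0// invr_ge0 ltW|exact: sqr_ge0].
    have -> : Nk^-1 / 2 * (s - Nk * t) ^+ 2 =
      Nk^-1 / 2 * s ^+ 2 + Nk / 2 * t ^+ 2 - s * t by field; rewrite gt_eqF.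
    by rewrite subr_ge0.
  rewrite meanD; [|by apply: bmM; (exact: bm_cst || exact: bmX)..].
  rewrite !meanZ; [|exact: bmX..].
  have -> : kappa * ((Nk^-1 * ip y y + Nk * ip z z) / 2) =
    Nk^-1 / 2 * (kappa * ip y y) + Nk / 2 * (kappa * ip z z) by ring.
  by apply: lerD; rewrite ler_wpM2l// ?X_mean2// divr_ge0// ?invr_ge0 ltW.
have : N%:R * (kappa * ((Nk^-1 * ip y y + Nk * ip z z) / 2)) =
    (ip y y + Nk ^+ 2 * ip z z) / 2.
  rewrite mulrA -/Nk; field; rewrite gt_eqF//.
by move=> e; move: h; rewrite e; lra.
Qed.

Definition rest i w (k : D) : R := \sum_(j | j != i) X j w k.

Lemma fnof_rest i k : fnof (Zo i) (fun w => rest i w k).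
Proof. by apply: fnof_sum => j ji; exact: XZo. Qed.

Lemma ip_suml (A : pred 'I_N) (U : 'I_N -> D -> R) v :
  ip (fun k => \sum_(j | A j) U j k) v = \sum_(j | A j) ip (U j) v.
Proof.
by rewrite /ip exchange_big/=; apply: eq_bigr => k _; rewrite mulr_suml.
Qed.

Lemma sum_diag_offdiag (A : pred 'I_N) (F : 'I_N -> 'I_N -> R) :
  \sum_(j | A j) \sum_(k | A k) F j k =
  \sum_(j | A j) F j j +
  \sum_(p : 'I_N * 'I_N | p.1 != p.2) (A p.1 && A p.2)%:R * F p.1 p.2.
Proof.
rewrite pair_big_dep /= (bigID (fun p => p.1 == p.2)) /=; congr (_ + _).
  rewrite (reindex (fun j => (j, j))) /=.
    by apply: eq_bigl => j; rewrite eqxx andbT andbb.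
  by exists fst => [j|[j k]]//=; rewrite inE => /andP[_ /= /eqP ->].
rewrite [RHS]big_mkcond/= [LHS]big_mkcond/=; apply: eq_bigr => -[j k] _ /=.
by case: (A j); case: (A k); case: eqP; rewrite /= ?mul1r ?mul0r.
Qed.

(** The squared norm of [rest i] is split: its diagonal part [V] is at most N pointwise, its
    off-diagonal part [U] has second moment at most 2 N^2, and 2 V^2 + 2 U^2 then has mean at most 6
    N^2. *)
Lemma rest_norm4 i : mean P (fun w => ip (rest i w) (rest i w) ^+ 2) <= 6 * N%:R ^+ 2.
Proof.
pose a (p : 'I_N * 'I_N) : R := ((p.1 != i) && (p.2 != i))%:R.
pose U w := \sum_(p : 'I_N * 'I_N | p.1 != p.2) a p * ip (X p.1 w) (X p.2 w).
have bU : bm U by apply: bm_sum => p _; apply: bmM; [exact: bm_cst|exact: bm_ip].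
apply: (@le_trans _ _ (mean P (fun w => 2 * N%:R ^+ 2 + 2 * U w ^+ 2))).
  apply: ler_mean.
  - by apply: bmX; apply: bm_ip => k; apply: (fnof_bm (@mZo i)); exact: fnof_rest.
  - by apply: bmD; [exact: bm_cst|apply: bmM; [exact: bm_cst|exact: bmX]].
  move=> w; rewrite {1}/rest ip_suml.
  under eq_bigr do rewrite ipC ip_suml.
  rewrite (sum_diag_offdiag (fun j => j != i) (fun j k => ip (X k w) (X j w))).
  have -> : \sum_(p : 'I_N * 'I_N | p.1 != p.2)
      ((p.1 != i) && (p.2 != i))%:R * ip (X p.2 w) (X p.1 w) = U w.
    by apply: eq_bigr => p _; rewrite ipC.
  set V := \sum_(j | _) _.
  have V0 : 0 <= V by apply: sumr_ge0 => j _; exact: ip_ge0.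
  have VN : V <= N%:R by rewrite -[N%:R]mulr1; apply: sum_le_card.
  have : V ^+ 2 <= N%:R ^+ 2 by rewrite ler_sqr// nnegrE.
  have := sqr_ge0 (V - U w).
  by move=> ? ?; nra.
rewrite meanD; [|exact: bm_cst|by apply: bmM; [exact: bm_cst|exact: bmX]].
rewrite mean_cst meanZ; last exact: bmX.
have : mean P (fun w => U w ^+ 2) <= 2 * N%:R ^+ 2; last by lra.
apply: le_trans (mean_weighted_sum_le a) _.
have : \sum_(p : 'I_N * 'I_N | p.1 != p.2) a p ^+ 2 <= N%:R ^+ 2.
  rewrite big_mkcond/= (@le_trans _ _ (\sum_(p : 'I_N * 'I_N) 1))//.
    apply: ler_sum => p _; rewrite /a; case: ifP => //.
    by case: (_ && _); rewrite ?expr1n ?expr0n.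
  by rewrite sumr_const card_prod card_ord expr2 natrM.
have := sqr_ge0 (N%:R : R); move=> N0 aN.
rewrite -mulrA ler_pM2l//; apply: le_trans (ler_wpM2l kappa_ge0 aN) _.
by rewrite ler_piMl.
Qed.

(** * The leave-one-out Stein bound *)

Section stein.
Variables (b L : R) (f g : R -> R).
Hypotheses (cf : continuous f) (cg : continuous g) (L_ge0 : 0 <= L).
Hypothesis taylor : forall x y, `|f y - f x - g x * (y - x)| <= L * (y - x) ^+ 2.
Hypothesis lip : forall x y, `|g y - g x| <= L * `|y - x|.

(** Each unordered pair occurs twice in the sum, whence [b / 2]. *)
Definition qsum w : R :=
  b / 2 * \sum_(p : 'I_N * 'I_N | p.1 != p.2) ip (X p.1 w) (X p.2 w).

Definition qpart i w : R := b * ip (X i w) (rest i w).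

(** Conditional variance of [qpart i] given the other vectors, hence a function of those vectors
    alone. *)
Definition qvar i w : R := b ^+ 2 * ip (rest i w) (mulv (cov i) (rest i w)).

Let qloo i w : R := qsum w - qpart i w.

Lemma offdiag_sumE w :
  \sum_(p : 'I_N * 'I_N | p.1 != p.2) ip (X p.1 w) (X p.2 w) =
  ip (fun k => \sum_j X j w k) (fun k => \sum_j X j w k) - \sum_j ip (X j w) (X j w).
Proof.
rewrite (ip_suml xpredT (fun j => X j w)); under [X in X - _]eq_bigr do rewrite ipC ip_suml.
rewrite (sum_diag_offdiag xpredT (fun j k => ip (X k w) (X j w))) addrAC subrr add0r.
by apply: eq_bigr => p _; rewrite mul1r ipC.
Qed.

Lemma sum_qpart w : \sum_i qpart i w = 2 * qsum w.
Proof.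
rewrite /qsum mulrA (mulrC 2) divfK// /qpart -mulr_sumr; congr (_ * _).
transitivity (\sum_i \sum_(j | j != i) ip (X i w) (X j w)).
  by apply: eq_bigr => i _; rewrite ipC ip_suml; apply: eq_bigr => j _; rewrite ipC.
by rewrite pair_big_dep/=; apply: eq_bigl => p; rewrite eq_sym.
Qed.

Let qloo_fnof i : fnof (Zo i) (qloo i).
Proof.
(* The off-diagonal sum is a squared norm minus a diagonal. Taking out [i] leaves the same
   expression in [rest i], which no longer involves [X i]. *)
have -> : qloo i = fun w => b / 2 * (ip (rest i w) (rest i w) +
    \sum_(j | j != i) (- 1) * ip (X j w) (X j w)).
  apply/funext => w; rewrite /qloo /qsum /qpart offdiag_sumE.
  rewrite (bigD1 i)//= -mulr_sumr.
  have -> : ip (fun k => \sum_j X j w k) (fun k => \sum_j X j w k) =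
      ip (X i w) (X i w) + 2 * ip (X i w) (rest i w) + ip (rest i w) (rest i w).
    rewrite /ip mulr_sumr -!big_split/=; apply: eq_bigr => k _.
    by rewrite (bigD1 i)//= -/(rest i w k); ring.
  by field.
apply: fnofM; first exact: fnof_cst.
apply: fnofD; first by apply: fnof_ip => k; exact: fnof_rest.
apply: fnof_sum => j ji; apply: fnofM; first exact: fnof_cst.
by apply: fnof_ip => k; exact: XZo.
Qed.

Let bm_rest i k : bm (fun w => rest i w k).
Proof. exact: (fnof_bm (@mZo i)) (fnof_rest i k). Qed.

Lemma bm_qpart i : bm (qpart i).
Proof. by apply: bmM; [exact: bm_cst|exact: bm_ip]. Qed.

Lemma bm_qsum : bm qsum.
Proof. by apply: bmM; [exact: bm_cst|apply: bm_sum => p _; exact: bm_ip]. Qed.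

Let qvar_fnof i : fnof (Zo i) (qvar i).
Proof.
apply: fnofM; first exact: fnof_cst.
by apply: fnof_ip => k; [exact: fnof_rest|apply: fnof_mulv => l; exact: fnof_rest].
Qed.

Lemma bm_qvar i : bm (qvar i).
Proof. exact: (fnof_bm (@mZo i)). Qed.

Let bm_qloo i : bm (qloo i). Proof. exact: (fnof_bm (@mZo i)). Qed.

Lemma qvar_ge0 i w : 0 <= qvar i w.
Proof.
apply: mulr_ge0; first exact: sqr_ge0.
by rewrite -mean_ip_ip; apply: mean_ge0 => v; rewrite -expr2 sqr_ge0.
Qed.

Lemma qvar_le i w : qvar i w <= b ^+ 2 * kappa * ip (rest i w) (rest i w).
Proof.
rewrite /qvar -mulrA ler_wpM2l ?sqr_ge0//.
by rewrite -mean_ip_ip; under eq_mean do rewrite -expr2; exact: X_mean2.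
Qed.

(** The identities [E1_] and [E2_] are exact because [qloo i] does not involve [X i]. [D1] is a
    Taylor remainder centred at the full sum; [D2] and [D3] move [g] between the full and the
    leave-one-out value by the Lipschitz bound. [D1] and [D2] each cost the third absolute moment of
    [qpart i]. *)
Lemma mean_qpart_stein i :
  `|mean P (fun w => qpart i w * f (qsum w)) - mean P (fun w => qvar i w * g (qsum w))|
  <= L * (2 * mean P (fun w => `|qpart i w| ^+ 3) + mean P (fun w => qvar i w * `|qpart i w|)).
Proof.
have bS := bm_qsum; have bp := bm_qpart i; have bv := bm_qvar i; have bl := bm_qloo i.
have bfS : bm (fun w => f (qsum w)) by exact: bm_comp_cont.
have bgS : bm (fun w => g (qsum w)) by exact: bm_comp_cont.
have bfl : bm (fun w => f (qloo i w)) by exact: bm_comp_cont.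
have bgl : bm (fun w => g (qloo i w)) by exact: bm_comp_cont.
have bp3 : bm (fun w => `|qpart i w| ^+ 3) by apply: bmX; exact: bm_norm.
have bvp : bm (fun w => qvar i w * `|qpart i w|) by apply: bmM => //; exact: bm_norm.
have E1_ : mean P (fun w => qpart i w * f (qloo i w)) = 0.
  rewrite -(@mean_lin0 i (fun w k => (b * f (qloo i w)) * rest i w k)).
    apply: eq_mean => w; rewrite /qpart /ip mulr_sumr mulr_suml.
    by apply: eq_bigr => k _; ring.
  move=> k; apply: fnofM; last exact: fnof_rest.
  by apply: fnofM; [exact: fnof_cst|exact: fnof_comp_cont].
have E2_ : mean P (fun w => qpart i w ^+ 2 * g (qloo i w)) =
    mean P (fun w => qvar i w * g (qloo i w)).
  rewrite (eq_mean P (V := fun w => ip (X i w) (rest i w) ^+ 2 * (b ^+ 2 * g (qloo i w)))).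
    rewrite mean_ip2; first last.
    - by apply: fnofM; [exact: fnof_cst|exact: fnof_comp_cont].
    - by move=> k; exact: fnof_rest.
    apply: eq_mean => w; rewrite /qvar -mean_ip_ip mulrA; congr (_ * _).
    by rewrite mulrC; congr (_ * _); apply: eq_mean => v; rewrite expr2.
  by move=> w; rewrite /qpart exprMn; ring.
pose D1 w := qpart i w * f (qsum w) - qpart i w * f (qloo i w) - qpart i w ^+ 2 * g (qsum w).
pose D2 w := qpart i w ^+ 2 * g (qsum w) - qpart i w ^+ 2 * g (qloo i w).
pose D3 w := qvar i w * g (qloo i w) - qvar i w * g (qsum w).
have b1 : bm D1.
  by apply: bmB; [apply: bmB; exact: bmM|apply: bmM => //; exact: bmX].
have b2 : bm D2 by apply: bmB; apply: bmM => //; exact: bmX.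
have b3 : bm D3 by apply: bmB; exact: bmM.
have -> : mean P (fun w => qpart i w * f (qsum w)) - mean P (fun w => qvar i w * g (qsum w)) =
    mean P D1 + mean P D2 + mean P D3.
  rewrite /D1 /D2 /D3 !meanB ?E1_ ?E2_; [ring|..];
    by [exact: bmM|apply: bmM => //; exact: bmX|apply: bmB; exact: bmM].
apply: le_trans (ler_normD _ _) _; apply: le_trans (lerD (ler_normD _ _) (lexx _)) _.
have h1 : `|mean P D1| <= L * mean P (fun w => `|qpart i w| ^+ 3).
  apply: le_trans (ler_norm_mean P b1) _; rewrite -meanZ//.
  apply: ler_mean; [exact: bm_norm|by apply: bmM => //; exact: bm_cst|move=> w].
  have -> : D1 w = - (qpart i w * (f (qloo i w) - f (qsum w) -
      g (qsum w) * (qloo i w - qsum w))) by rewrite /D1 /qloo; ring.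
  rewrite normrN normrM exprS (mulrCA L) ler_wpM2l//.
  apply: le_trans (taylor _ _) _; rewrite /qloo.
  by rewrite (_ : _ - _ - _ = - qpart i w) ?sqrrN ?real_normK ?num_real//; ring.
have h2 : `|mean P D2| <= L * mean P (fun w => `|qpart i w| ^+ 3).
  apply: le_trans (ler_norm_mean P b2) _; rewrite -meanZ//.
  apply: ler_mean; [exact: bm_norm|by apply: bmM => //; exact: bm_cst|move=> w].
  rewrite /D2 -mulrBr normrM normrX [in leRHS]exprSr mulrCA ler_wpM2l ?exprn_ge0//.
  apply: le_trans (lip _ _) _.
  by rewrite /qloo opprB addrC subrK.
have h3 : `|mean P D3| <= L * mean P (fun w => qvar i w * `|qpart i w|).
  apply: le_trans (ler_norm_mean P b3) _; rewrite -meanZ//.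
  apply: ler_mean; [exact: bm_norm|by apply: bmM => //; exact: bm_cst|move=> w].
  rewrite /D3 -mulrBr normrM ger0_norm ?qvar_ge0// mulrCA ler_wpM2l ?qvar_ge0//.
  by apply: le_trans (lip _ _) _; rewrite /qloo addrAC subrr add0r normrN.
by rewrite mulrDr (mulrA L) (mulrC L 2) -mulrA (_ : 2 * _ = L * mean P (fun w => `|qpart i w| ^+ 3) + L * mean P (fun w => `|qpart i w| ^+ 3)); [rewrite !lerD|ring].
Qed.

(** [beta] controls the total variance, [K] the ratio of fourth moments to squared second moments,
    [eta] the error in the mean variance. For the statistic they are 4, 27 and (2 p + 5) / m. *)
Variables (beta K eta : R).
Hypothesis beta_ge : b ^+ 2 * kappa * N%:R ^+ 2 <= beta.
Hypothesis kappa4_le : kappa4 <= K * kappa ^+ 2.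
Hypothesis K_ge1 : 1 <= K.
Hypothesis g_le : forall x, `|g x| <= L.
Hypothesis mean_var : `|b ^+ 2 / 2 *
  (\sum_(p : 'I_N * 'I_N | p.1 != p.2) mean P (fun w => ip (X p.1 w) (X p.2 w) ^+ 2))
  - 1| <= eta.

Let NR : R := N%:R.
Let NR_gt0 : 0 < NR. Proof. by rewrite ltr0n. Qed.
Let sN : R := Num.sqrt NR.
Let sN_gt0 : 0 < sN. Proof. by rewrite sqrtr_gt0. Qed.
Let sN_sq : sN ^+ 2 = NR. Proof. by rewrite sqr_sqrtr// ltW. Qed.
Let bk : R := b ^+ 2 * kappa.
Let bk_ge0 : 0 <= bk. Proof. by rewrite mulr_ge0// sqr_ge0. Qed.
Let beta_ge0 : 0 <= beta.
Proof. by apply: le_trans beta_ge; rewrite mulr_ge0// sqr_ge0. Qed.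
Let K_ge0 : 0 <= K. Proof. by apply: le_trans K_ge1. Qed.

Let bm_nsq i : bm (fun w => ip (rest i w) (rest i w)).
Proof. by apply: bm_ip => k; exact: bm_rest. Qed.

Lemma rest_norm2 i : mean P (fun w => ip (rest i w) (rest i w)) <= 4 * NR.
Proof.
(* With x <= N/2 + x^2 / (2 N), the bound 6 N^2 on the mean of x^2 gives 7 N / 2. *)
apply: (@le_trans _ _ (mean P (fun w => NR / 2 + NR^-1 / 2 * ip (rest i w) (rest i w) ^+ 2))).
  apply: ler_mean => // [|w].
    by apply: bmD; [exact: bm_cst|apply: bmM; [exact: bm_cst|exact: bmX]].
  set x := ip _ _.
  have : 0 <= NR^-1 / 2 * (NR - x) ^+ 2.
    by apply: mulr_ge0; [rewrite divr_ge0// invr_ge0 ltW|exact: sqr_ge0].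
  have -> : NR^-1 / 2 * (NR - x) ^+ 2 = NR / 2 + NR^-1 / 2 * x ^+ 2 - x.
    by field; rewrite gt_eqF.
  by rewrite subr_ge0.
rewrite meanD; [|exact: bm_cst|by apply: bmM; [exact: bm_cst|exact: bmX]].
rewrite mean_cst meanZ; last exact: bmX.
have : NR^-1 / 2 * mean P (fun w => ip (rest i w) (rest i w) ^+ 2) <=
    NR^-1 / 2 * (6 * NR ^+ 2).
  by rewrite ler_wpM2l ?rest_norm4// divr_ge0// invr_ge0 ltW.
have -> : NR^-1 / 2 * (6 * NR ^+ 2) = 3 * NR by field; rewrite gt_eqF.
set M := _ * mean _ _; have := NR_gt0; lra.
Qed.

Let betaN : bk * NR <= beta / NR.
Proof.
by rewrite ler_pdivlMr// -mulrA -expr2.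
Qed.

Let beta2N : bk ^+ 2 * NR ^+ 2 <= beta ^+ 2 / NR ^+ 2.
Proof.
rewrite ler_pdivlMr ?exprn_gt0//.
have -> : bk ^+ 2 * NR ^+ 2 * NR ^+ 2 = (bk * NR ^+ 2) ^+ 2 by ring.
by rewrite ler_sqr ?nnegrE// mulr_ge0// sqr_ge0.
Qed.

Lemma mean_qpart2_le i : mean P (fun w => qpart i w ^+ 2) <= 4 * beta / NR.
Proof.
under eq_mean do rewrite exprMn.
rewrite meanZ; last by apply: bmX; exact: bm_ip.
apply: (@le_trans _ _ (b ^+ 2 * (kappa * (4 * NR)))).
  rewrite ler_wpM2l ?sqr_ge0//; apply: le_trans (@mean_ip2_le i (rest i) _) _.
    by move=> k; exact: fnof_rest.
  by rewrite ler_wpM2l// rest_norm2.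
by move: betaN; rewrite /bk; lra.
Qed.

Lemma mean_qpart4_le i :
  mean P (fun w => qpart i w ^+ 4) <= 6 * K * beta ^+ 2 / NR ^+ 2.
Proof.
under eq_mean do rewrite exprMn.
rewrite meanZ; last by apply: bmX; exact: bm_ip.
have b40 : 0 <= b ^+ 4 by rewrite (exprM b 2 2) sqr_ge0.
apply: (@le_trans _ _ (b ^+ 4 * (K * kappa ^+ 2 * (6 * NR ^+ 2)))).
  rewrite ler_wpM2l//; apply: le_trans (@mean_ip4_le i (rest i) _) _.
    by move=> k; exact: fnof_rest.
  set M := mean P _; have M0 : 0 <= M by apply: mean_ge0 => w; exact: sqr_ge0.
  apply: le_trans (ler_wpM2r M0 kappa4_le) _.
  by rewrite ler_wpM2l ?rest_norm4// mulr_ge0// sqr_ge0.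
have -> : b ^+ 4 * (K * kappa ^+ 2 * (6 * NR ^+ 2)) = 6 * K * (bk ^+ 2 * NR ^+ 2).
  by rewrite /bk; ring.
by rewrite -[leRHS]mulrA ler_wpM2l// mulr_ge0.
Qed.

Lemma mean_qvar2_le i : mean P (fun w => qvar i w ^+ 2) <= 6 * K * beta ^+ 2 / NR ^+ 2.
Proof.
apply: (@le_trans _ _ (bk ^+ 2 * (6 * NR ^+ 2))).
  apply: (@le_trans _ _ (mean P (fun w => bk ^+ 2 * ip (rest i w) (rest i w) ^+ 2))).
    apply: ler_mean => [||w]; first by apply: bmX; exact: bm_qvar.
      by apply: bmM; [exact: bm_cst|exact: bmX].
    rewrite -exprMn ler_sqr ?nnegrE ?qvar_ge0 ?qvar_le//.
    by rewrite mulr_ge0// ip_ge0.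
  by rewrite meanZ; [rewrite ler_wpM2l ?sqr_ge0// rest_norm4|exact: bmX].
have : 6 * (bk ^+ 2 * NR ^+ 2) <= 6 * (beta ^+ 2 / NR ^+ 2) by rewrite ler_pM2l.
have h : 0 <= beta ^+ 2 / NR ^+ 2 by rewrite divr_ge0// sqr_ge0.
have : beta ^+ 2 / NR ^+ 2 <= K * (beta ^+ 2 / NR ^+ 2) by rewrite ler_peMl.
lra.
Qed.

(** Common bound for the third-order terms. Second and fourth moments are of orders 1/N and 1/N^2,
    and the AM-GM weights 1 / sqrt N and sqrt N balance them; summed over N indices this leaves
    order 1 / sqrt N. *)
Let small := (2 * beta + 3 * K * beta ^+ 2) / (NR * sN).

Let smallE : (sN^-1 * (4 * beta / NR) + sN * (6 * K * beta ^+ 2 / NR ^+ 2)) / 2 = small.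
Proof. by rewrite /small -sN_sq; field; rewrite gt_eqF. Qed.

Lemma mean_qpart3_le i : mean P (fun w => `|qpart i w| ^+ 3) <= small.
Proof.
have bp := bm_qpart i.
rewrite -smallE.
apply: (@le_trans _ _ (mean P (fun w => sN^-1 / 2 * qpart i w ^+ 2 + sN / 2 * qpart i w ^+ 4))).
  apply: ler_mean => [||w]; first by apply: bmX; exact: bm_norm.
    by apply: bmD; apply: bmM; (exact: bm_cst || exact: bmX).
  rewrite -(@real_normK _ (qpart i w) (num_real _)).
  have -> : qpart i w ^+ 4 = `|qpart i w| ^+ 4.
    by rewrite -[RHS]normrX ger0_norm// (exprM _ 2 2) sqr_ge0.
  set x := `|qpart i w|.
  have : 0 <= sN / 2 * (x * (x - sN^-1)) ^+ 2.
    by apply: mulr_ge0; [rewrite divr_ge0// ltW|exact: sqr_ge0].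
  have -> : sN / 2 * (x * (x - sN^-1)) ^+ 2 =
      sN^-1 / 2 * x ^+ 2 + sN / 2 * x ^+ 4 - x ^+ 3 by field; rewrite gt_eqF.
  by rewrite subr_ge0.
rewrite meanD; [|by apply: bmM; (exact: bm_cst || exact: bmX)..].
rewrite !meanZ; [|exact: bmX..].
have -> : forall u v : R, (sN^-1 * u + sN * v) / 2 = sN^-1 / 2 * u + sN / 2 * v by move=> u v; ring.
apply: lerD; rewrite ler_wpM2l ?mean_qpart2_le ?mean_qpart4_le// divr_ge0// ?invr_ge0 ltW//.
Qed.

Lemma mean_qvar_qpart_le i : mean P (fun w => qvar i w * `|qpart i w|) <= small.
Proof.
have bp := bm_qpart i; have bv := bm_qvar i.
rewrite -smallE.
apply: (@le_trans _ _ (mean P (fun w => sN^-1 / 2 * qpart i w ^+ 2 + sN / 2 * qvar i w ^+ 2))).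
  apply: ler_mean => [||w]; first by apply: bmM => //; exact: bm_norm.
    by apply: bmD; apply: bmM; (exact: bm_cst || exact: bmX).
  rewrite -(@real_normK _ (qpart i w) (num_real _)).
  set x := `|qpart i w|; set y := qvar i w.
  have : 0 <= sN / 2 * (y - sN^-1 * x) ^+ 2.
    by apply: mulr_ge0; [rewrite divr_ge0// ltW|exact: sqr_ge0].
  have -> : sN / 2 * (y - sN^-1 * x) ^+ 2 =
      sN^-1 / 2 * x ^+ 2 + sN / 2 * y ^+ 2 - y * x by field; rewrite gt_eqF.
  by rewrite subr_ge0.
rewrite meanD; [|by apply: bmM; (exact: bm_cst || exact: bmX)..].
rewrite !meanZ; [|exact: bmX..].
have -> : forall u v : R, (sN^-1 * u + sN * v) / 2 = sN^-1 / 2 * u + sN / 2 * v by move=> u v; ring.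
apply: lerD; rewrite ler_wpM2l ?mean_qpart2_le ?mean_qvar2_le// divr_ge0// ?invr_ge0 ltW//.
Qed.

(** The sum of the conditional variances is a quadratic form in the vectors. [dg] collects its
    diagonal, a sum of independent terms, and [off] its off-diagonal, a degenerate sum; each gets
    its own variance bound. *)
Let dg j w : R := ip (X j w) (mulv (cov_sum (fun i => i != j)) (X j w)).

Let off (p : 'I_N * 'I_N) w : R :=
  ip (X p.1 w) (mulv (cov_sum (fun i => (i != p.1) && (i != p.2))) (X p.2 w)).

Let sum_qvar w : \sum_i qvar i w =
  b ^+ 2 * (\sum_j dg j w + \sum_(p : 'I_N * 'I_N | p.1 != p.2) off p w).
Proof.
rewrite /qvar -mulr_sumr; congr (_ * _).
have e i : ip (rest i w) (mulv (cov i) (rest i w)) =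
    \sum_j (i != j)%:R * ip (X j w) (mulv (cov i) (X j w)) +
    \sum_(p : 'I_N * 'I_N | p.1 != p.2)
      ((i != p.1) && (i != p.2))%:R * ip (X p.1 w) (mulv (cov i) (X p.2 w)).
  rewrite {1}/rest ip_suml.
  under eq_bigr do rewrite ip_mulv_tr ip_suml.
  rewrite (sum_diag_offdiag (fun j => j != i)
    (fun j k => ip (X k w) (mulv (fun a c => cov i c a) (X j w)))).
  congr (_ + _).
    rewrite big_mkcond/=; apply: eq_bigr => j _; rewrite eq_sym ip_mulv_tr.
    by case: ifP; rewrite ?mul1r ?mul0r.
  by apply: eq_bigr => p _; rewrite ip_mulv_tr !(eq_sym i).
rewrite (eq_bigr _ (fun i _ => e i)) big_split/=; congr (_ + _).
  rewrite exchange_big/=; apply: eq_bigr => j _; rewrite /dg mulv_cov_sum [RHS]big_mkcond/=.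
  by apply: eq_bigr => i _; case: ifP; rewrite ?mul1r ?mul0r.
rewrite exchange_big/=; apply: eq_bigr => p _; rewrite /off mulv_cov_sum [RHS]big_mkcond/=.
by apply: eq_bigr => i _; case: ifP; rewrite ?mul1r ?mul0r.
Qed.

Let fnof_dg j : fnof (Y j) (dg j).
Proof. by apply: fnof_ip => // k; exact: fnof_mulv. Qed.

Let fnof_dg_other i j : j != i -> fnof (Zo i) (dg j).
Proof.
by move=> ji; apply: fnof_ip => k; [|apply: fnof_mulv => l]; exact: XZo.
Qed.

Let bm_dg j : bm (dg j). Proof. exact: (fnof_bm (@mY j)). Qed.

Let bm_off p : bm (off p).
Proof.
apply: bm_ip => // k; apply: bm_ip => // l; exact: bm_cst.
Qed.

Let mean_dg j : mean P (dg j) = \sum_(i | i != j) mean P (fun w => ip (X j w) (X i w) ^+ 2).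
Proof.
rewrite /dg (eq_mean P (V := fun w => \sum_(i | i != j) ip (X j w) (mulv (cov i) (X j w)))) => [|w]; last first.
  by rewrite mulv_cov_sum.
rewrite mean_sum => [|i _]; last first.
  by apply: bm_ip => // k; apply: bm_ip => // l; exact: bm_cst.
apply: eq_bigr => i ij.
rewrite [RHS](eq_mean P (V := fun w => ip (X i w) (X j w) ^+ 2 * 1)) => [|w]; last first.
  by rewrite ipC mulr1.
rewrite mean_ip2; [|by move=> k; apply: XZo; rewrite eq_sym|exact: fnof_cst].
apply: eq_mean => w; rewrite mulr1 -mean_ip_ip; apply: eq_mean => v; exact: expr2.
Qed.

Let dg_ge0 j w : 0 <= dg j w. Proof. exact: ip_cov_sum_ge0. Qed.

Let dg_le j w : dg j w <= Nk.
Proof.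
apply: le_trans (ip_cov_sum_le _ _) _; rewrite ler_piMr//; exact: ltW.
Qed.

Let mean_dg_sum_var : mean P (fun w => (\sum_j (dg j w - mean P (dg j))) ^+ 2) <= NR * Nk ^+ 2.
Proof.
pose e j w := dg j w - mean P (dg j).
have be j : bm (e j) by apply: bmB => //; exact: bm_cst.
rewrite (eq_mean P (V := fun w => \sum_j \sum_k e j w * e k w)) => [|w]; last first.
  by rewrite expr2 big_distrlr.
rewrite mean_sum => [|j _]; last by apply: bm_sum => k _; exact: bmM.
apply: sum_le_card => [|j]; first exact: sqr_ge0.
rewrite mean_sum => [|k _]; last exact: bmM.
have e0 k : mean P (e k) = 0.
  by rewrite meanB ?mean_cst ?subrr//; exact: bm_cst.
rewrite (bigD1 j)//= big1 => [|k kj]; last first.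
  rewrite (@indep j) ?e0 ?mul0r//.
    by apply: fnofD => //; exact: fnof_cst.
  by apply: fnofD; [exact: fnof_dg_other|exact: fnof_cst].
rewrite addr0; apply: mean_le_cst => [|w]; first exact: bmM.
have m0 : 0 <= mean P (dg j) by exact: mean_ge0.
have m1 : mean P (dg j) <= Nk by exact: mean_le_cst.
move: (dg_ge0 j w) (dg_le j w) m0 m1; rewrite /e.
set x := dg j w; set y := mean P (dg j) => x0 x1 y0 y1.
rewrite -expr2 -real_normK ?num_real// ler_sqr ?nnegrE ?normr_ge0 ?(ltW Nk_gt0)//.
by rewrite ler_norml; apply/andP; split; lra.
Qed.

(** The degenerate-sum bound applies with the kernels [cov_sum], of operator norm at most N [kappa];
    averaging over the first vector of each pair brings one more factor [kappa]. *)
Let mean_off_var : mean P (fun w => (\sum_(p : 'I_N * 'I_N | p.1 != p.2) off p w) ^+ 2) <=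
  2 * (NR ^+ 2 * (kappa * Nk ^+ 2)).
Proof.
apply: le_trans (mean_degenerate_sum
  (fun j k => cov_sum (fun i => (i != j) && (i != k)))) _.
rewrite ler_pM2l//.
have c0 : 0 <= kappa * Nk ^+ 2 by rewrite mulr_ge0// sqr_ge0.
apply: (@le_trans _ _ (\sum_(p : 'I_N * 'I_N) kappa * Nk ^+ 2)); last first.
  by rewrite sumr_const card_prod card_ord -mulr_natl natrM expr2.
rewrite big_mkcond/=; apply: ler_sum => p _; case: ifP => // p12.
apply: le_trans (@mean_offdiag_sq_le (fun j k => cov_sum (fun i => (i != j) && (i != k))) p p12) _.
rewrite ler_wpM2l//; apply: mean_le_cst => [|w].
  by apply: bm_ip => k; apply: bm_ip => // l; exact: bm_cst.
apply: le_trans (norm_cov_sum_le _ _) _.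
by rewrite ler_piMr// sqr_ge0.
Qed.

(** The diagonal fluctuation contributes 1/N and the off-diagonal one [kappa]. The latter is where
    small covariance operators matter: without them this bound would not vanish as N grows. *)
Lemma mean_half_qvar_dist : mean P (fun w => `|(\sum_i qvar i w) / 2 - 1|) <=
  eta + beta * Num.sqrt (NR^-1 + kappa).
Proof.
pose c := b ^+ 2 / 2 * \sum_j mean P (dg j).
have c1 : `|c - 1| <= eta.
  rewrite /c; under eq_bigr do rewrite mean_dg.
  rewrite pair_big_dep/=; move: mean_var; congr (`|_ * _ - _| <= _).
  by apply: eq_bigl => p; rewrite eq_sym.
pose D1 w := \sum_j (dg j w - mean P (dg j)).
pose D2 w := \sum_(p : 'I_N * 'I_N | p.1 != p.2) off p w.
have b1 : bm D1 by apply: bm_sum => j _; apply: bmB => //; exact: bm_cst.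
have b2 : bm D2 by exact: bm_sum.
pose DD w := b ^+ 2 / 2 * (D1 w + D2 w).
have bDD : bm DD by apply: bmM; [exact: bm_cst|exact: bmD].
have e w : (\sum_i qvar i w) / 2 - 1 = DD w + (c - 1).
  by rewrite sum_qvar /DD /D1 /D2 /c sumrB; ring.
apply: (@le_trans _ _ (mean P (fun w => `|DD w| + `|c - 1|))).
  apply: ler_mean => [||w].
  - by rewrite (funext (fun w => congr1 _ (e w))); apply: bm_norm; apply: bmD => //; exact: bm_cst.
  - by apply: bmD; [exact: bm_norm|exact: bm_cst].
  - by rewrite e ler_normD.
rewrite meanD; [|exact: bm_norm|exact: bm_cst].
rewrite mean_cst addrC lerD//.
apply: le_trans (mean_norm_le_sqrt P bDD) _.
rewrite -[beta]ger0_norm// -sqrtr_sqr -sqrtrM ?sqr_ge0// ler_wsqrtr//.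
apply: (@le_trans _ _ (mean P (fun w => b ^+ 4 / 2 * (D1 w ^+ 2 + D2 w ^+ 2)))).
  apply: ler_mean => [||w]; first exact: bmX.
    by apply: bmM; [exact: bm_cst|apply: bmD; exact: bmX].
  have -> : DD w ^+ 2 = b ^+ 4 / 4 * (D1 w + D2 w) ^+ 2 by rewrite /DD; field.
  have : 0 <= b ^+ 4 / 4 * (D1 w - D2 w) ^+ 2.
    by rewrite mulr_ge0 ?sqr_ge0// divr_ge0// (exprM b 2 2) sqr_ge0.
  have -> : b ^+ 4 / 4 * (D1 w - D2 w) ^+ 2 =
    b ^+ 4 / 2 * (D1 w ^+ 2 + D2 w ^+ 2) - b ^+ 4 / 4 * (D1 w + D2 w) ^+ 2 by field.
  by rewrite subr_ge0.
rewrite meanZ; last by apply: bmD; exact: bmX.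
rewrite meanD; [|exact: bmX..].
apply: (@le_trans _ _ (b ^+ 4 / 2 * (NR * Nk ^+ 2 + 2 * (NR ^+ 2 * (kappa * Nk ^+ 2))))).
  rewrite ler_wpM2l//; first by rewrite divr_ge0// (exprM b 2 2) sqr_ge0.
  by apply: lerD.
have -> : b ^+ 4 / 2 * (NR * Nk ^+ 2 + 2 * (NR ^+ 2 * (kappa * Nk ^+ 2))) =
    (bk * NR ^+ 2) ^+ 2 * (NR^-1 / 2 + kappa).
  by rewrite /bk /Nk -/NR; field; rewrite gt_eqF.
apply: ler_pM.
- exact: sqr_ge0.
- by rewrite addr_ge0// divr_ge0// invr_ge0 ltW.
- by rewrite ler_sqr ?nnegrE// mulr_ge0// sqr_ge0.
- rewrite lerD2r; have i0 : 0 < NR^-1 by rewrite invr_gt0.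
  by move: i0; set r := NR^-1 => r0; lra.
Qed.

(* Leave-one-out Stein argument: with [S i = qpart i], which is linear in [X i]
   given the other vectors, [2 S f(S) = sum_i S i f(S)] is expanded around
   [S - S i], which does not depend on [X i]; the conditional variances
   [qvar i] then add up to nearly [2]. *)
Theorem quadratic_form_stein :
  `|mean P (fun w => qsum w * f (qsum w)) - mean P (fun w => g (qsum w))| <=
  L * (3 / 2 * (2 * beta + 3 * K * beta ^+ 2) / sN +
       (eta + beta * Num.sqrt (NR^-1 + kappa))).
Proof.
have bS := bm_qsum; have bp := bm_qpart; have bv := bm_qvar.
have bfS : bm (fun w => f (qsum w)) by exact: bm_comp_cont.
have bgS : bm (fun w => g (qsum w)) by exact: bm_comp_cont.
pose V w := (\sum_i qvar i w) / 2 - 1.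
have bV : bm V.
  by apply: bmB; [apply: bmM; [exact: bm_sum|exact: bm_cst]|exact: bm_cst].
have e1 : mean P (fun w => qsum w * f (qsum w)) =
    2^-1 * \sum_i mean P (fun w => qpart i w * f (qsum w)).
  rewrite -mean_sum => [|i _]; last exact: bmM.
  rewrite -meanZ; last by apply: bm_sum => i _; exact: bmM.
  by apply: eq_mean => w; rewrite -mulr_suml sum_qpart; field.
have e2 : mean P (fun w => V w * g (qsum w)) + mean P (fun w => g (qsum w)) =
    2^-1 * \sum_i mean P (fun w => qvar i w * g (qsum w)).
  rewrite -mean_sum => [|i _]; last exact: bmM.
  rewrite -meanZ; last by apply: bm_sum => i _; exact: bmM.
  rewrite -meanD//; last exact: bmM.
  by apply: eq_mean => w; rewrite -mulr_suml /V; field.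
have -> : mean P (fun w => qsum w * f (qsum w)) - mean P (fun w => g (qsum w)) =
  2^-1 * \sum_i (mean P (fun w => qpart i w * f (qsum w)) -
     mean P (fun w => qvar i w * g (qsum w))) + mean P (fun w => V w * g (qsum w)).
  by rewrite sumrB mulrBr -e1 -e2; ring.
apply: le_trans (ler_normD _ _) _; rewrite mulrDr; apply: lerD.
  rewrite normrM ger0_norm//.
  apply: (@le_trans _ _ (2^-1 * (NR * (L * (3 * small))))); last first.
    by rewrite le_eqVlt; apply/orP; left; apply/eqP; rewrite /small; field; rewrite !gt_eqF.
  rewrite ler_wpM2l//; apply: le_trans (ler_norm_sum _ _ _) _.
  have s0 : 0 <= small.
    apply: divr_ge0; last by apply: mulr_ge0; exact: ltW.
    by rewrite addr_ge0 ?mulr_ge0 ?sqr_ge0.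
  apply: sum_le_card => [|i].
    by apply: mulr_ge0 => //; apply: mulr_ge0.
  apply: le_trans (mean_qpart_stein i) _; rewrite ler_wpM2l//.
  by have := mean_qpart3_le i; have := mean_qvar_qpart_le i; lra.
apply: le_trans (ler_norm_mean P _) _; first exact: bmM.
apply: (@le_trans _ _ (mean P (fun w => L * `|V w|))).
  apply: ler_mean => [||w]; first by apply: bm_norm; exact: bmM.
    by apply: bmM; [exact: bm_cst|exact: bm_norm].
  by rewrite normrM mulrC ler_wpM2r.
by rewrite meanZ ?ler_wpM2l ?mean_half_qvar_dist//; exact: bm_norm.
Qed.

End stein.

End quadratic_form_sum.

(** * The Stein equation and convergence in distribution *)

Section normal_law.
Context {R : realType}.

(* The random variable whose law is [normal_prob], which lives on the alias
   [measurableTypeR R] of [R]. *)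
Definition idR (x : measurableTypeR R) : R := x.

HB.instance Definition _ :=
  @isMeasurableFun.Build _ _ _ _ idR (@measurable_id _ _ setT).

Lemma integral_normal_law d (Om : measurableType d) (P : probability Om R)
    (X : {RV P >-> R}) (m s : R) (f : R -> \bar R) : measurable_fun [set: R] f ->
  (forall A, measurable A -> distribution P X A = normal_prob m s A) ->
  (\int[distribution P X]_x f x = \int[normal_prob m s]_x f x)%E.
Proof.
move=> mf H.
transitivity (\int[distribution (normal_prob m s) idR]_x f x)%E.
  by apply: eq_measure_integral => A mA _; exact: (H A mA).
by rewrite (@integral_distribution_measurable _ _ _ _ _ (normal_prob m s) idR).
Qed.
End normal_law.

(** * The standard normal density, its distribution function and the Mills ratio *)

Section normal_density_ode.
Context {R : realType}.
Implicit Types x y : R.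

Definition phi x : R := normal_pdf 0 1 x.

Lemma phiE x : phi x = normal_peak 1 * expR (- x ^+ 2 / 2).
Proof. by rewrite /phi normal_pdfE ?oner_neq0// /normal_fun subr0 expr1n. Qed.

Lemma phi_gt0 x : 0 < phi x.
Proof. by rewrite phiE mulr_gt0 ?expR_gt0// normal_peak_gt0// oner_neq0. Qed.

Lemma is_derive_phi x : is_derive x 1 phi (- x * phi x).
Proof.
rewrite (_ : phi = (fun x => normal_peak 1 * expR (- x ^+ 2 / 2))); last first.
  by apply/funext => y; rewrite phiE.
have d1 : is_derive x 1 (fun y : R => - y ^+ 2 / 2) (- x).
  by apply: is_derive_eq; rewrite ?scaler0 /GRing.scale/=; field.
have d2 : is_derive x 1 (fun y => expR (- y ^+ 2 / 2)) (expR (- x ^+ 2 / 2) * - x).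
  exact: (is_derive1_comp (f := expR)).
by apply: is_derive_eq; rewrite ?scaler0 /GRing.scale/=; ring.
Qed.

Lemma continuous_phi : continuous phi.
Proof. by apply: continuous_normal_pdf; exact: oner_neq0. Qed.

Lemma is_derive_primitive (k : R -> R) x : lebesgue_measure.-integrable setT (EFin \o k) ->
  {for x, continuous k} ->
  is_derive x 1 (fun y => \int[lebesgue_measure]_(t in `]-oo, y]) k t) (k x).
Proof.
move=> ik ck.
have ik' : lebesgue_measure.-integrable `]-oo, x + 1] (EFin \o k).
  by apply: integrableS ik.
have xx : x < x + 1 by rewrite ltrDl.
have [dk kE] := continuous_FTC1 xx ik' (ltNyr _) ck.
by apply: DeriveDef; [exact: dk|rewrite -derive1E; exact: kE].
Qed.

Lemma nonincreasing_to0_ge0 (F dF : R -> R) x :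
  (forall y, x <= y -> is_derive y 1 F (dF y)) -> (forall y, x <= y -> dF y <= 0) ->
  F y @[y --> +oo] --> (0 : R) -> 0 <= F x.
Proof.
move=> FdF dF0 F0; apply: (cvgr_to_le F0); near=> y.
have xy : x < y by near: y; apply: nbhs_pinfty_gt; exact: num_real.
have [||c cxy e] := @MVT_segment R F dF x y (ltW xy).
- move=> z; rewrite in_itv/= => /andP[/ltW xz _]; exact: FdF.
- apply: derivable_within_continuous => z; rewrite in_itv/= => /andP[xz _].
  by have [] := FdF _ xz.
move: cxy; rewrite in_itv/= => /andP[xc _].
have : F y - F x <= 0.
  by rewrite e mulr_le0_ge0 ?subr_ge0 ?(ltW xy)//; exact: dF0.
lra.
Unshelve. all: by end_near. Qed.

Lemma is_derive1V (f : R -> R) x df : f x != 0 -> is_derive x 1 f df ->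
  is_derive x 1 (fun y => (f y)^-1) (- df / f x ^+ 2).
Proof.
move=> fx0 [dfx <-]; apply: DeriveDef; first exact: derivableV.
by rewrite deriveV// /GRing.scale/=; field.
Qed.

Lemma cvg_inv_pinfty : x^-1 @[x --> +oo] --> (0 : R).
Proof.
apply/gtr0_cvgV0; last exact: cvg_id.
by apply: nbhs_pinfty_gt; exact: num_real.
Qed.

Lemma cvg_phi_inv : phi x * x^-1 @[x --> +oo] --> (0 : R).
Proof.
apply: (@squeeze_cvgr _ _ _ _ (fun=> 0) (fun x => normal_peak 1 * x^-1)).
- near=> x; have x0 : 0 < x by near: x; apply: nbhs_pinfty_gt; exact: num_real.
  have i0 : 0 <= x^-1 by rewrite invr_ge0 ltW.
  apply/andP; split; first by rewrite mulr_ge0// ltW// phi_gt0.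
  by rewrite ler_wpM2r// normal_pdf_ub// oner_neq0.
- exact: cvg_cst.
- rewrite -[X in _ --> X](mulr0 (normal_peak 1)); apply: cvgM; first exact: cvg_cst.
  exact: cvg_inv_pinfty.
Unshelve. all: by end_near. Qed.

(** [G] is minus the upper normal tail. Both phi/x + G and - G - (phi/x - phi/x^3) tend to 0 and
    have derivatives - phi/x^2 and - 3 phi/x^4, so both are nonnegative. This order of accuracy is
    required because the second derivative of the Stein solution multiplies the error by x^2. *)
Lemma mills (G : R -> R) : (forall y, is_derive y 1 G (phi y)) ->
  G y @[y --> +oo] --> (0 : R) ->
  forall x, 1 <= x -> `|G x / phi x + x^-1| <= x^-1 ^+ 3.
Proof.
move=> dG G0 x x1.
have y0 y : x <= y -> 0 < y by move=> xy; rewrite (lt_le_trans ltr01)// (le_trans x1).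
have dinv y : 0 < y -> is_derive y 1 (fun z : R => z^-1) (- 1 / y ^+ 2).
  by move=> yp; apply: (@is_derive1V id); rewrite gt_eqF.
have h1 : 0 <= phi x * x^-1 + G x.
  apply: (@nonincreasing_to0_ge0 (fun y => phi y * y^-1 + G y) (fun y => - (phi y * y^-1 ^+ 2))).
  - move=> y /y0 yp; have := dinv _ yp; have := is_derive_phi y; have := dG y => d1 d2 d3.
    by apply: is_derive_eq; rewrite /GRing.scale/=; field; rewrite gt_eqF.
  - move=> y /y0 yp; rewrite oppr_le0 mulr_ge0 ?sqr_ge0// ltW// phi_gt0//.
  - by rewrite -[X in _ --> X](addr0 (0:R)); apply: cvgD => //; exact: cvg_phi_inv.
have h2 : 0 <= - G x - (phi x * x^-1 - phi x * x^-1 * x^-1 ^+ 2).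
  apply: (@nonincreasing_to0_ge0 (fun y => - G y - (phi y * y^-1 - phi y * y^-1 * y^-1 ^+ 2))
    (fun y => - (3 * phi y * y^-1 ^+ 4))).
  - move=> y /y0 yp; have := dinv _ yp; have := is_derive_phi y; have := dG y => d1 d2 d3.
    by apply: is_derive_eq; rewrite /GRing.scale/=; field; rewrite gt_eqF.
  - move=> y /y0 yp; rewrite oppr_le0 mulr_ge0//; last by rewrite (exprM _ 2 2) sqr_ge0.
    by rewrite mulr_ge0// ltW// phi_gt0.
  - have i0 := cvg_inv_pinfty; have p0 := cvg_phi_inv.
    rewrite -[X in _ --> X](_ : - 0 - (0 - 0 * (0 * 0)) = 0 :> R); last by rewrite !(oppr0, mulr0, addr0).
    apply: cvgB; first exact: cvgN.
    apply: cvgB => //; apply: cvgM => //.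
    by rewrite (funext (fun y : R => expr2 y^-1)); exact: cvgM.
have px := phi_gt0 x; have x0 := y0 _ (lexx x).
have -> : G x / phi x + x^-1 = (phi x * x^-1 + G x) / phi x by field; rewrite !gt_eqF.
rewrite ger0_norm; last by rewrite divr_ge0// ltW.
rewrite ler_pdivrMr//.
rewrite -subr_ge0 (_ : _ - _ = - G x - (phi x * x^-1 - phi x * x^-1 * x^-1 ^+ 2))//.
by field; rewrite gt_eqF.
Qed.

Definition Phi x : R := \int[lebesgue_measure]_(t in `]-oo, x]) phi t.

Lemma integrable_phi : lebesgue_measure.-integrable setT (EFin \o phi).
Proof. exact: integrable_normal_pdf. Qed.

Lemma PhiE x : (Phi x)%:E = normal_prob 0 1 `]-oo, x].
Proof.
rewrite /Phi /Rintegral fineK//; apply: integrable_fin_num => //.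
exact: (integrableS _ _ (subsetT _) integrable_phi).
Qed.

Lemma is_derive_Phi x : is_derive x 1 Phi (phi x).
Proof. by apply: is_derive_primitive; [exact: integrable_phi|exact: continuous_phi]. Qed.

Lemma cvg_Phi_pinfty : Phi x @[x --> +oo] --> (1 : R).
Proof.
have := @cvg_cdfy1 _ _ R (normal_prob 0 1) (@idR R).
rewrite (_ : cdf _ = EFin \o Phi); last by apply/funext => x /=; rewrite PhiE.
by move/fine_cvg.
Qed.

Lemma cvg_Phi_ninfty : Phi x @[x --> -oo] --> (0 : R).
Proof.
have := @cvg_cdfNy0 _ _ R (normal_prob 0 1) (@idR R).
rewrite (_ : cdf _ = EFin \o Phi); last by apply/funext => x /=; rewrite PhiE.
by move/fine_cvg.
Qed.

Lemma mills_right x : 1 <= x -> `|(Phi x - 1) / phi x + x^-1| <= x^-1 ^+ 3.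
Proof.
apply: (mills (G := fun x => Phi x - 1)) => [y|].
  have := is_derive_Phi y => d.
  by apply: is_derive_eq; rewrite subr0.
rewrite -[X in _ --> X](subrr (1 : R)); apply: cvgB; last exact: cvg_cst.
exact: cvg_Phi_pinfty.
Qed.

Lemma phiN x : phi (- x) = phi x.
Proof. by rewrite !phiE sqrrN. Qed.

(** By symmetry of [phi], the function [- Phi (- x)] is also a primitive of [phi] vanishing at
    infinity. *)
Lemma mills_left x : 1 <= x -> `|- Phi (- x) / phi x + x^-1| <= x^-1 ^+ 3.
Proof.
apply: (mills (G := fun x => - Phi (- x))) => [y|].
  have d := is_derive_Phi (- y).
  have d2 : is_derive y 1 (fun z => Phi (- z)) (phi (- y) * - 1).
    by apply: (is_derive1_comp (f := Phi)).
  by apply: is_derive_eq; rewrite phiN; ring.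
rewrite -[X in _ --> X](oppr0); apply: cvgN.
have := cvg_Phi_ninfty => /cvgNy_compNP.
exact.
Qed.

End normal_density_ode.

Section real_function_bounds.
Context {R : realType}.
Implicit Types F dF : R -> R.

Lemma MVT_dist F dF : (forall x : R, is_derive x 1 F (dF x)) -> forall x y,
  exists c, `|c - x| <= `|y - x| /\ F y - F x = dF c * (y - x).
Proof.
move=> FdF x y.
have cF u v : {within `[u, v], continuous F}.
  by apply: derivable_within_continuous => z _; have [] := FdF z.
have [xy|yx] := leP x y.
  have [c + e] := MVT_segment xy (fun z _ => FdF z) (@cF _ _).
  rewrite in_itv/= => /andP[xc cy]; exists c; split => //.
  by rewrite !ger0_norm; lra.
have [c + e] := MVT_segment (ltW yx) (fun z _ => FdF z) (@cF _ _).
rewrite in_itv/= => /andP[yc cx]; exists c; split.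
  by rewrite !ler0_norm; lra.
by rewrite -opprB e; ring.
Qed.

Lemma bounded_on_itv F (c : R) : continuous F ->
  exists C, forall x, - c <= x <= c -> `|F x| <= C.
Proof.
move=> cF; have [c0|c0] := leP 0 c; last first.
  by exists 0 => x xc; lra.
have cn : {within `[- c, c], continuous (fun x => `|F x|)}.
  apply: continuous_subspaceT => x; apply: continuous_comp; first exact: cF.
  exact: norm_continuous.
have [|m _ mmax] := @EVT_max _ _ (- c) c _ cn; first lra.
by exists `|F m| => x xc; apply: mmax; rewrite in_itv.
Qed.

End real_function_bounds.

(** * Stein's equation for a smoothed indicator of a half-line *)

Section stein_equation.
Context {R : realType}.
Variables (h dh : R -> R) (a b : R).
Hypothesis h_deriv : forall x : R, is_derive x 1 h (dh x).
Hypothesis dh_cont : continuous dh.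
Hypothesis h01 : forall x, 0 <= h x <= 1.
Hypothesis h_left : forall x, x <= a -> h x = 1 /\ dh x = 0.
Hypothesis h_right : forall x, b <= x -> h x = 0 /\ dh x = 0.

Definition stein_mean : R := \int[lebesgue_measure]_t (h t * phi t).

Let H x : R := \int[lebesgue_measure]_(t in `]-oo, x]) (h t * phi t).

(** Solution of f'(x) - x f(x) = h(x) - E h(Z) for standard normal Z. Any other solution differs
    from it by a multiple of 1 / [phi], which grows too fast to have bounded derivatives. *)
Definition stein_sol x : R := (H x - stein_mean * Phi x) / phi x.

Definition stein_dsol x : R := x * stein_sol x + (h x - stein_mean).

Let d2sol x : R := stein_sol x + x * stein_dsol x + dh x.

Let h_cont : continuous h.
Proof. by move=> x; have [/derivable1_diffP/differentiable_continuous] := h_deriv x. Qed.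

Let hphi_cont : continuous (fun t => h t * phi t).
Proof. by move=> x; apply: cvgM; [exact: h_cont|exact: continuous_phi]. Qed.

Lemma integrable_h_phi : lebesgue_measure.-integrable setT (EFin \o (fun t => h t * phi t)).
Proof.
apply: (le_integrable measurableT _ _ (@integrable_phi R)).
  by apply/measurable_EFinP; exact: continuous_measurable_fun.
move=> x _ /=; rewrite lee_fin normrM ler_piMl//.
by have /andP[h0 h1] := h01 x; rewrite ger0_norm.
Qed.

Let dH (x : R) : is_derive x 1 H (h x * phi x).
Proof. by apply: is_derive_primitive; [exact: integrable_h_phi|exact: hphi_cont]. Qed.

Lemma stein_mean01 : 0 <= stein_mean <= 1.
Proof.
apply/andP; split.
  apply: Rintegral_ge0 => x _; apply: mulr_ge0; last exact: ltW (phi_gt0 x).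
  by have /andP[] := h01 x.
have e1 : \int[lebesgue_measure]_t (phi t) = 1 :> R.
  by rewrite /Rintegral integral_normal_pdf.
rewrite -[leRHS]e1; apply: le_Rintegral => //.
- exact: integrable_h_phi.
- exact: integrable_phi.
move=> x _; apply: ler_piMl; first exact: ltW (phi_gt0 x).
by have /andP[] := h01 x.
Qed.

Let H_left x : x <= a -> H x = Phi x.
Proof.
move=> xa; apply: eq_Rintegral => t; rewrite inE/= in_itv/= => tx.
by rewrite (h_left (le_trans tx xa)).1 mul1r.
Qed.

Let H_right x : b <= x -> H x = stein_mean.
Proof.
move=> bx; rewrite /H Rintegral_mkcond; apply: eq_Rintegral => t _.
rewrite patchE; case: ifPn => //; rewrite notin_setE/= in_itv/= => /negP.
rewrite -ltNge => xt; rewrite (h_right _).1 ?mul0r//.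
by rewrite (le_trans bx)// ltW.
Qed.

(** [h] is squeezed between the indicators of the half-lines ending at [a] and at [b]. *)
Lemma stein_mean_bounds : Phi a <= stein_mean <= Phi b.
Proof.
have hp x : 0 <= h x * phi x.
  by apply: mulr_ge0; [have /andP[] := h01 x|exact: ltW (phi_gt0 x)].
apply/andP; split.
  rewrite -H_left// /H Rintegral_mkcond; apply: le_Rintegral => //.
  - rewrite -restrict_EFin -integrable_restrict// setTI.
    by apply: (integrableS _ _ (subsetT _) integrable_h_phi).
  - exact: integrable_h_phi.
  - by move=> x _; rewrite patchE; case: ifP.
rewrite -(H_right (lexx b)); apply: le_Rintegral => //.
- by apply: (integrableS _ _ (subsetT _) integrable_h_phi).
- by apply: (integrableS _ _ (subsetT _) integrable_phi).
- move=> x _; apply: ler_piMl; first exact: ltW (phi_gt0 x).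
  by have /andP[] := h01 x.
Qed.

Lemma is_derive_stein_sol (x : R) : is_derive x 1 stein_sol (stein_dsol x).
Proof.
have px := phi_gt0 x; have pn : phi x != 0 by rewrite gt_eqF.
have d1 := dH x; have d2 := is_derive_Phi x.
have d3 := is_derive1V pn (is_derive_phi x).
have d4 : is_derive x 1 (fun y => H y - stein_mean * Phi y) (h x * phi x - stein_mean * phi x).
  by apply: is_derive_eq; rewrite ?scaler0 /GRing.scale/=; ring.
apply: is_derive_eq; rewrite /GRing.scale/= /stein_dsol /stein_sol.
by field.
Qed.

Lemma is_derive_stein_dsol (x : R) : is_derive x 1 stein_dsol (d2sol x).
Proof.
have d1 := is_derive_stein_sol x; have d2 := h_deriv x.
by apply: is_derive_eq; rewrite ?scaler0 /GRing.scale/= /d2sol; ring.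
Qed.

Lemma continuous_stein_sol : continuous stein_sol.
Proof.
by move=> x; have [/derivable1_diffP/differentiable_continuous] := is_derive_stein_sol x.
Qed.

Lemma continuous_stein_dsol : continuous stein_dsol.
Proof.
by move=> x; have [/derivable1_diffP/differentiable_continuous] := is_derive_stein_dsol x.
Qed.

Let continuous_d2sol : continuous d2sol.
Proof.
move=> x; apply: cvgD; last exact: dh_cont.
apply: cvgD; first exact: continuous_stein_sol.
by apply: cvgM; [exact: cvg_id|exact: continuous_stein_dsol].
Qed.

(** [r] is a signed Mills ratio, close to - 1/y, and [c] is [stein_mean] or its complement. The
    quantity 1 + y r = y (r + 1/y) is at most 1/y^2 in absolute value. The three conclusions serve
    for the solution, for x times its derivative, and for the derivative. *)
Let tail_le (c r y : R) : 0 <= c <= 1 -> 1 <= y -> `|r + y^-1| <= y^-1 ^+ 3 ->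
  `|c * r| <= 2 /\ `|c * y * (1 + y * r)| <= 1 /\ `|c * (1 + y * r)| <= 1.
Proof.
move=> /andP[c0 c1] y1; set i := y^-1 => ri.
have y0 : 0 < y by rewrite (lt_le_trans ltr01).
have yi : y * i = 1 by rewrite divff// gt_eqF.
have i0 : 0 <= i by rewrite invr_ge0 ltW.
have i1 : i <= 1 by rewrite invf_le1.
have i21 : i ^+ 2 <= 1 by rewrite expr_le1.
have i31 : i ^+ 3 <= 1 by rewrite expr_le1.
have key : `|1 + y * r| <= i ^+ 2.
  have -> : 1 + y * r = y * (r + i) by rewrite mulrDr yi addrC.
  rewrite normrM (gtr0_norm y0); apply: le_trans (ler_wpM2l (ltW y0) ri) _.
  by rewrite exprS mulrA yi mul1r.
have rle : `|r| <= 2.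
  by move: ri; rewrite !ler_norml => /andP[? ?]; apply/andP; split; lra.
split; first by rewrite normrM ger0_norm// (le_trans _ rle)// ler_piMl.
have k1 : `|1 + y * r| <= 1 by apply: le_trans key i21.
split; last by rewrite normrM ger0_norm// mulr_ile1.
rewrite -mulrA normrM ger0_norm// mulr_ile1// normrM (gtr0_norm y0).
apply: le_trans (ler_wpM2l (ltW y0) key) _.
by rewrite expr2 mulrA yi mul1r.
Qed.

Let right_tail x : b <= x -> 1 <= x -> `|stein_dsol x| <= 1 /\ `|d2sol x| <= 3.
Proof.
move=> bx x1; have [hx dhx] := h_right bx.
set r := (Phi x - 1) / phi x.
have e1 : stein_sol x = - (stein_mean * r).
  by rewrite /stein_sol H_right// /r; field; rewrite gt_eqF ?phi_gt0.
have e2 : stein_dsol x = - (stein_mean * (1 + x * r)).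
  by rewrite /stein_dsol e1 hx; ring.
have [t1 [t2 t3]] := tail_le stein_mean01 x1 (mills_right x1).
split; first by rewrite e2 normrN.
rewrite /d2sol dhx addr0 e1 e2 (le_trans (ler_normD _ _))// (_ : 3 = 2 + 1 :> R); last by ring.
apply: lerD; first by rewrite normrN.
by rewrite mulrN normrN mulrA (mulrC x).
Qed.

Let left_tail x : x <= a -> x <= -1 -> `|stein_dsol x| <= 1 /\ `|d2sol x| <= 3.
Proof.
move=> xa x1; have [hx dhx] := h_left xa.
have y1 : 1 <= - x by lra.
set r := - Phi (- - x) / phi (- x).
have e1 : stein_sol x = - ((1 - stein_mean) * r).
  by rewrite /stein_sol H_left// /r opprK phiN; field; rewrite gt_eqF ?phi_gt0.
have e2 : stein_dsol x = (1 - stein_mean) * (1 + - x * r).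
  by rewrite /stein_dsol e1 hx; ring.
have m01 : 0 <= 1 - stein_mean <= 1 by have := stein_mean01; lra.
have [t1 [t2 t3]] := tail_le m01 y1 (mills_left y1).
split; first by rewrite e2.
rewrite /d2sol dhx addr0 e1 e2 (le_trans (ler_normD _ _))// (_ : 3 = 2 + 1 :> R); last by ring.
apply: lerD; first by rewrite normrN.
by rewrite -normrN -mulNr mulrA (mulrC (- x)).
Qed.

(** Mills estimates on the tails, compactness in between. [L] depends on [h], which is harmless
    since [h] stays fixed while N grows. *)
Lemma stein_bounds : exists L, 0 <= L /\ forall x, `|stein_dsol x| <= L /\ `|d2sol x| <= L.
Proof.
pose c := 1 + `|a| + `|b|.
have [C1 hC1] := bounded_on_itv c continuous_stein_dsol.
have [C2 hC2] := bounded_on_itv c continuous_d2sol.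
exists (3 + `|C1| + `|C2|); split; first by rewrite !addr_ge0.
move=> x.
have n1 := normr_ge0 C1; have n2 := normr_ge0 C2.
have l1 := ler_norm C1; have l2 := ler_norm C2.
have la := ler_norm (- a); have lb := ler_norm b; rewrite normrN in la.
have na := normr_ge0 a; have nb := normr_ge0 b.
have [xc|xc] := leP x (- c).
  have [|| t1 t2] := @left_tail x; rewrite /c in xc; lra.
have [cx|cx] := leP c x.
  have [|| t1 t2] := @right_tail x; rewrite /c in cx; lra.
have xcc : - c <= x <= c by lra.
by have := hC1 _ xcc; have := hC2 _ xcc; lra.
Qed.

Theorem stein_equation : exists L, [/\ 0 <= L,
  forall x, `|stein_dsol x| <= L,
  forall x y, `|stein_dsol y - stein_dsol x| <= L * `|y - x| &
  forall x y, `|stein_sol y - stein_sol x - stein_dsol x * (y - x)| <= L * (y - x) ^+ 2].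
Proof.
have [L [L0 bnd]] := stein_bounds; exists L.
have lip x y : `|stein_dsol y - stein_dsol x| <= L * `|y - x|.
  have [c [_ ->]] := MVT_dist is_derive_stein_dsol x y.
  by rewrite normrM ler_wpM2r//; have [] := bnd c.
split => // [x|x y]; first by have [] := bnd x.
have [c [cx ->]] := MVT_dist is_derive_stein_sol x y.
rewrite -mulrBl normrM -[X in _ <= _ * X]real_normK ?num_real// expr2 mulrA.
by rewrite ler_wpM2r// (le_trans (lip _ _))// ler_wpM2l.
Qed.

End stein_equation.

(** * A continuously differentiable approximation of the indicator of a half-line *)

Section smooth_indicator.
Context {R : realType}.
Implicit Types x y a b : R.

Lemma is_derive_sqr_bound (F : R -> R) (x c K : R) :
  (forall y, `|F y - F x - c * (y - x)| <= K * (y - x) ^+ 2) -> is_derive x 1 F c.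
Proof.
move=> FK.
have lim : h^-1 *: (F (h *: 1 + x) - F x) @[h --> 0^'] --> c.
  apply/cvgrPdist_le => e e0; near=> t.
  have t0 : t != 0 by near: t; exact: nbhs_dnbhs_neq.
  rewrite /GRing.scale/= mulr1.
  have -> : c - t^-1 * (F (t + x) - F x) = - (t^-1 * (F (t + x) - F x - c * t)).
    by field.
  rewrite normrN normrM.
  have := FK (t + x); rewrite addrK => FKt.
  apply: le_trans (ler_wpM2l (normr_ge0 _) FKt) _.
  rewrite -(real_normK (num_real t)) normfV.
  have -> : `|t|^-1 * (K * `|t| ^+ 2) = K * `|t| by field; rewrite normr_eq0.
  have tK : `|t| <= e / (`|K| + 1).
    near: t; apply: dnbhs0_le; rewrite divr_gt0// ltr_wpDl//.
  have K1 : 0 < `|K| + 1 by rewrite ltr_wpDl.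
  move: tK; rewrite ler_pdivlMr// => tK.
  apply: le_trans tK; rewrite mulrC ler_wpM2l//.
  by rewrite (le_trans (ler_norm _))// lerDl.
by split; [apply/cvg_ex; exists c|apply/cvg_lim].
Unshelve. all: by end_near. Qed.

Definition ramp x : R := (x + `|x|) / 2.

Lemma ramp_pos x : 0 <= x -> ramp x = x.
Proof. by move=> x0; rewrite /ramp ger0_norm//; field. Qed.

Lemma ramp_neg x : x <= 0 -> ramp x = 0.
Proof. by move=> x0; rewrite /ramp ler0_norm// subrr mul0r. Qed.

(** A quadratic remainder bound, checked over the four sign patterns, settles the kink at 0 together
    with the other points. *)
Lemma is_derive_ramp_sqr x : is_derive x 1 (fun y => ramp y ^+ 2) (2 * ramp x).
Proof.
apply: (@is_derive_sqr_bound _ _ _ 1) => y; rewrite mul1r.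
have s1 := sqr_ge0 (y - x); have s2 := sqr_ge0 x; have s3 := sqr_ge0 y.
rewrite ler_norml; have [x0|/ltW x0] := leP 0 x; have [y0|/ltW y0] := leP 0 y.
- by rewrite !ramp_pos//; apply/andP; split; lra.
- have xy : 0 <= x * - y by rewrite mulr_ge0// oppr_ge0.
  by rewrite (ramp_pos x0) (ramp_neg y0) expr0n/= ?mulr0 ?mul0r; apply/andP; split; lra.
- have xy : 0 <= - x * y by rewrite mulr_ge0// oppr_ge0.
  by rewrite (ramp_neg x0) (ramp_pos y0) expr0n/= ?mulr0 ?mul0r; apply/andP; split; lra.
- by rewrite !ramp_neg// expr0n/= ?mulr0 ?mul0r; apply/andP; split; lra.
Qed.

Lemma continuous_ramp : continuous ramp.
Proof.
move=> x; apply: cvgM; last exact: cvg_cst.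
by apply: cvgD; [exact: cvg_id|exact: norm_continuous].
Qed.

Lemma smooth_indicator a b : a < b -> exists h dh : R -> R,
  [/\ forall x, is_derive x 1 h (dh x), continuous dh,
      forall x, 0 <= h x <= 1,
      forall x, x <= a -> h x = 1 /\ dh x = 0 &
      forall x, b <= x -> h x = 0 /\ dh x = 0].
Proof.
(* [dh] below is minus a triangular bump on [a, b] with peak at the midpoint [c], so [h] is a
   quadratic spline; [k] makes the total drop equal to 1. *)
move=> ab; pose c := (a + b) / 2; pose k := 2 / (b - a) ^+ 2.
have ba : b - a != 0 by rewrite subr_eq0 gt_eqF.
have ba0 : 0 < b - a by rewrite subr_gt0.
pose h x := 1 - k * (ramp (x - a) ^+ 2 - 2 * ramp (x - c) ^+ 2 + ramp (x - b) ^+ 2).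
pose dh x := - (k * (2 * ramp (x - a) - 4 * ramp (x - c) + 2 * ramp (x - b))).
exists h, dh; split.
- move=> x.
  have dr (e : R) : is_derive x 1 (fun y : R => ramp (y - e) ^+ 2) (2 * ramp (x - e)).
    have d1 : is_derive x 1 (fun y : R => y - e) (1 : R).
      by apply: is_derive_eq; exact: subr0.
    have := is_derive1_comp (f := fun y => ramp y ^+ 2) (g := fun y => y - e)
      (is_derive_ramp_sqr (x - e)) d1.
    by rewrite mulr1.
  have da := dr a; have db := dr b; have dc := dr c.
  by apply: is_derive_eq; rewrite ?scaler0 /GRing.scale/= /dh; ring.
- have cr e : continuous (fun x => ramp (x - e)).
    move=> x; apply: (@continuous_comp _ _ _ (fun x => x - e) ramp).
      by apply: cvgB; [exact: cvg_id|exact: cvg_cst].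
    exact: continuous_ramp.
  move=> x; apply: cvgN; apply: cvgM; first exact: cvg_cst.
  apply: cvgD; [apply: cvgB|]; apply: cvgM; try exact: cvg_cst; exact: cr.
- move=> x.
  have ac : a <= c by rewrite /c; lra.
  have cb : c <= b by rewrite /c; lra.
  have hE u : 0 <= u <= (b - a) ^+ 2 / 2 -> 0 <= 1 - k * u <= 1.
    move=> /andP[u0 u1]; have k0 : 0 < k by rewrite divr_gt0// exprn_gt0.
    have ku : k * u <= k * ((b - a) ^+ 2 / 2) by rewrite ler_pM2l.
    have k1 : k * ((b - a) ^+ 2 / 2) = 1 by rewrite /k; field.
    have ku0 : 0 <= k * u by rewrite mulr_ge0// ltW.
    by rewrite k1 in ku; lra.
  apply: hE.
  have [xa|ax] := leP x a.
    rewrite !ramp_neg; [|lra..].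
    by have := sqr_ge0 (b - a); lra.
  have [xc|cx] := leP x c.
    rewrite (ramp_pos (x := x - a)); last lra.
    rewrite !ramp_neg; [|lra..].
    have : (x - a) ^+ 2 <= ((b - a) / 2) ^+ 2.
      by rewrite ler_sqr ?nnegrE; rewrite /c in xc; lra.
    have := sqr_ge0 (x - a); have := sqr_ge0 (b - a).
    by rewrite expr_div_n; lra.
  have [xb|bx] := leP x b.
    rewrite (ramp_pos (x := x - a)); last lra.
    rewrite (ramp_pos (x := x - c)); last lra.
    rewrite ramp_neg; last lra.
    have -> : (x - a) ^+ 2 - 2 * (x - c) ^+ 2 + 0 ^+ 2 = (b - a) ^+ 2 / 2 - (b - x) ^+ 2.
      by rewrite /c; field.
    have : (b - x) ^+ 2 <= ((b - a) / 2) ^+ 2.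
      by rewrite ler_sqr ?nnegrE; rewrite /c in cx; lra.
    have := sqr_ge0 (b - x); have := sqr_ge0 (b - a).
    by rewrite expr_div_n; lra.
  rewrite !ramp_pos; [|lra..].
  have -> : (x - a) ^+ 2 - 2 * (x - c) ^+ 2 + (x - b) ^+ 2 = (b - a) ^+ 2 / 2.
    by rewrite /c; field.
  by have := sqr_ge0 (b - a); lra.
- move=> x xa; rewrite /h /dh !ramp_neg; [|rewrite /c; lra..].
  by split; ring.
- move=> x bx; rewrite /h /dh !ramp_pos; [|rewrite /c; lra..].
  by split; rewrite /k /c; field.
Qed.

End smooth_indicator.

(** * From an asymptotic Stein identity to convergence in distribution *)

Section convergence_to_normal.
Context {R : realType}.

(** [g] acts as the derivative of [f], tied to it by the Taylor bound alone; these are the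
    properties that [quadratic_form_stein] asks of its test functions. *)
Definition lipschitz_deriv (f g : R -> R) (L : R) := [/\ continuous f /\ continuous g,
  0 <= L, forall x, `|g x| <= L,
  forall x y, `|g y - g x| <= L * `|y - x| &
  forall x y, `|f y - f x - g x * (y - x)| <= L * (y - x) ^+ 2].

Lemma bm_indic d (T : measurableType d) (A : set T) :
  measurable A -> bm (\1_A : T -> R).
Proof.
move=> mA; split; first exact: measurable_indic.
by exists 1 => t; rewrite indicE; case: (_ \in _); rewrite ?normr0 ?normr1.
Qed.

Lemma mean_indic d (T : measurableType d) (P : probability T R) (A : set T) :
  measurable A -> mean P \1_A = fine (P A).
Proof. by move=> mA; rewrite /mean /Rintegral integral_indic// setIT. Qed.

Lemma Phi_continuous : continuous (@Phi R).
Proof.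
by move=> x; have [/derivable1_diffP/differentiable_continuous] := is_derive_Phi x.
Qed.

Variables (d : nat -> measure_display) (Om : forall n, measurableType (d n))
  (P : forall n, probability (Om n) R) (Q : forall n, {RV (P n) >-> R})
  (S : forall n, Om n -> R).
Hypothesis bQ : forall n, bm (Q n).
Hypothesis bS : forall n, bm (@S n).
Hypothesis stein : forall f g L, lipschitz_deriv f g L ->
  mean (P n) (fun w => @S n w * f (S w)) - mean (P n) (fun w => g (@S n w)) @[n --> \oo] --> (0 : R).
Hypothesis close : mean (P n) (fun w => (Q n w - S w) ^+ 2) @[n --> \oo] --> (0 : R).

Let smooth_limit a b : a < b -> exists h : R -> R, exists theta : R,
  [/\ continuous h /\ forall x, 0 <= h x <= 1, forall x, x <= a -> h x = 1,
      forall x, b <= x -> h x = 0, Phi a <= theta <= Phi b &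
      mean (P n) (fun w => h (Q n w)) @[n --> \oo] --> theta].
Proof.
move=> ab; have [h [dh [hd cdh h01 hl hr]]] := smooth_indicator ab.
have ch : continuous h.
  by move=> x; have [/derivable1_diffP/differentiable_continuous] := hd x.
exists h, (stein_mean h); split => //.
- by move=> x /hl[].
- by move=> x /hr[].
- exact: (stein_mean_bounds hd h01 hl hr).
have [L [L0 gL glip fL]] := stein_equation hd cdh h01 hl hr.
have cf := continuous_stein_sol hd h01.
have cg := continuous_stein_dsol hd h01.
have sd : lipschitz_deriv (stein_sol h) (stein_dsol h) L by [].
have [K hK] : exists K, forall x, `|dh x| <= K.
  have [K dK] := bounded_on_itv (`|a| + `|b|) cdh.
  exists `|K| => x; have la := ler_norm (- a); have lb := ler_norm b.
  have na := normr_ge0 a; have nb := normr_ge0 b; rewrite normrN in la.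
  have [xa|xa] := leP x a; first by rewrite (hl _ xa).2 normr0.
  have [bx|bx] := leP b x; first by rewrite (hr _ bx).2 normr0.
  by rewrite (le_trans _ (ler_norm K))//; apply: dK; lra.
have K0 : 0 <= K by rewrite (le_trans _ (hK 0)).
have hlip x y : `|h y - h x| <= K * `|y - x|.
  by have [c [_ ->]] := MVT_dist hd x y; rewrite normrM ler_wpM2r.
have bh (V : forall n, Om n -> R) : (forall n, bm (@V n)) -> forall n, bm (fun w => h (V n w)).
  by move=> bV n; exact: bm_comp_cont.
(* Stein's equation turns E h(S) - E h(Z) into the difference that tends to 0; the last summand pays
   for replacing S by Q. *)
have e n : mean (P n) (fun w => h (Q n w)) = stein_mean h -
    (mean (P n) (fun w => @S n w * stein_sol h (S w)) - mean (P n) (fun w => stein_dsol h (@S n w)))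
    + mean (P n) (fun w => h (Q n w) - h (S w)).
  have bSf : bm (fun w => @S n w * stein_sol h (S w)) by apply: bmM => //; exact: bm_comp_cont.
  have bg : bm (fun w => stein_dsol h (@S n w)) by exact: bm_comp_cont.
  rewrite meanB; [|exact: bm_comp_cont..].
  have -> : mean (P n) (fun w => stein_dsol h (@S n w)) =
      mean (P n) (fun w => @S n w * stein_sol h (S w)) + (mean (P n) (fun w => h (@S n w)) - stein_mean h).
    rewrite -[X in _ + (_ - X)](mean_cst (P n)).
    rewrite -meanB; [|exact: bm_comp_cont|exact: bm_cst].
    by rewrite -meanD//; apply: bmB; [exact: bm_comp_cont|exact: bm_cst].
  by ring.
rewrite (funext e) -[X in _ --> X]addr0; apply: cvgD.
  by rewrite -[X in _ --> X]subr0; apply: cvgB; [exact: cvg_cst|exact: stein sd].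
apply: norm_cvg0.
apply: (@squeeze_cvgr _ _ _ _ (fun=> 0)
    (fun n => K * Num.sqrt (mean (P n) (fun w => (Q n w - S w) ^+ 2)))).
- near=> n; rewrite normr_ge0/=.
  have bd : bm (fun w => h (Q n w) - h (@S n w)) by apply: bmB; exact: bm_comp_cont.
  have bqs : bm (fun w => Q n w - @S n w) by exact: bmB.
  apply: le_trans (ler_norm_mean _ bd) _.
  apply: (@le_trans _ _ (mean (P n) (fun w => K * `|Q n w - S w|))).
    apply: ler_mean => //; first exact: bm_norm.
    by apply: bmM; [exact: bm_cst|exact: bm_norm].
  rewrite meanZ; last exact: bm_norm.
  by rewrite ler_wpM2l// mean_norm_le_sqrt.
- exact: cvg_cst.
- rewrite -[X in _ --> X](mulr0 K); apply: cvgM; first exact: cvg_cst.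
  rewrite -(sqrtr0 R).
  by apply: (@continuous_cvg _ _ _ _ _ _ Num.sqrt 0); [exact: sqrt_continuous|exact: close].
Unshelve. all: by end_near. Qed.

Theorem cvg_in_distribution_normal : cvg_in_distribution Q (normal_prob 0 1).
Proof.
move=> /= x _.
pose p n := mean (P n) (\1_(Q n @^-1` `]-oo, x])).
have mA n : measurable (Q n @^-1` `]-oo, x]).
  by rewrite -[X in measurable X]setTI; apply: measurable_funPT.
have pE n : cdf (Q n) x = (p n)%:E.
  rewrite /p mean_indic// fineK ?fin_num_measure//.
rewrite (funext pE) -PhiE.
apply: cvg_EFin; first by near=> n.
rewrite (_ : fine \o _ = p)//.
apply/cvgrPdist_le => e e0.
have e20 : 0 < e / 2 by rewrite divr_gt0.
have /cvgrPdist_le /(_ _ e20) := @Phi_continuous x.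
move=> /nbhs_ballP[del /= del0 hdel].
have pd y : `|x - y| < del -> `|Phi x - Phi y| <= e / 2 by move=> xy; exact: hdel.
have d20 : 0 < del / 2 by rewrite divr_gt0.
(* One smoothed indicator lies above and one below that of ]-oo, x]. Their Gaussian means are within
   e/2 of [Phi x], and another e/2 is spent on the limits. *)
have [|h1 [t1 [[ch1 h101] h1l h1r t1b c1]]] := @smooth_limit x (x + del / 2); first lra.
have [|h2 [t2 [[ch2 h201] h2l h2r t2b c2]]] := @smooth_limit (x - del / 2) x; first lra.
have p1 : `|Phi x - Phi (x + del / 2)| <= e / 2.
  by apply: pd; rewrite opprD addrA subrr add0r normrN gtr0_norm; lra.
have p2 : `|Phi x - Phi (x - del / 2)| <= e / 2.
  by apply: pd; rewrite opprB addrCA subrr addr0 gtr0_norm; lra.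
have up n : p n <= mean (P n) (fun w => h1 (Q n w)).
  apply: ler_mean => [||w]; [exact: bm_indic|exact: bm_comp_cont|].
  rewrite indicE; have /andP[h10 h11] := h101 (Q n w).
  case: (boolP (w \in _)) => // /set_mem; rewrite /= in_itv/= => Qx.
  by rewrite h1l.
have lo n : mean (P n) (fun w => h2 (Q n w)) <= p n.
  apply: ler_mean => [||w]; [exact: bm_comp_cont|exact: bm_indic|].
  rewrite indicE; have /andP[h20 h21] := h201 (Q n w).
  case: (boolP (w \in _)) => // /negP Qx; rewrite h2r//.
  rewrite leNgt; apply/negP => Qx'; apply: Qx; apply/mem_set => /=.
  by rewrite in_itv/= ltW.
move/cvgrPdist_le : c1 => /(_ _ e20) n1; move/cvgrPdist_le : c2 => /(_ _ e20) n2.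
near=> n.
have a1 : `|t1 - mean (P n) (fun w => h1 (Q n w))| <= e / 2 by near: n.
have a2 : `|t2 - mean (P n) (fun w => h2 (Q n w))| <= e / 2 by near: n.
have := up n; have := lo n.
move: a1 a2 p1 p2; rewrite !ler_norml => /andP[? ?] /andP[? ?] /andP[? ?] /andP[? ?] ? ?.
by move: t1b t2b => /andP[? ?] /andP[? ?]; apply/andP; split; lra.
Unshelve. all: by end_near. Qed.

End convergence_to_normal.

(** * Gaussian integration by parts *)

Section normal_integral.
Context {R : realType}.
Variable s : R.
Hypothesis s0 : 0 < s.
Let sn0 : s != 0. Proof. by rewrite gt_eqF. Qed.

Notation mu := (@lebesgue_measure R).
Notation pdf := (normal_pdf 0 s).

(** The Radon-Nikodym derivative and the density have the same integral over every measurable set,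
    hence agree almost everywhere. *)
Lemma ge0_integral_normal_prob (f : R -> \bar R) :
  measurable_fun [set: R] f -> (forall x, (0 <= f x)%E) ->
  (\int[normal_prob 0 s]_x f x = \int[mu]_x (f x * (pdf x)%:E))%E.
Proof.
move=> mf f0; have numu := normal_prob_dominates 0 s.
rewrite -(Radon_Nikodym_SigmaFinite.change_of_variables (nu := normal_prob 0 s) (mu := mu) numu f0)//.
have mg := measurable_int _ (Radon_Nikodym_SigmaFinite.f_integrable (nu := normal_prob 0 s) (mu := mu) numu).
have mp : measurable_fun [set: R] (fun x : R => (pdf x)%:E).
  by apply/measurable_EFinP; exact: measurable_normal_pdf.
apply: ae_eq_integral => //; [exact: emeasurable_funM|exact: emeasurable_funM|].
apply: ae_eqe_mul2l; apply: integral_ae_eq => //.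
  exact: Radon_Nikodym_SigmaFinite.f_integrable.
by move=> E _ mE; rewrite -Radon_Nikodym_SigmaFinite.f_integral.
Qed.

Lemma integrable_normal_prob (f : R -> R) : measurable_fun [set: R] f ->
  mu.-integrable [set: R] (EFin \o (fun x => f x * pdf x)) ->
  (normal_prob 0 s).-integrable [set: R] (EFin \o f).
Proof.
move=> mf /integrableP[_ ify]; apply/integrableP; split; first exact/measurable_EFinP.
rewrite ge0_integral_normal_prob//; last by apply: measurableT_comp => //; exact/measurable_EFinP.
apply: le_lt_trans ify; rewrite le_eqVlt; apply/orP; left; apply/eqP.
by apply: eq_integral => x _ /=; rewrite normrM (ger0_norm (normal_pdf_ge0 _ _ _)) EFinM.
Qed.

Lemma Rintegral_normal_prob (f : R -> R) : measurable_fun [set: R] f ->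
  \int[normal_prob 0 s]_x f x = \int[mu]_x (f x * pdf x).
Proof.
move=> mf; rewrite /Rintegral; congr fine.
have posM (r q : R) : 0 <= q -> (maxe r%:E 0 * q%:E = maxe (r * q)%:E 0)%E.
  by move=> q0; rewrite -!EFin_max -EFinM maxr_pMl// mul0r.
have mE : measurable_fun [set: R] (EFin \o f) by exact/measurable_EFinP.
rewrite integralE [RHS]integralE; congr (_ - _)%E.
  rewrite ge0_integral_normal_prob//; last exact: measurable_funepos.
  by apply: eq_integral => x _; rewrite !funeposE /= posM// normal_pdf_ge0.
rewrite ge0_integral_normal_prob//; last exact: measurable_funeneg.
by apply: eq_integral => x _; rewrite !funenegE /= posM ?mulNr// normal_pdf_ge0.
Qed.

Let s2 : R := Num.sqrt 2 * s.
Let s2n0 : s2 != 0. Proof. by rewrite mulf_neq0// sqrtr_eq0 -ltNge. Qed.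

(** Half of the Gaussian exponent absorbs the polynomial: exp(- x^2 / (2 s^2)) is the square of
    exp(- x^2 / (4 s^2)), and the remaining factor is the profile of the density with deviation
    [s2]. Hence the choice c = 4 s^2. *)
Lemma poly_normal_pdf_le k : exists2 C, 0 <= C &
  forall x, (1 + x ^+ 2) ^+ k * pdf x <= C * normal_pdf 0 s2 x.
Proof.
pose c := 4 * s ^+ 2; have c0 : 0 < c by rewrite mulr_gt0// exprn_gt0.
pose C0 := c ^+ k * (k`!)%:R * expR c^-1.
have C00 : 0 <= C0 by rewrite !mulr_ge0 ?expR_ge0 ?exprn_ge0 ?(ltW c0).
have bnd x : (1 + x ^+ 2) ^+ k <= C0 * expR (x ^+ 2 / c).
  pose y := (1 + x ^+ 2) / c.
  have y0 : 0 <= y by rewrite divr_ge0 ?(ltW c0)// addr_ge0// sqr_ge0.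
  have ye : y ^+ k <= k`!%:R * expR y.
    case: k {C0 C00} => [|k].
      by rewrite expr0 fact0 mul1r -expR0 ler_expR.
    rewrite mulrC -ler_pdivrMr ?ltr0n ?fact_gt0//.
    by apply: le_trans (expR_ge1Dxn k y0); rewrite lerDr.
  have -> : (1 + x ^+ 2) ^+ k = c ^+ k * y ^+ k.
    by rewrite -exprMn mulrC divfK// gt_eqF.
  have ey : y = c^-1 + x ^+ 2 / c by rewrite /y mulrDl mul1r.
  have -> : C0 * expR (x ^+ 2 / c) = c ^+ k * (k`!%:R * expR y).
    by rewrite ey expRD /C0; ring.
  by rewrite ler_pM2l ?exprn_gt0.
exists (C0 * (normal_peak s / normal_peak s2)).
  by rewrite mulr_ge0// divr_ge0 ?normal_peak_ge0.
move=> x.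
have pk : normal_peak s2 != 0 by rewrite gt_eqF// normal_peak_gt0.
rewrite !normal_pdfE// /normal_fun !subr0.
have -> : C0 * (normal_peak s / normal_peak s2) * (normal_peak s2 * expR (- x ^+ 2 / (s2 ^+ 2 *+ 2))) =
    normal_peak s * (C0 * expR (- x ^+ 2 / (s2 ^+ 2 *+ 2))) by field.
rewrite mulrCA ler_pM2l ?normal_peak_gt0//.
have -> : - x ^+ 2 / (s2 ^+ 2 *+ 2) = x ^+ 2 / c + - x ^+ 2 / (s ^+ 2 *+ 2).
  by rewrite /s2 exprMn sqr_sqrtr// /c; field.
rewrite expRD mulrA; apply: ler_pM => //; rewrite ?expR_ge0//.
by rewrite exprn_ge0// addr_ge0// sqr_ge0.
Qed.

Lemma integrable_poly_normal_pdf (f : R -> R) C k : measurable_fun [set: R] f ->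
  (forall x, `|f x| <= C * (1 + x ^+ 2) ^+ k) ->
  mu.-integrable [set: R] (EFin \o (fun x => f x * pdf x)).
Proof.
move=> mf fC; have [D D0 DP] := poly_normal_pdf_le k.
have ig : mu.-integrable [set: R] (fun x => (`|C| * D)%:E * (normal_pdf 0 s2 x)%:E)%E.
  by apply: integrableZl => //; exact: integrable_normal_pdf.
apply: (le_integrable measurableT _ _ ig).
  by apply/measurable_EFinP; apply: measurable_funM => //; exact: measurable_normal_pdf.
move=> x _ /=; rewrite lee_fin normrM (ger0_norm (normal_pdf_ge0 _ _ _)).
apply: le_trans (ler_wpM2r (normal_pdf_ge0 _ _ _) (fC x)) _.
have CC : C * (1 + x ^+ 2) ^+ k <= `|C| * (1 + x ^+ 2) ^+ k.
  by rewrite ler_wpM2r ?ler_norm// exprn_ge0// addr_ge0// sqr_ge0.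
apply: le_trans (ler_wpM2r (normal_pdf_ge0 _ _ _) CC) _.
rewrite -mulrA; apply: le_trans (ler_wpM2l (normr_ge0 _) (DP x)) _.
by rewrite mulrA ler_norm.
Qed.

Lemma is_derive_normal_pdf (x : R) : is_derive x 1 pdf (- (x / s ^+ 2) * pdf x).
Proof.
rewrite (_ : pdf = (fun x => normal_peak s * expR (- x ^+ 2 / (s ^+ 2 *+ 2)))); last first.
  by apply/funext => y; rewrite normal_pdfE// /normal_fun subr0.
have d1 : is_derive x 1 (fun y : R => - y ^+ 2 / (s ^+ 2 *+ 2)) (- (x / s ^+ 2)).
  by apply: is_derive_eq; rewrite ?scaler0 /GRing.scale/=; field.
have d2 : is_derive x 1 (fun y => expR (- y ^+ 2 / (s ^+ 2 *+ 2)))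
    (expR (- x ^+ 2 / (s ^+ 2 *+ 2)) * - (x / s ^+ 2)).
  exact: (is_derive1_comp (f := expR)).
by apply: is_derive_eq; rewrite ?scaler0 /GRing.scale/=; ring.
Qed.

(** The fundamental theorem on [-n, n], followed by dominated convergence with the absolute value of
    [dF] as dominating function. *)
Lemma integral_derive0 (F dF : R -> R) : (forall x : R, is_derive x 1 F (dF x)) ->
  continuous dF -> mu.-integrable [set: R] (EFin \o dF) ->
  F n%:R @[n --> \oo] --> (0 : R) -> F (- n%:R) @[n --> \oo] --> (0 : R) ->
  \int[mu]_x dF x = 0.
Proof.
move=> FdF cdF idF F1 F2.
pose f_ n := (EFin \o dF) \_ `[- n%:R, n%:R].
have mdF : measurable_fun [set: R] (EFin \o dF) by exact: measurable_int idF.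
have [] := @dominated_convergence _ _ _ mu setT measurableT f_ (EFin \o dF) (fun x => `|(dF x)%:E|%E).
- by move=> n; apply/measurable_restrict => //; exact: measurable_funS mdF.
- exact: mdF.
- apply: aeW => x _; apply: cvg_near_cst.
  near=> n; rewrite /f_ patchE mem_set//= in_itv/= -ler_norml.
  by near: n; exact: nbhs_infty_ger.
- exact: integrable_abse.
- apply: aeW => x n _; rewrite /f_ patchE; case: ifP => // _.
  by rewrite abse0 abse_ge0.
move=> _ _ lim.
have e n : (0 < n)%N -> (\int[mu]_x f_ n x = (F n%:R - F (- n%:R))%:E)%E.
  move=> n0; rewrite /f_ -integral_mkcond EFinB.
  have nn : - n%:R < n%:R :> R by rewrite gtrN// ltr0n.
  apply: continuous_FTC2 => //; first exact: continuous_subspaceT.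
    split.
    + by move=> x _; have [] := FdF x.
    + by apply: cvg_at_right_filter; have [/derivable1_diffP/differentiable_continuous] := FdF (- n%:R).
    + by apply: cvg_at_left_filter; have [/derivable1_diffP/differentiable_continuous] := FdF n%:R.
  by move=> x _; rewrite derive1E; have [] := FdF x.
have lim0 : (\int[mu]_x f_ n x)%E @[n --> \oo] --> 0%:E.
  apply: cvg_EFin.
    by exists 1%N => // n /= n0; rewrite e.
  rewrite -[X in _ --> X](subrr (0 : R)).
  apply: (cvg_trans _ (cvgB F1 F2)); apply: near_eq_cvg.
  by exists 1%N => // n /= n0; rewrite e.
rewrite /Rintegral; have -> : (\int[mu]_x (dF x)%:E)%E = 0%:E by exact: cvg_unique lim lim0.
by [].
Unshelve. all: by end_near. Qed.

(** One more power of 1 + x^2 is spent to get the decay rate 1 / (n + 1). Prescribing only the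
    square of [v n] covers both endpoints n and - n. *)
Lemma poly_normal_pdf_cvg0 (f : R -> R) C k :
  (forall x, `|f x| <= C * (1 + x ^+ 2) ^+ k) -> forall v : nat -> R,
  (forall n, v n ^+ 2 = n%:R ^+ 2) -> (f (v n) * pdf (v n)) @[n --> \oo] --> (0 : R).
Proof.
move=> fC v vn; have [D D0 DP] := poly_normal_pdf_le k.+1.
pose B := `|C| * D * normal_peak s2.
have bnd n : `|f (v n) * pdf (v n)| <= B * (n.+1%:R)^-1.
  have p0 : 0 < 1 + v n ^+ 2 by rewrite ltr_wpDr// sqr_ge0.
  have q0 := normal_pdf_ge0 0 s (v n).
  have CD0 : 0 <= `|C| * D by rewrite mulr_ge0.
  have h1 : (1 + v n ^+ 2) * `|f (v n) * pdf (v n)| <= B.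
    apply: (@le_trans _ _ (`|C| * ((1 + v n ^+ 2) ^+ k.+1 * pdf (v n)))).
      have -> : `|C| * ((1 + v n ^+ 2) ^+ k.+1 * pdf (v n)) =
          (1 + v n ^+ 2) * (`|C| * (1 + v n ^+ 2) ^+ k * pdf (v n)) by rewrite exprS; ring.
      rewrite ler_pM2l// normrM (ger0_norm q0) ler_wpM2r//.
      apply: le_trans (fC _) _.
      by rewrite ler_wpM2r ?ler_norm// exprn_ge0// ltW.
    apply: le_trans (ler_wpM2l (normr_ge0 _) (DP _)) _.
    by rewrite mulrA ler_wpM2l// normal_pdf_ub.
  have B0 : 0 <= B by rewrite mulr_ge0// normal_peak_ge0.
  rewrite ler_pdivlMr ?ltr0n//; apply: le_trans h1; rewrite mulrC ler_wpM2r//.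
  rewrite vn -natr1 addrC lerD2l -natrX ler_nat.
  by case: (n) => // n'; rewrite expnS leq_pmulr.
apply: norm_cvg0; apply: (@squeeze_cvgr _ _ _ _ (fun=> 0) (fun n => B * (n.+1%:R)^-1)).
- by near=> n; rewrite normr_ge0 bnd.
- exact: cvg_cst.
- rewrite -[X in _ --> X](mulr0 B); apply: cvgM; first exact: cvg_cst.
  exact: cvg_harmonic.
Unshelve. all: by end_near. Qed.

Theorem normal_integration_by_parts (h dh : R -> R) C k :
  (forall x : R, is_derive x 1 h (dh x)) -> continuous dh ->
  (forall x, `|h x| <= C * (1 + x ^+ 2) ^+ k) ->
  (forall x, `|dh x| <= C * (1 + x ^+ 2) ^+ k) ->
  \int[normal_prob 0 s]_x (x * h x) = s ^+ 2 * \int[normal_prob 0 s]_x dh x.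
Proof.
move=> hdh cdh hC dhC.
have ch : continuous h by move=> x; have [/derivable1_diffP/differentiable_continuous] := hdh x.
have mh : measurable_fun [set: R] h by exact: continuous_measurable_fun.
have mdh : measurable_fun [set: R] dh by exact: continuous_measurable_fun.
have mxh : measurable_fun [set: R] (fun x => x * h x) by exact: measurable_funM.
have C0 : 0 <= C.
  by have := le_trans (normr_ge0 _) (hC 0); rewrite expr0n/= addr0 expr1n mulr1.
have xhC x : `|x * h x| <= C * (1 + x ^+ 2) ^+ k.+1.
  rewrite normrM exprS mulrCA; apply: ler_pM => //.
  rewrite -(real_normK (num_real x)).
  by have := sqr_ge0 (`|x| - 1); have := sqr_ge0 `|x|; lra.
have i1 := integrable_poly_normal_pdf mdh dhC.
have i2 := integrable_poly_normal_pdf mxh xhC.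
rewrite !Rintegral_normal_prob//.
pose F x := h x * pdf x.
(* The derivative of [F], as the density satisfies pdf' = - x pdf / s^2; the claim is that its
   integral vanishes. *)
pose dF x := dh x * pdf x - s ^- 2 * (x * h x * pdf x).
have i3 : mu.-integrable [set: R] (EFin \o (fun x => s ^- 2 * (x * h x * pdf x))).
  by have := integrableZl measurableT (s ^- 2) i2.
have iF : mu.-integrable [set: R] (EFin \o dF).
  by apply: (integrableB measurableT i1 i3).
have cpdf : continuous pdf by exact: continuous_normal_pdf.
have : \int[mu]_x dF x = 0.
  apply: (@integral_derive0 F) => //.
  - move=> x; have d1 := hdh x; have d2 := is_derive_normal_pdf x.
    by apply: is_derive_eq; rewrite /GRing.scale/= /dF; field.
  - move=> x; apply: cvgB; first by apply: cvgM; [exact: cdh|exact: cpdf].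
    apply: cvgM; first exact: cvg_cst.
    by apply: cvgM; [apply: cvgM; [exact: cvg_id|exact: ch]|exact: cpdf].
  - exact: (poly_normal_pdf_cvg0 hC).
  - by apply: (poly_normal_pdf_cvg0 hC) => n; rewrite sqrrN.
rewrite RintegralB// RintegralZl// => /eqP; rewrite subr_eq0 => /eqP ->.
by rewrite mulrA divff ?mul1r// expf_neq0.
Qed.

End normal_integral.

(** * Coordinates of a normal vector with scalar covariance *)

Section normal_vector_coordinates.
Context {R : realType}.
Variable s : R.
Hypothesis s0 : 0 < s.

Lemma lebesgue_integral_tuple_prod n (g : 'I_n -> R -> R) c : 0 <= c ->
  (forall k, measurable_fun [set: R] (g k)) -> (forall k x, 0 <= g k x) ->
  lebesgue_integral_tuple (fun t : n.-tuple R => (c * \prod_k g k (tnth t k))%:E) =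
  (c%:E * \prod_k \int[lebesgue_measure]_x (g k x)%:E)%E.
Proof.
elim: n g c => [|n IH] g c c0 mg g0.
  by rewrite /= !big_ord0 mulr1 mule1.
rewrite /=.
under eq_integral => x _.
  rewrite (_ : (fun t : n.-tuple R => _) = (fun t : n.-tuple R =>
      ((c * g ord0 x) * \prod_k g (lift ord0 k) (tnth t k))%:E)); last first.
    apply/funext => t; rewrite big_ord_recl -mulrA; congr (_ * (_ * _))%:E.
    by apply: eq_bigr => k _; rewrite tnthS.
  rewrite (IH (fun k => g (lift ord0 k)))//; last exact: mulr_ge0.
  over.
have K0 : (0 <= \prod_(k < n) \int[lebesgue_measure]_x (g (lift ord0 k) x)%:E)%E.
  by apply: prode_ge0 => k _; apply: integral_ge0 => x _; rewrite lee_fin.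
rewrite ge0_integralZr//; last 2 first.
- by apply/measurable_EFinP; apply: measurable_funM; [exact: measurable_cst|exact: mg].
- by move=> x _; rewrite lee_fin mulr_ge0.
rewrite big_ord_recl muleA; congr (_ * _)%E.
under eq_integral do rewrite EFinM.
by rewrite ge0_integralZl//; [apply/measurable_EFinP; exact: mg|move=> x _; rewrite lee_fin].
Qed.

Lemma mvnormal_pdf_scalar n (t : n.-tuple R) :
  mvnormal_pdf 0 ((s ^+ 2)%:M : 'M[R]_n) (col_of_tuple t) =
  \prod_k normal_pdf 0 s (tnth t k).
Proof.
have sn0 : s != 0 by rewrite gt_eqF.
rewrite /mvnormal_pdf subr0 det_scalar invmx_scalar.
have -> : forall u : 'cV[R]_n, (u^T *m ((s ^+ 2)^-1)%:M *m u) 0 0 = \sum_k u k 0 ^+ 2 / s ^+ 2.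
  move=> u; rewrite mul_mx_scalar -scalemxAl !mxE mulr_sumr.
  by apply: eq_bigr => k _; rewrite mxE expr2; field.
under [RHS]eq_bigr do rewrite normal_pdfE// /normal_fun subr0.
rewrite big_split/= prodr_const card_ord -expR_sum; congr (_ * _).
  rewrite /normal_peak -exprMn.
  rewrite (_ : 2 * pi * s ^+ 2 = s ^+ 2 * pi *+ 2); last by rewrite -mulr_natl; ring.
  set a := _ *+ 2; have a0 : 0 <= a by rewrite mulrn_wge0// mulr_ge0 ?sqr_ge0// pi_ge0.
  elim: n {t} => [|n IH]; first by rewrite !expr0 sqrtr1 invr1.
  by rewrite !exprS sqrtrM// invfM IH.
congr expR; rewrite -sumrN mulr_suml; apply: eq_bigr => k _.
by rewrite mxE; field.
Qed.

Context d (Om : measurableType d) (P : probability Om R) (n : nat)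
  (X : {RV P >-> n.-tuple R}).
Hypothesis X_normal : has_mvnormal_distribution X 0 ((s ^+ 2)%:M).

Definition entry (k : 'I_n) (w : Om) : R := tnth (X w) k.

Lemma measurable_entry k : measurable_fun [set: Om] (entry k).
Proof.
apply: (@measurableT_comp _ _ _ _ _ _ (fun t : n.-tuple R => tnth t k)).
  exact: measurable_tnth.
exact: measurable_funPT.
Qed.

HB.instance Definition _ k := isMeasurableFun.Build _ _ _ _ (entry k) (measurable_entry k).

(** The density factors over the coordinates, and so does the indicator of a rectangle. Marginal
    laws and independence are both read off from this formula. *)
Lemma entry_rectangle (B : 'I_n -> set R) : (forall k, measurable (B k)) ->
  P (\bigcap_k entry k @^-1` B k) = (\prod_k normal_prob 0 s (B k))%E.
Proof.
move=> mB; pose C := [set t : n.-tuple R | forall k, B k (tnth t k)].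
have mC : measurable C.
  rewrite (_ : C = \bigcap_(k in [set: 'I_n]) ((@tnth n R ^~ k) @^-1` B k)); last first.
    by apply/seteqP; split => t /=; [move=> Ct k _; exact: Ct|move=> Ct k; exact: Ct].
  apply: fin_bigcap_measurable => // k _.
  by rewrite -[X in measurable X]setTI; exact: measurable_tnth.
have -> : \bigcap_k entry k @^-1` B k = X @^-1` C.
  by apply/seteqP; split => w /=; [move=> Bw k; exact: Bw|move=> Bw k _; exact: Bw].
transitivity (distribution P X C); first by [].
rewrite (X_normal mC) /mvnormal_prob.
rewrite (_ : (fun t => _) = (fun t : n.-tuple R =>
    (1 * \prod_k (normal_pdf 0 s (tnth t k) * \1_(B k) (tnth t k)))%:E)).
  rewrite (lebesgue_integral_tuple_prod (g := fun k x => normal_pdf 0 s x * \1_(B k) x))//.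
  - rewrite mul1e; apply: eq_bigr => k _; rewrite /normal_prob [RHS]integral_mkcond.
    apply: eq_integral => x _; rewrite patchE indicE.
    by case: ifP; rewrite ?mulr1 ?mulr0.
  - by move=> k; apply: measurable_funM; [exact: measurable_normal_pdf|exact: measurable_indic].
  - by move=> k x; rewrite mulr_ge0 ?normal_pdf_ge0.
apply/funext => t; rewrite mul1r big_split/= mvnormal_pdf_scalar; congr (_ * _)%:E.
rewrite indicE; have [/set_mem tC|/negP tC] := boolP (t \in C).
  by rewrite big1// => k _; rewrite indicE mem_set//; exact: tC.
have [k nBk] : exists k, ~ B k (tnth t k).
  by apply: contrapT => /forallNP h; apply: tC; apply/mem_set => k; exact: contrapT.
by rewrite (bigD1 k)//= indicE memNset// mul0r.
Qed.

Lemma distribution_entry k (A : set R) : measurable A ->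
  distribution P (entry k) A = normal_prob 0 s A.
Proof.
move=> mA; pose B j := if j == k then A else setT.
have mB j : measurable (B j) by rewrite /B; case: ifP.
transitivity (P (\bigcap_j entry j @^-1` B j)).
  congr (P _); apply/seteqP; split => w /=.
    by move=> Aw j _; rewrite /B /=; case: eqP => // ->.
  by move=> /(_ k Logic.I); rewrite /B eqxx.
rewrite entry_rectangle// (bigD1 k)//= /B eqxx big1 ?mule1// => j /negbTE ->.
exact: probability_setT.
Qed.

Lemma independent_entry : mutually_independent (fun k => entry k : {RV P >-> R}).
Proof.
move=> J B mB; pose B' j := if j \in J then B j else setT.
have mB' j : measurable (B' j) by rewrite /B'; case: ifP.
transitivity (P (\bigcap_j entry j @^-1` B' j)).
  congr (P _); apply/seteqP; split => w /=.
    by move=> Bw j _; rewrite /B' /=; case: ifP => // jJ; exact: Bw.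
  by move=> Bw j /= jJ; have := Bw j Logic.I; rewrite /B' jJ.
rewrite entry_rectangle// [RHS]big_mkcond/=; apply: eq_bigr => j _.
rewrite /B'; case: ifP => _; last exact: probability_setT.
exact/esym/distribution_entry.
Qed.

End normal_vector_coordinates.

(** * Functions of polynomial growth and their partial derivatives *)

Section coordinatewise_smooth.
Context {R : realType} (n : nat).
Implicit Types (u h : ('I_n -> R) -> R) (v : 'I_n -> R) (a : 'I_n).

Definition upd a (x : R) v : 'I_n -> R := fun k => if k == a then x else v k.

Lemma updE a x y v : upd a y (upd a x v) = upd a y v.
Proof. by apply/funext => k; rewrite /upd; case: eqP. Qed.

Lemma upd_id a v : upd a (v a) v = v.
Proof. by apply/funext => k; rewrite /upd; case: eqP => // ->. Qed.

Definition wt v : R := 1 + \sum_k v k ^+ 2.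

Lemma wt_ge1 v : 1 <= wt v.
Proof. by rewrite lerDl sumr_ge0// => k _; exact: sqr_ge0. Qed.

Lemma wt_ge0 v : 0 <= wt v. Proof. by rewrite (le_trans ler01)// wt_ge1. Qed.

Lemma ler_wtX v i j : (i <= j)%N -> wt v ^+ i <= wt v ^+ j.
Proof. by move=> ij; rewrite ler_weXn2l// wt_ge1. Qed.

(** A class closed under sums, products and regularized inverses, and integrable for the normal law.
    Continuity is imposed one coordinate at a time, since integration by parts proceeds that way. *)
Definition tame u := [/\ measurable_fun [set: n.-tuple R] (fun t => u (tnth t)),
  exists C j, 0 <= C /\ forall v, `|u v| <= C * wt v ^+ j &
  forall a v, continuous (fun x => u (upd a x v))].

Lemma tame_cst c : tame (fun=> c).
Proof.
split; first exact: measurable_cst.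
- by exists `|c|, 0%N; split => // v; rewrite expr0 mulr1.
- by move=> a v; exact: cst_continuous.
Qed.

Lemma tame_coord k : tame (fun v => v k).
Proof.
split; first exact: measurable_tnth.
- exists 1, 1%N; split => // v; rewrite mul1r expr1 /wt.
  have : v k ^+ 2 <= \sum_l v l ^+ 2.
    by rewrite (bigD1 k)//= lerDl sumr_ge0// => l _; exact: sqr_ge0.
  rewrite -(real_normK (num_real (v k))).
  by have := sqr_ge0 (`|v k| - 1); have := sqr_ge0 `|v k|; lra.
- move=> a v x; rewrite /upd; case: (k == a); [exact: cvg_id|exact: cvg_cst].
Qed.

Lemma tameD u1 u2 : tame u1 -> tame u2 -> tame (fun v => u1 v + u2 v).
Proof.
move=> [m1 [C1 [j1 [C10 b1]]] c1] [m2 [C2 [j2 [C20 b2]]] c2]; split.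
- exact: measurable_funD.
- exists (C1 + C2), (j1 + j2)%N; split; first exact: addr_ge0.
  move=> v; rewrite mulrDl (le_trans (ler_normD _ _))//; apply: lerD.
    by apply: le_trans (b1 v) _; rewrite ler_wpM2l// ler_wtX// leq_addr.
  by apply: le_trans (b2 v) _; rewrite ler_wpM2l// ler_wtX// leq_addl.
- by move=> a v x; apply: cvgD; [exact: c1|exact: c2].
Qed.

Lemma tameM u1 u2 : tame u1 -> tame u2 -> tame (fun v => u1 v * u2 v).
Proof.
move=> [m1 [C1 [j1 [C10 b1]]] c1] [m2 [C2 [j2 [C20 b2]]] c2]; split.
- exact: measurable_funM.
- exists (C1 * C2), (j1 + j2)%N; split; first exact: mulr_ge0.
  by move=> v; rewrite exprD mulrACA normrM ler_pM.
- by move=> a v x; apply: cvgM; [exact: c1|exact: c2].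
Qed.

Lemma tame_sum (I : Type) (r : seq I) (Q : pred I) (F : I -> ('I_n -> R) -> R) :
  (forall i, Q i -> tame (F i)) -> tame (fun v => \sum_(i <- r | Q i) F i v).
Proof.
by move=> tF; apply: (big_fun_ind (K := tame)) => //; [exact: tame_cst|exact: tameD].
Qed.

Lemma tameX u j : tame u -> tame (fun v => u v ^+ j).
Proof.
move=> tu; elim: j => [|j IH]; first by under eq_fun do rewrite expr0; exact: tame_cst.
by under eq_fun do rewrite exprS; exact: tameM.
Qed.

Lemma tameV u del : tame u -> (forall v, 0 <= u v) -> 0 < del ->
  tame (fun v => (u v + del)^-1).
Proof.
move=> [m1 _ c1] u0 d0.
have cg : continuous (fun z : R => (`|z| + del)^-1).
  move=> z; apply: cvgV; first by rewrite gt_eqF// ltr_wpDl.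
  by apply: cvgD; [exact: norm_continuous|exact: cvg_cst].
(* The absolute value makes the outer function continuous on the whole line, with denominator at
   least [del]. *)
have e : (fun v => (u v + del)^-1) = (fun v => (`|u v| + del)^-1).
  by apply/funext => v; rewrite ger0_norm.
rewrite e; split.
- by apply: (@measurableT_comp _ _ _ _ _ _ (fun z : R => (`|z| + del)^-1)) => //;
    exact: continuous_measurable_fun.
- exists del^-1, 0%N; split; first by rewrite invr_ge0 ltW.
  move=> v; rewrite expr0 mulr1 normfV ger0_norm; last by rewrite addr_ge0// ltW.
  by rewrite lef_pV2 ?posrE// ?ltr_wpDl// lerDr.
- move=> a v x.
  apply: (@continuous_comp _ _ _ (fun x => u (upd a x v)) (fun z : R => (`|z| + del)^-1)).
    exact: c1.
  exact: cg.
Qed.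

Definition smooth_in a h dh := [/\ tame h, tame dh &
  forall v, is_derive (v a) 1 (fun x => h (upd a x v)) (dh v)].

Lemma smooth_in_cst a c : smooth_in a (fun=> c) (fun=> 0).
Proof. by split; [exact: tame_cst|exact: tame_cst|move=> v; exact: is_derive_cst]. Qed.

Lemma smooth_in_coord a k : smooth_in a (fun v => v k) (fun=> (k == a)%:R).
Proof.
split; [exact: tame_coord|exact: tame_cst|move=> v].
rewrite /upd; case: (k == a); [exact: is_derive_id|exact: is_derive_cst].
Qed.

Lemma smooth_inD a h1 d1 h2 d2 : smooth_in a h1 d1 -> smooth_in a h2 d2 ->
  smooth_in a (fun v => h1 v + h2 v) (fun v => d1 v + d2 v).
Proof.
move=> [t1 t1' e1] [t2 t2' e2]; split; [exact: tameD|exact: tameD|move=> v].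
have i1 := e1 v; have i2 := e2 v; exact: is_deriveD.
Qed.

Lemma smooth_inM a h1 d1 h2 d2 : smooth_in a h1 d1 -> smooth_in a h2 d2 ->
  smooth_in a (fun v => h1 v * h2 v) (fun v => d1 v * h2 v + h1 v * d2 v).
Proof.
move=> [t1 t1' e1] [t2 t2' e2]; split; first exact: tameM.
  by apply: tameD; exact: tameM.
move=> v; have i1 := e1 v; have i2 := e2 v.
by apply: is_derive_eq; rewrite /GRing.scale/= upd_id; ring.
Qed.

Lemma smooth_in_sum a (I : Type) (r : seq I) (F dF : I -> ('I_n -> R) -> R) :
  (forall i, smooth_in a (F i) (dF i)) ->
  smooth_in a (fun v => \sum_(i <- r) F i v) (fun v => \sum_(i <- r) dF i v).
Proof.
move=> sF; elim: r => [|i r IH].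
  rewrite (_ : (fun v => \sum_(i <- [::]) F i v) = fun=> 0); last by apply/funext => v; rewrite big_nil.
  rewrite (_ : (fun v => \sum_(i <- [::]) dF i v) = fun=> 0); last by apply/funext => v; rewrite big_nil.
  exact: smooth_in_cst.
rewrite (_ : (fun v => \sum_(i <- i :: r) F i v) = fun v => F i v + \sum_(i <- r) F i v); last first.
  by apply/funext => v; rewrite big_cons.
rewrite (_ : (fun v => \sum_(i <- i :: r) dF i v) = fun v => dF i v + \sum_(i <- r) dF i v); last first.
  by apply/funext => v; rewrite big_cons.
exact: smooth_inD.
Qed.

Lemma smooth_inX a h dh j : smooth_in a h dh ->
  smooth_in a (fun v => h v ^+ j) (fun v => j%:R * h v ^+ j.-1 * dh v).
Proof.
move=> [t1 t1' e1]; split; first exact: tameX.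
  by apply: tameM => //; apply: tameM; [exact: tame_cst|exact: tameX].
move=> v; have i1 := e1 v.
rewrite (_ : (fun x => h (upd a x v) ^+ j) = (fun x => h (upd a x v)) ^+ j); last first.
  by apply/funext => x; rewrite exprfctE.
by apply: is_derive_eq; rewrite /GRing.scale/= upd_id.
Qed.

Lemma smooth_inV a h dh del : smooth_in a h dh -> (forall v, 0 <= h v) -> 0 < del ->
  smooth_in a (fun v => (h v + del)^-1) (fun v => - ((h v + del)^-1 ^+ 2 * dh v)).
Proof.
move=> [t1 t1' e1] h0 d0; split; first exact: tameV.
  rewrite (_ : (fun v => - _) = (fun v => -1 * ((h v + del)^-1 ^+ 2 * dh v))); last first.
    by apply/funext => v; rewrite mulN1r.
  apply: tameM; first exact: tame_cst.
  by apply: tameM => //; apply: tameX; exact: tameV.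
move=> v; have i1 := e1 v.
have n0 : h (upd a (v a) v) + del != 0 by rewrite gt_eqF// ltr_wpDl.
have i2 : is_derive (v a) 1 (fun x => h (upd a x v) + del) (dh v).
  by apply: is_derive_eq; rewrite addr0.
have i3 := is_derive1V (f := fun x => h (upd a x v) + del) n0 i2.
by apply: is_derive_eq; rewrite upd_id; field; rewrite -(upd_id a v).
Qed.

End coordinatewise_smooth.

(** * Integration by parts for a normal vector *)

Section normal_vector_stein.
Context {R : realType} (s : R) (s0 : 0 < s).
Context d (Om : measurableType d) (P : probability Om R) (n : nat)
  (X : {RV P >-> n.-tuple R}).
Hypothesis X_normal : has_mvnormal_distribution X 0 ((s ^+ 2)%:M).
Implicit Types (u h : ('I_n -> R) -> R) (v : 'I_n -> R) (a : 'I_n).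

Let Xk k : {RV P >-> R} := entry X k.
Let Xv w : 'I_n -> R := tnth (X w).

(** [wt v] is at most n + 1 times 1 plus the largest squared coordinate, and the power of the latter
    occurs among the summands. Integrability thus only involves single coordinates. *)
Lemma wt_expX j v : wt v ^+ j <= n.+1%:R ^+ j * (1 + \sum_k (1 + v k ^+ 2) ^+ j).
Proof.
have p0 k : 0 <= 1 + v k ^+ 2 by rewrite addr_ge0// sqr_ge0.
have [m [m0 mv mle]] : exists m : R, [/\ 0 <= m, forall k, v k ^+ 2 <= m &
    (1 + m) ^+ j <= 1 + \sum_k (1 + v k ^+ 2) ^+ j].
  have [k0|nk] := pselect (exists k : 'I_n, True); last first.
    exists 0; split => // [k|]; first by exfalso; apply: nk; exists k.
    by rewrite addr0 expr1n lerDl sumr_ge0// => k _; rewrite exprn_ge0.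
  have [k _] := k0.
  case: (@Order.TotalTheory.arg_maxP _ _ _ k xpredT (fun k => v k ^+ 2) isT) => i _ imax.
  exists (v i ^+ 2); split; first exact: sqr_ge0.
    by move=> l; exact: imax.
  rewrite (bigD1 i)//= addrCA lerDl addr_ge0// sumr_ge0// => l _.
  by rewrite exprn_ge0.
apply: (@le_trans _ _ ((n.+1%:R * (1 + m)) ^+ j)); last first.
  by rewrite exprMn ler_wpM2l// exprn_ge0.
have w1 := wt_ge0 v.
apply: lerXn2r; rewrite ?nnegrE// ?mulr_ge0// ?addr_ge0//.
rewrite /wt; have : \sum_k v k ^+ 2 <= n%:R * m.
  apply: (@le_trans _ _ (\sum_(k < n) m)); first exact: ler_sum.
  by rewrite sumr_const card_ord mulr_natl.
rewrite -natr1; have n0 : 0 <= n%:R :> R by [].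
by lra.
Qed.

Lemma integrable_coord_poly k j :
  P.-integrable [set: Om] (EFin \o (fun w => (1 + Xv w k ^+ 2) ^+ j)).
Proof.
pose f (x : R) := (1 + x ^+ 2) ^+ j.
have mf : measurable_fun [set: R] f.
  by apply: measurable_funX; apply: measurable_funD => //; exact: measurable_funX.
have mEf : measurable_fun [set: R] (EFin \o f) by exact/measurable_EFinP.
have /integrableP[_ fy] : (normal_prob 0 s).-integrable [set: R] (EFin \o f).
  apply: integrable_normal_prob => //.
  apply: (@integrable_poly_normal_pdf _ s s0 f 1 j) => // x.
  by rewrite mul1r ger0_norm// exprn_ge0// addr_ge0// sqr_ge0.
apply/integrableP; split.
  by apply: (measurableT_comp mEf); exact: measurable_entry.
rewrite -(@ge0_integral_distribution _ _ _ _ _ _ (Xk k) (fun x => `|(f x)%:E|%E))//; last first.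
  exact: measurableT_comp.
apply: le_lt_trans fy; rewrite le_eqVlt; apply/orP; left; apply/eqP.
apply: integral_normal_law; first exact: measurableT_comp.
by move=> A mA; exact: (distribution_entry s0 X_normal).
Qed.

Lemma tame_measurable u : tame u -> measurable_fun [set: Om] (fun w => u (Xv w)).
Proof.
move=> [mu _ _].
by apply: (@measurableT_comp _ _ _ _ _ _ (fun t : n.-tuple R => u (tnth t))).
Qed.

Lemma tame_integrable u : tame u -> P.-integrable [set: Om] (EFin \o (fun w => u (Xv w))).
Proof.
move=> tu; have [mu [C [j [C0 uC]]] _] := tu.
pose S w := \sum_k (1 + Xv w k ^+ 2) ^+ j.
have iS : P.-integrable [set: Om] (EFin \o S).
  rewrite (_ : EFin \o _ = (fun w => \sum_k ((1 + Xv w k ^+ 2) ^+ j)%R%:E)%E).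
    by apply: integrable_sum => // k _; exact: integrable_coord_poly.
  by apply/funext => w /=; rewrite sumEFin.
pose S1 w := 1 + S w.
have i1 : P.-integrable [set: Om] (EFin \o (fun=> 1 : R)).
  by apply: bm_integrable; exact: bm_cst.
have iS1 : P.-integrable [set: Om] (EFin \o S1) by exact: (integrableD measurableT i1 iS).
pose B w := (C * n.+1%:R ^+ j) * S1 w.
have iB : P.-integrable [set: Om] (EFin \o B) by exact: (integrableZl measurableT _ iS1).
apply: (le_integrable measurableT _ _ iB).
  by apply/measurable_EFinP; exact: tame_measurable.
move=> w _ /=; rewrite lee_fin; apply: le_trans (uC _) _.
apply: le_trans (ler_norm _); rewrite /B -mulrA ler_wpM2l//; exact: wt_expX.
Qed.

Let Z a : Om -> n.-tuple R := others Xk 0 a.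

Let upd_others a w : upd a (Xv w a) (tnth (Z a w)) = Xv w.
Proof.
apply/funext => k; rewrite /upd; case: (eqVneq k a) => [->//|ka].
by rewrite tnth_others.
Qed.

Lemma measurable_upd u a : tame u ->
  measurable_fun [set: R * n.-tuple R] (fun z => u (upd a z.1 (tnth z.2))).
Proof.
move=> [mu _ _].
pose m (z : R * n.-tuple R) := [tuple upd a z.1 (tnth z.2) k | k < n].
have mm : measurable_fun [set: R * n.-tuple R] m.
  apply/measurable_fun_tnthP => k.
  rewrite (_ : _ \o _ = if k == a then fst else (fun t => tnth t k) \o snd).
    case: ifP => _; first exact: measurable_fst.
    by apply: measurableT_comp; [exact: measurable_tnth|exact: measurable_snd].
  by apply/funext => z /=; rewrite tnth_mktuple /upd; case: ifP.
rewrite (_ : (fun z => _) = (fun t : n.-tuple R => u (tnth t)) \o m).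
  exact: measurableT_comp.
apply/funext => z /=; congr u; apply/funext => k; by rewrite tnth_mktuple.
Qed.

Lemma measurable_upd_slice a v u : tame u ->
  measurable_fun [set: R] (fun x => u (upd a x v)).
Proof. by move=> [_ _ cu]; apply: continuous_measurable_fun; exact: cu. Qed.

Lemma integral_upd u a : tame u ->
  (\int[P]_w (u (Xv w))%:E =
   \int[P]_w \int[normal_prob 0 s]_x (u (upd a x (tnth (Z a w))))%:E)%E.
Proof.
move=> tu.
have := @integral_split_at _ _ _ _ P _ n Xk 0 (independent_entry s0 X_normal) a
  (fun z => (u (upd a z.1 (tnth z.2)))%:E).
have e w : u (upd a (split_at Xk 0 a w).1 (tnth (split_at Xk 0 a w).2)) = u (Xv w).
  by congr u; exact: upd_others.
move=> H; transitivity (\int[P]_w (u (upd a (split_at Xk 0 a w).1 (tnth (split_at Xk 0 a w).2)))%:E)%E.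
  by apply: eq_integral => w _; rewrite e.
rewrite H.
- apply: eq_integral => w _; apply: integral_normal_law; last first.
    by move=> A mA; exact: (distribution_entry s0 X_normal).
  apply/measurable_EFinP; exact: (measurable_upd_slice a (tnth (Z a w)) tu).
- by apply/measurable_EFinP; exact: measurable_upd.
- rewrite (_ : _ \o _ = EFin \o (fun w => u (Xv w))); first exact: tame_integrable.
  by apply/funext => w /=; rewrite e.
Qed.

Lemma upd_growth u a v : tame u -> exists C j, forall x,
  `|u (upd a x v)| <= C * (1 + x ^+ 2) ^+ j.
Proof.
move=> [_ [C [j [C0 uC]]] _]; exists (C * wt v ^+ j), j => x.
apply: le_trans (uC _) _; rewrite -mulrA ler_wpM2l// -exprMn.
have x0 := sqr_ge0 x; have w0 := wt_ge0 v.
apply: lerXn2r; rewrite ?nnegrE ?wt_ge0// ?mulr_ge0// ?addr_ge0//.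
rewrite /wt (bigD1 a)//= [in leRHS](bigD1 a)//= {1}/upd eqxx.
have -> : \sum_(k | k != a) upd a x v k ^+ 2 = \sum_(k | k != a) v k ^+ 2.
  by apply: eq_bigr => k /negbTE ka; rewrite /upd ka.
have : 0 <= \sum_(k | k != a) v k ^+ 2 by apply: sumr_ge0 => k _; exact: sqr_ge0.
set S := \sum_(k | _) _ => S0; have v0 := sqr_ge0 (v a).
have : 0 <= x ^+ 2 * S by exact: mulr_ge0.
have : 0 <= x ^+ 2 * v a ^+ 2 by exact: mulr_ge0.
by lra.
Qed.

(** With all coordinates but the [a]-th frozen this is the one-dimensional identity, whose growth
    hypotheses come from [upd_growth]; [integral_upd] restores the outer integral. *)
Theorem normal_vector_stein a h dh : smooth_in a h dh ->
  mean P (fun w => Xv w a * h (Xv w)) = s ^+ 2 * mean P (fun w => dh (Xv w)).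
Proof.
move=> [th tdh hdh].
have txh : tame (fun v => v a * h v) by apply: tameM => //; exact: tame_coord.
rewrite -RintegralZl//; last exact: tame_integrable.
rewrite /mean /Rintegral (integral_upd a txh); congr fine.
have tsd : tame (fun v => s ^+ 2 * dh v) by apply: tameM => //; exact: tame_cst.
rewrite (integral_upd a tsd); apply: eq_integral => w _.
set v := tnth (Z a w).
have [C1 [j1 b1]] := upd_growth a v th; have [C2 [j2 b2]] := upd_growth a v tdh.
pose C := `|C1| + `|C2|; pose j := (j1 + j2)%N.
have q1 (x : R) : 1 <= 1 + x ^+ 2 by rewrite lerDl sqr_ge0.
have gb D i x : (D <= C) -> (i <= j)%N -> D * (1 + x ^+ 2) ^+ i <= C * (1 + x ^+ 2) ^+ j.
  move=> DC ij; apply: (@le_trans _ _ (C * (1 + x ^+ 2) ^+ i)).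
    by rewrite ler_wpM2r// exprn_ge0// (le_trans ler01).
  by rewrite ler_wpM2l ?addr_ge0// ler_weXn2l.
have B1 x : `|h (upd a x v)| <= C * (1 + x ^+ 2) ^+ j.
  apply: le_trans (b1 x) _; apply: gb; last exact: leq_addr.
  by rewrite (le_trans (ler_norm _))// lerDl.
have B2 x : `|dh (upd a x v)| <= C * (1 + x ^+ 2) ^+ j.
  apply: le_trans (b2 x) _; apply: gb; last exact: leq_addl.
  by rewrite (le_trans (ler_norm _))// lerDr.
have cdh : continuous (fun x => dh (upd a x v)) by have [_ _ +] := tdh; exact.
have dd (x : R) : is_derive x 1 (fun x => h (upd a x v)) (dh (upd a x v)).
  have := hdh (upd a x v); rewrite {1}/upd eqxx.
  by under eq_fun do rewrite updE.
have := normal_integration_by_parts s0 dd cdh B1 B2.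
have mv := @measurable_upd_slice a v.
have fin u : tame u -> ((\int[normal_prob 0 s]_x (u (upd a x v))%:E)%E \is a fin_num).
  move=> tu; apply: integrable_fin_num => //; apply: integrable_normal_prob => //; first exact: mv.
  have [D [i bD]] := upd_growth a v tu.
  by apply: (integrable_poly_normal_pdf s0 _ bD); exact: mv.
rewrite -RintegralZl//; last first.
  apply: integrable_normal_prob => //; first exact: mv.
  by apply: (integrable_poly_normal_pdf s0 _ b2); exact: mv.
move=> e; rewrite -(fineK (fin _ txh)) -(fineK (fin _ tsd)); congr EFin.
rewrite -[RHS]e; congr fine; apply: eq_integral => x _.
by rewrite {1}/upd eqxx.
Qed.

End normal_vector_stein.

(** * Moments of the direction of a projected normal vector *)

Section quadratic_forms.
Context {R : realType} (n : nat).
Implicit Types (A B : 'M[R]_n) (v : 'I_n -> R).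

Definition colv v : 'cV[R]_n := \col_k v k.

Definition lin B v (k : 'I_n) : R := (B *m colv v) k 0.

Definition qf B v : R := ((colv v)^T *m B *m colv v) 0 0.

Lemma linE B v k : lin B v k = \sum_l B k l * v l.
Proof. by rewrite /lin mxE; apply: eq_bigr => l _; rewrite mxE. Qed.

Lemma qfE B v : qf B v = \sum_k v k * lin B v k.
Proof.
by rewrite /qf -mulmxA mxE; apply: eq_bigr => k _; congr (_ * _); rewrite !mxE.
Qed.

Lemma lin_dot A B v : \sum_k lin A v k * lin B v k = qf (A^T *m B) v.
Proof.
rewrite /qf mulmxA -trmx_mul -mulmxA mxE.
by apply: eq_bigr => k _; rewrite mxE.
Qed.

Lemma qfD A B v : qf (A + B) v = qf A v + qf B v.
Proof. by rewrite /qf mulmxDr mulmxDl mxE. Qed.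

Lemma qfZ c B v : qf (c *: B) v = c * qf B v.
Proof. by rewrite /qf -scalemxAr -scalemxAl mxE. Qed.

Lemma qf_tr B v : qf B^T v = qf B v.
Proof.
have e (M : 'M[R]_1) : M 0 0 = M^T 0 0 by rewrite mxE.
by rewrite /qf e !trmx_mul !trmxK mulmxA.
Qed.

Lemma smooth_in_lin a B k : smooth_in a (fun v => lin B v k) (fun=> B k a).
Proof.
rewrite (_ : (fun v => lin B v k) = (fun v => \sum_l B k l * v l)); last first.
  by apply/funext => v; rewrite linE.
rewrite (_ : (fun=> B k a) = (fun v : 'I_n -> R => \sum_l (0 * v l + B k l * (l == a)%:R))).
  apply: smooth_in_sum => l.
  by apply: smooth_inM; [exact: smooth_in_cst|exact: smooth_in_coord].
apply/funext => v; rewrite (bigD1 a)//= eqxx mulr1 mul0r add0r big1 ?addr0// => l /negbTE ->.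
by rewrite mulr0 mul0r addr0.
Qed.

Lemma smooth_in_qf a B : B^T = B -> smooth_in a (qf B) (fun v => 2 * lin B v a).
Proof.
move=> sB.
rewrite (_ : qf B = (fun v => \sum_k v k * lin B v k)); last first.
  by apply/funext => v; rewrite qfE.
rewrite (_ : (fun v => 2 * _) = (fun v : 'I_n -> R =>
    \sum_k ((k == a)%:R * lin B v k + v k * B k a))).
  apply: smooth_in_sum => k.
  by apply: smooth_inM; [exact: smooth_in_coord|exact: smooth_in_lin].
apply/funext => v; rewrite big_split/= (bigD1 a)//= eqxx mul1r big1 => [|k /negbTE ->]; last first.
  by rewrite mul0r.
rewrite addr0 mulr_natl mulr2n; congr (_ + _); rewrite linE.
by apply: eq_bigr => k _; rewrite mulrC -{1}sB mxE.
Qed.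

Lemma tame_qf B : tame (qf B).
Proof.
rewrite (_ : qf B = (fun v => \sum_k v k * lin B v k)); last first.
  by apply/funext => v; rewrite qfE.
apply: tame_sum => k _; apply: tameM; first exact: tame_coord.
rewrite (_ : (fun v => lin B v k) = (fun v => \sum_l B k l * v l)); last first.
  by apply/funext => v; rewrite linE.
by apply: tame_sum => l _; apply: tameM; [exact: tame_cst|exact: tame_coord].
Qed.

Section projector.
Variable Pm : 'M[R]_n.
Hypotheses (Psym : Pm^T = Pm) (Pidem : Pm *m Pm = Pm).

Lemma qf_proj_sum v : qf Pm v = \sum_k lin Pm v k ^+ 2.
Proof.
rewrite -{1}Pidem -{1}Psym -lin_dot; apply: eq_bigr => k _; exact: expr2.
Qed.

Lemma qf_proj_ge0 v : 0 <= qf Pm v.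
Proof. by rewrite qf_proj_sum sumr_ge0// => k _; exact: sqr_ge0. Qed.

(** Matrices living on the range of the projection: their quadratic forms are dominated by [qf Pm],
    so the ratios studied below are bounded. *)
Definition carried B := Pm *m B = B /\ B *m Pm = B.

Lemma qf_carried_le B : carried B -> exists2 C, 0 <= C & forall v, `|qf B v| <= C * qf Pm v.
Proof.
move=> [PB BP]; exists (\sum_k \sum_l `|B k l|).
  by apply: sumr_ge0 => k _; apply: sumr_ge0.
move=> v.
have -> : qf B v = \sum_k \sum_l B k l * (lin Pm v k * lin Pm v l).
  have -> : qf B v = \sum_k lin Pm v k * (B *m (Pm *m colv v)) k 0.
    rewrite /qf -{1}PB -{1}BP -{1}Psym !mulmxA -trmx_mul -!mulmxA mxE.
    by apply: eq_bigr => k _; rewrite mxE.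
  apply: eq_bigr => k _; rewrite mxE mulr_sumr; apply: eq_bigr => l _.
  by rewrite /lin; ring.
rewrite mulr_suml; apply: le_trans (ler_norm_sum _ _ _) _; apply: ler_sum => k _.
rewrite mulr_suml; apply: le_trans (ler_norm_sum _ _ _) _; apply: ler_sum => l _.
rewrite normrM ler_wpM2l//.
have pk j : lin Pm v j ^+ 2 <= qf Pm v.
  by rewrite qf_proj_sum (bigD1 j)//= lerDl sumr_ge0// => i _; exact: sqr_ge0.
rewrite normrM; have := pk k; have := pk l.
rewrite -(real_normK (num_real (lin Pm v k))) -(real_normK (num_real (lin Pm v l))).
by have := sqr_ge0 (`|lin Pm v k| - `|lin Pm v l|); lra.
Qed.

End projector.
End quadratic_forms.

(** * Ratios of quadratic forms of a projected normal vector *)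

Section projected_normal.
Context {R : realType} (s : R) (s0 : 0 < s).
Context d (Om : measurableType d) (P : probability Om R) (n : nat)
  (X : {RV P >-> n.-tuple R}).
Hypothesis X_normal : has_mvnormal_distribution X 0 ((s ^+ 2)%:M).
Variable Pm : 'M[R]_n.
Hypotheses (Psym : Pm^T = Pm) (Pidem : Pm *m Pm = Pm).
Implicit Types (N A M : 'M[R]_n) (F G H : ('I_n -> R) -> R) (v : 'I_n -> R).

Let Xv w : 'I_n -> R := tnth (X w).
Let E F : R := mean P (fun w => F (Xv w)).
Let q := qf Pm.
Let q_ge0 v : 0 <= q v. Proof. exact: qf_proj_ge0. Qed.
Let tame_q : tame q. Proof. exact: tame_qf. Qed.

Let int F : tame F -> P.-integrable [set: Om] (EFin \o (fun w => F (Xv w))).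
Proof. exact: (tame_integrable s0 X_normal). Qed.

Let E_D F G : tame F -> tame G -> E (fun v => F v + G v) = E F + E G.
Proof. by move=> tF tG; apply: RintegralD => //; exact: int. Qed.

Let E_Z c F : tame F -> E (fun v => c * F v) = c * E F.
Proof. by move=> tF; apply: RintegralZl => //; exact: int. Qed.

Let E_sum (I : Type) (r : seq I) (F : I -> ('I_n -> R) -> R) :
  (forall i, tame (F i)) -> E (fun v => \sum_(i <- r) F i v) = \sum_(i <- r) E (F i).
Proof.
move=> tF; elim: r => [|a r IH].
  rewrite big_nil -[RHS](mean_cst P); apply: eq_mean => w; exact: big_nil.
rewrite big_cons -IH -E_D//; last exact: tame_sum.
by apply: eq_mean => w; rewrite big_cons.
Qed.

Let iq del v := (q v + del)^-1.

Let tame_iq del : 0 < del -> tame (iq del).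
Proof. by move=> d0; exact: tameV. Qed.

(** The vector field N v F(v) / (q(v) + delta)^k is integrated by parts in each coordinate. Its
    divergence has three terms: the trace of [N], the derivative of [F] along N v, and that of the
    denominator, where N Pm = N turns the product of N v with the gradient of q into 2 [qf N]. *)
Let stein_delta N F dF k del : N^T = N -> N *m Pm = N -> 0 < del ->
  (forall a, smooth_in a F (dF a)) -> tame F ->
  E (fun v => qf N v * F v * iq del v ^+ k) =
  s ^+ 2 * (\tr N * E (fun v => F v * iq del v ^+ k) +
    E (fun v => (\sum_a lin N v a * dF a v) * iq del v ^+ k) -
    2 * k%:R * E (fun v => qf N v * F v * iq del v ^+ k.+1)).
Proof.
move=> sN NP d0 sF tF.
have tiq := tame_iq d0; have tqN := tame_qf N.
have tl a : tame (fun v => lin N v a) by have [] := smooth_in_lin a N a.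
have tdF a : tame (dF a) by have [] := sF a.
pose h a v := lin N v a * (F v * iq del v ^+ k).
pose dh a v := N a a * (F v * iq del v ^+ k) +
  lin N v a * (dF a v * iq del v ^+ k +
    F v * (k%:R * iq del v ^+ k.-1 * - (iq del v ^+ 2 * (2 * lin Pm v a)))).
have sh a : smooth_in a (h a) (dh a).
  apply: smooth_inM; first exact: smooth_in_lin.
  apply: smooth_inM; first exact: sF.
  apply: smooth_inX; apply: smooth_inV => //.
  exact: smooth_in_qf.
have th a : tame (fun v => v a * h a v).
  by apply: tameM; [exact: tame_coord|have [] := sh a].
have tdh a : tame (dh a) by have [] := sh a.
transitivity (\sum_a E (fun v => v a * h a v)).
  rewrite -E_sum//; apply: eq_mean => w; rewrite qfE !mulr_suml.
  by apply: eq_bigr => a _; rewrite /h !mulrA.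
transitivity (\sum_a s ^+ 2 * E (dh a)).
  by apply: eq_bigr => a _; exact: (normal_vector_stein s0 X_normal (sh a)).
rewrite -mulr_sumr -E_sum//; congr (_ * _).
have t1 : tame (fun v => F v * iq del v ^+ k) by apply: tameM => //; exact: tameX.
have t2 : tame (fun v => (\sum_a lin N v a * dF a v) * iq del v ^+ k).
  by apply: tameM; [apply: tame_sum => a _; exact: tameM|exact: tameX].
have t3 : tame (fun v => qf N v * F v * iq del v ^+ k.+1).
  by apply: tameM; [exact: tameM|exact: tameX].
rewrite -E_Z// -E_D//; last by apply: tameM => //; exact: tame_cst.
rewrite -mulNr -E_Z// -E_D//; last 2 first.
- by apply: tameD => //; apply: tameM => //; exact: tame_cst.
- by apply: tameM => //; exact: tame_cst.
apply: eq_mean => w; set v := Xv w; rewrite /dh big_split/=.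
rewrite -mulr_suml -/(\tr N) -addrA; congr (_ + _).
have kk : k%:R * iq del v ^+ k.-1 * iq del v ^+ 2 = k%:R * iq del v ^+ k.+1.
  case: (k) => [|k']; first by rewrite !mul0r.
  by rewrite /= -mulrA -exprD addn2.
have -> : qf N v = \sum_a lin N v a * lin Pm v a by rewrite lin_dot sN NP.
rewrite !mulr_suml mulr_sumr -big_split/=; apply: eq_bigr => a _.
rewrite mulrDr mulrA; congr (_ + _).
transitivity (- 2 * (k%:R * iq del v ^+ k.-1 * iq del v ^+ 2) * (lin N v a * lin Pm v a * F v)).
  by ring.
by rewrite kk; ring.
Qed.

(* The unregularised powers are limits of [iq (n.+1)^-1] because the numerators
   vanish where [q] does. *)
Let lim_iq G H k : tame G -> tame H -> (forall v, `|G v| <= H v * q v ^+ k) ->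
  E (fun v => G v * iq (j.+1%:R)^-1 v ^+ k) @[j --> \oo] --> E (fun v => G v * (q v)^-1 ^+ k).
Proof.
move=> tG tH GH.
have mq : measurable_fun [set: Om] (fun w => q (Xv w)) by exact: (tame_measurable _ tame_q).
have mG : measurable_fun [set: Om] (fun w => G (Xv w)) by exact: (tame_measurable _ tG).
have G0 v : q v = 0 -> (0 < k)%N -> G v = 0.
  move=> qv k0; apply/eqP; rewrite -normr_le0; apply: le_trans (GH v) _.
  by rewrite qv expr0n eqn0Ngt k0 mulr0.
have H0 v : 0 < q v -> 0 <= H v.
  move=> qv; have := le_trans (normr_ge0 _) (GH v).
  by rewrite pmulr_lge0// exprn_gt0.
pose f_ j w := (G (Xv w) * iq (j.+1%:R)^-1 (Xv w) ^+ k)%:E.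
pose f w := (G (Xv w) * (q (Xv w))^-1 ^+ k)%:E.
have cvg_w w : f_ j w @[j --> \oo] --> f w.
  apply: cvg_EFin; first by near=> j.
  set v := Xv w; have [qv|qv] := eqVneq (q v) 0.
    have [k0|k0] := posnP k.
      rewrite (_ : fine \o _ = fun=> G v * (q v)^-1 ^+ k); first exact: cvg_cst.
      by apply/funext => j /=; rewrite -/v k0 !expr0.
    rewrite G0// (_ : fine \o _ = fun=> 0 * (q v)^-1 ^+ k); first exact: cvg_cst.
    by apply/funext => j /=; rewrite -/v G0// !mul0r.
  have ci : iq (j.+1%:R)^-1 v @[j --> \oo] --> (q v)^-1.
    apply: cvgV => //; rewrite -[X in _ --> X](addr0 (q v)).
    by apply: cvgD; [exact: cvg_cst|exact: cvg_harmonic].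
  apply: cvgM; first exact: cvg_cst.
  elim: (k) => [|k' IH].
    by under eq_fun do rewrite expr0; rewrite expr0; exact: cvg_cst.
  by under eq_fun do rewrite exprS; rewrite exprS; exact: cvgM.
have dom w j : (`|f_ j w| <= (`|H (Xv w)|)%:E)%E.
  rewrite lee_fin; set v := Xv w; have d0 : 0 < (j.+1%:R : R)^-1 by rewrite invr_gt0.
  rewrite normrM normrX normfV (ger0_norm (addr_ge0 (q_ge0 v) (ltW d0))).
  have qd : 0 < q v + (j.+1%:R)^-1 by rewrite ltr_wpDl.
  rewrite -/(iq _ _) exprVn ler_pdivrMr ?exprn_gt0//.
  apply: le_trans (GH v) _.
  have [qv|qv] := leP (q v) 0.
    have qv0 : q v = 0 by apply/eqP; rewrite eq_le qv q_ge0.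
    have [k0|k0] := posnP k; first by rewrite k0 !expr0 !mulr1 ler_norm.
    by rewrite qv0 expr0n eqn0Ngt k0 mulr0 mulr_ge0// exprn_ge0// add0r ltW.
  rewrite (ger0_norm (H0 _ qv)) ler_wpM2l ?H0//.
  by rewrite lerXn2r ?nnegrE// ?ltW// ltrDl.
have mf_ j : measurable_fun [set: Om] (f_ j).
  apply/measurable_EFinP.
  have d0 : 0 < (j.+1%:R : R)^-1 by rewrite invr_gt0.
  apply: (@tame_measurable _ _ _ _ _ X (fun v => G v * iq (j.+1%:R)^-1 v ^+ k)).
  by apply: tameM => //; apply: tameX; exact: tame_iq.
have mf : measurable_fun [set: Om] f.
  by apply: (emeasurable_fun_cvg f_) => // w _; exact: cvg_w.
have iH : P.-integrable [set: Om] (fun w => (`|H (Xv w)|)%:E).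
  by have := integrable_abse (int tH).
have [] := @dominated_convergence _ _ _ P setT measurableT f_ f
  (fun w => (`|H (Xv w)|)%:E).
- by move=> j; exact: mf_.
- exact: mf.
- by apply: aeW => w _; exact: cvg_w.
- exact: iH.
- by apply: aeW => w j _; exact: dom.
move=> fi _ cv.
apply: fine_cvg; rewrite fineK; first exact: cv.
exact: integrable_fin_num.
Unshelve. all: by end_near. Qed.

(** Order of vanishing in [q]: it makes division by (q + delta)^k bounded uniformly in delta. *)
Let dominated k F := exists2 C, 0 <= C & forall v, `|F v| <= C * q v ^+ k.

Let dominatedM i j F G : dominated i F -> dominated j G ->
  dominated (i + j) (fun v => F v * G v).
Proof.
move=> [C C0 bF] [D D0 bG]; exists (C * D); first exact: mulr_ge0.
by move=> v; rewrite exprD mulrACA normrM ler_pM.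
Qed.

Let dominatedZ c k F : dominated k F -> dominated k (fun v => c * F v).
Proof.
move=> [C C0 bF]; exists (`|c| * C); first exact: mulr_ge0.
by move=> v; rewrite normrM -mulrA ler_wpM2l.
Qed.

Let dominatedX F j : dominated 1 F -> dominated j (fun v => F v ^+ j).
Proof.
move=> [C C0 bF]; exists (C ^+ j); first exact: exprn_ge0.
by move=> v; rewrite normrX -exprMn; apply: lerXn2r; rewrite ?nnegrE ?mulr_ge0.
Qed.

Let dominated_qf A : carried Pm A -> dominated 1 (qf A).
Proof.
move=> cA; have [C C0 bA] := qf_carried_le Psym Pidem cA.
by exists C => // v; rewrite expr1.
Qed.

Let dominated0 k F v : dominated k F -> (0 < k)%N -> q v = 0 -> F v = 0.
Proof.
move=> [C _ bF] k0 qv; apply/eqP; rewrite -normr_le0; apply: le_trans (bF v) _.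
by rewrite qv expr0n eqn0Ngt k0 mulr0.
Qed.

(** The limit of [stein_delta] along delta = 1 / (j + 1). The numerator on the left vanishes to
    order k + 1 but is divided only by q^k, so its dominating function is C q rather than a
    constant. *)
Let ratio_stein N F dF k : N^T = N -> carried Pm N ->
  (forall a, smooth_in a F (dF a)) -> tame F -> dominated k F ->
  dominated k (fun v => \sum_a lin N v a * dF a v) ->
  E (fun v => qf N v * F v * (q v)^-1 ^+ k) =
  s ^+ 2 * (\tr N * E (fun v => F v * (q v)^-1 ^+ k) +
    E (fun v => (\sum_a lin N v a * dF a v) * (q v)^-1 ^+ k) -
    2 * k%:R * E (fun v => qf N v * F v * (q v)^-1 ^+ k.+1)).
Proof.
move=> sN cN sF tF dF_ ddF; have [_ NP] := cN.
have tqN := tame_qf N.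
have tNF : tame (fun v => qf N v * F v) by exact: tameM.
have tdF : tame (fun v => \sum_a lin N v a * dF a v).
  apply: tame_sum => a _; have [_ + _] := sF a; apply: tameM.
  by have [] := smooth_in_lin a N a.
have [C C0 bNF] := dominatedM (dominated_qf cN) dF_.
have [C2 _ bF] := dF_; have [C3 _ bdF] := ddF.
have tCq : tame (fun v => C * q v) by apply: tameM => //; exact: tame_cst.
have bNF1 v : `|qf N v * F v| <= C * q v * q v ^+ k.
  by apply: le_trans (bNF v) _; rewrite exprS mulrA.
have l1 := lim_iq tNF tCq bNF1.
have l2 := lim_iq tF (tame_cst n C2) bF.
have l3 := lim_iq tdF (tame_cst n C3) bdF.
have l4 := lim_iq tNF (tame_cst n C) bNF.
have sd j : 0 < (j.+1%:R : R)^-1 by rewrite invr_gt0.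
rewrite -(cvg_lim (@Rhausdorff R) l1); apply/cvg_lim; first exact: Rhausdorff.
under eq_fun do rewrite (stein_delta k sN NP (sd _) sF tF).
apply: cvgM; first exact: cvg_cst.
apply: cvgB; first apply: cvgD.
- by apply: cvgM; [exact: cvg_cst|exact: l2].
- exact: l3.
- by apply: cvgM; [exact: cvg_cst|exact: l4].
Qed.

Definition qratio A v : R := qf A v / q v.

Lemma bm_qratio A : carried Pm A -> bm (fun w => qratio A (Xv w)).
Proof.
move=> cA; split.
  apply: measurable_funM; first exact: (tame_measurable _ (tame_qf A)).
  rewrite (_ : (fun _ => _) = (fun w => q (Xv w) `^ (-1))); last first.
    by apply/funext => w; rewrite powR_inv1.
  apply: (@measurableT_comp _ _ _ _ _ _ (@powR R ^~ (-1))); first exact: measurable_powR.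
  exact: (tame_measurable _ tame_q).
have [C C0 bA] := dominated_qf cA; exists C => w.
have := bA (Xv w); rewrite expr1 /qratio normrM normfV (ger0_norm (q_ge0 _)).
have [->|qn] := eqVneq (q (Xv w)) 0; first by rewrite invr0 !mulr0.
by rewrite ler_pdivrMr// lt_neqAle eq_sym qn q_ge0.
Qed.

(* [qratio A] is a function of the direction [w = Pm X / |Pm X|], uniform on a
   sphere. The identity comes from integrating one function by parts in two
   ways, written as [qf M * (qf A ^+ l / q ^+ l)] and as
   [qf Pm * (qf M * qf A ^+ l / q ^+ l.+1)]. *)
Lemma mean_qratio_rec M A l : M^T = M -> carried Pm M -> A^T = A -> carried Pm A ->
  (\tr Pm + 2 * l%:R) * mean P (fun w => qratio M (Xv w) * qratio A (Xv w) ^+ l) =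
  \tr M * mean P (fun w => qratio A (Xv w) ^+ l) +
  2 * l%:R * mean P (fun w => qratio (M *m A) (Xv w) * qratio A (Xv w) ^+ l.-1).
Proof.
move=> sM cM sA cA; have [PM MP] := cM; have [PA AP] := cA.
have cP : carried Pm Pm by [].
have cMA : carried Pm (M *m A) by split; rewrite ?mulmxA ?PM// -mulmxA AP.
have dM := dominated_qf cM; have dA := dominated_qf cA; have dMA := dominated_qf cMA.
have tM := tame_qf M; have tA := tame_qf A.
pose FS v := qf A v ^+ l.
pose dFS a v := l%:R * qf A v ^+ l.-1 * (2 * lin A v a).
pose FR v := qf M v * qf A v ^+ l.
pose dFR a v := 2 * lin M v a * qf A v ^+ l + qf M v * dFS a v.
have sFS a : smooth_in a FS (dFS a) by apply: smooth_inX; exact: smooth_in_qf.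
have sFR a : smooth_in a FR (dFR a) by apply: smooth_inM => //; exact: smooth_in_qf.
have dotS N v : N^T = N -> \sum_a lin N v a * dFS a v = 2 * l%:R * (qf (N *m A) v * qf A v ^+ l.-1).
  move=> sN; rewrite -[in RHS]sN -lin_dot mulr_suml mulr_sumr.
  by apply: eq_bigr => a _; rewrite /dFS; ring.
have eX v : l%:R * (qf A v * qf A v ^+ l.-1) = l%:R * qf A v ^+ l.
  by case: (l) => [|l']; rewrite ?mul0r// -exprS.
have dotR v : \sum_a lin Pm v a * dFR a v = 2 * l.+1%:R * FR v.
  transitivity (2 * qf (Pm *m M) v * qf A v ^+ l + qf M v * \sum_a lin Pm v a * dFS a v).
    rewrite -[X in qf (X *m M)]Psym -lin_dot mulr_sumr mulr_suml mulr_sumr -big_split/=.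
    by apply: eq_bigr => a _; rewrite /dFR; ring.
  rewrite dotS// PM PA -!mulrA eX /FR -natr1; ring.
have ldom : dominated l (fun v => 2 * l%:R * (qf (M *m A) v * qf A v ^+ l.-1)).
  case: (l) => [|l'].
    by exists 0 => // v; rewrite mulr0 mul0r normr0 mul0r.
  by apply: dominatedZ; rewrite -add1n; apply: dominatedM => //; exact: dominatedX.
have dFR_ : dominated l.+1 FR by rewrite -add1n; apply: dominatedM => //; exact: dominatedX.
have bM := bm_qratio cM; have bA := bm_qratio cA; have bMA := bm_qratio cMA.
set Y := mean P (fun w => qratio M (Xv w) * qratio A (Xv w) ^+ l).
set Z := mean P (fun w => qratio A (Xv w) ^+ l).
set W := mean P (fun w => qratio (M *m A) (Xv w) * qratio A (Xv w) ^+ l.-1).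
have rX v j : qf A v ^+ j * (q v)^-1 ^+ j = qratio A v ^+ j by rewrite -exprMn.
have eY : E (fun v => FR v * (q v)^-1 ^+ l.+1) = Y.
  by apply: eq_mean => w; rewrite /FR exprS mulrACA rX.
have eZ : E (fun v => FS v * (q v)^-1 ^+ l) = Z by apply: eq_mean => w; rewrite rX.
have eW : E (fun v => (\sum_a lin M v a * dFS a v) * (q v)^-1 ^+ l) = 2 * l%:R * W.
  rewrite -meanZ; last by apply: bmM => //; exact: bmX.
  apply: eq_mean => w; rewrite dotS// -!mulrA; case: (l) => [|l']; first by rewrite !mul0r.
  by rewrite /= exprS -rX /qratio (mulrCA _ (q (Xv w))^-1 (_ ^+ _)).
have S : E (fun v => FR v * (q v)^-1 ^+ l) = s ^+ 2 * (\tr M * Z + 2 * l%:R * W - 2 * l%:R * Y).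
  rewrite -eZ -eW -eY; apply: ratio_stein => //; [exact: tameX|exact: dominatedX|].
  by rewrite (funext (fun v => dotS M v sM)).
have tFR : tame FR by apply: tameM => //; exact: tameX.
(* Where [q] vanishes so does [FR], hence cancelling a factor [q] is correct there as well. *)
have eR1 : E (fun v => qf Pm v * FR v * (q v)^-1 ^+ l.+1) = E (fun v => FR v * (q v)^-1 ^+ l).
  apply: eq_mean => w; set v := Xv w; have [q0|qn] := eqVneq (q v) 0.
    by rewrite (dominated0 dFR_ _ q0)// mulr0 !mul0r.
  by rewrite -/(q v) exprS; field.
have eR2 : E (fun v => qf Pm v * FR v * (q v)^-1 ^+ l.+2) = Y.
  rewrite -eY; apply: eq_mean => w; set v := Xv w; have [q0|qn] := eqVneq (q v) 0.
    by rewrite (dominated0 dFR_ _ q0)// mulr0 !mul0r.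
  by rewrite -/(q v) [in LHS]exprS; field.
have eR3 : E (fun v => (\sum_a lin Pm v a * dFR a v) * (q v)^-1 ^+ l.+1) = 2 * l.+1%:R * Y.
  rewrite -meanZ; last by apply: bmM => //; exact: bmX.
  by apply: eq_mean => w; rewrite dotR -mulrA; congr (_ * _); rewrite /FR exprS mulrACA rX.
have Q := @ratio_stein Pm FR dFR l.+1 Psym cP sFR tFR dFR_ _.
rewrite eR1 eR2 eR3 eY S in Q.
have {}Q : s ^+ 2 * (\tr M * Z + 2 * l%:R * W - 2 * l%:R * Y) =
    s ^+ 2 * (\tr Pm * Y + 2 * l.+1%:R * Y - 2 * l.+1%:R * Y).
  by apply: Q; rewrite (funext dotR); exact: dominatedZ.
(* The variance cancels, as it must: the direction does not depend on the scale. *)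
have s2 : s ^+ 2 != 0 by rewrite expf_neq0// gt_eqF.
by move/(mulfI s2): Q => e; rewrite mulrDl; lra.
Qed.

End projected_normal.

(** * The Frobenius norm *)

Section frobenius.
Context {R : realType}.

(** Lagrange's identity: the double sum is twice the difference of the two sides. *)
Lemma cauchy_schwarz_ip (D : finType) (u v : D -> R) : ip u v ^+ 2 <= ip u u * ip v v.
Proof.
have : 0 <= \sum_k \sum_l (u k * v l - u l * v k) ^+ 2.
  by apply: sumr_ge0 => k _; apply: sumr_ge0 => l _; exact: sqr_ge0.
have -> : \sum_k \sum_l (u k * v l - u l * v k) ^+ 2 =
    \sum_k \sum_l ((u k * u k) * (v l * v l)) + \sum_k \sum_l ((v k * v k) * (u l * u l)) -
    2 * \sum_k \sum_l ((u k * v k) * (u l * v l)).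
  rewrite mulr_sumr -big_split -sumrB; apply: eq_bigr => k _ /=.
  by rewrite mulr_sumr -big_split -sumrB; apply: eq_bigr => l _ /=; ring.
by rewrite -!big_distrlr /= -/(ip u u) -/(ip v v) -/(ip u v); lra.
Qed.

Definition frob n (A : 'M[R]_n) : R := \tr (A^T *m A).

Lemma frobE n (A : 'M[R]_n) : frob A = \sum_k \sum_l A k l ^+ 2.
Proof.
rewrite exchange_big; apply: eq_bigr => l _ /=; rewrite mxE.
by apply: eq_bigr => k _; rewrite !mxE expr2.
Qed.

Lemma frobZ n (A : 'M[R]_n) c : frob (c *: A) = c ^+ 2 * frob A.
Proof.
rewrite !frobE mulr_sumr; apply: eq_bigr => k _; rewrite mulr_sumr.
by apply: eq_bigr => l _; rewrite mxE exprMn.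
Qed.

Lemma frobBZ n (A B : 'M[R]_n) c :
  frob (A - c *: B) = frob A - 2 * c * \tr (A^T *m B) + c ^+ 2 * frob B.
Proof.
have -> : \tr (A^T *m B) = \sum_k \sum_l A k l * B k l.
  rewrite exchange_big; apply: eq_bigr => l _ /=; rewrite mxE.
  by apply: eq_bigr => k _; rewrite !mxE.
rewrite !frobE !mulr_sumr -sumrB -big_split/=; apply: eq_bigr => k _.
rewrite !mulr_sumr -sumrB -big_split/=; apply: eq_bigr => l _.
by rewrite !mxE; ring.
Qed.

Lemma frob_ge0 n (A : 'M[R]_n) : 0 <= frob A.
Proof. by rewrite frobE; do 2 (apply: sumr_ge0 => ? _); exact: sqr_ge0. Qed.

Lemma frob_tr n (A : 'M[R]_n) : frob A^T = frob A.
Proof. by rewrite /frob trmxK mxtrace_mulC. Qed.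

Lemma frob_mul n (A B : 'M[R]_n) : frob (A *m B) <= frob A * frob B.
Proof.
rewrite -[in leRHS](frob_tr B) !frobE mulr_suml; apply: ler_sum => k _.
rewrite mulr_sumr; apply: ler_sum => l _; rewrite mxE.
apply: le_trans (cauchy_schwarz_ip (A k) (fun j => B j l)) _.
rewrite le_eqVlt; apply/orP; left; apply/eqP.
by congr (_ * _); apply: eq_bigr => j _; rewrite ?mxE expr2.
Qed.

(** The difference of the two sides is the squared norm of (1 - Pm) Z. *)
Lemma frob_proj n (Pm Z : 'M[R]_n) : Pm^T = Pm -> Pm *m Pm = Pm ->
  frob (Pm *m Z) <= frob Z.
Proof.
move=> sP iP; have e (Q : 'M[R]_n) : Q^T = Q -> Q *m Q = Q -> frob (Q *m Z) = \tr (Z^T *m Q *m Z).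
  by move=> sQ iQ; rewrite /frob trmx_mul sQ mulmxA -(mulmxA _ Q Q) iQ.
have := frob_ge0 ((1%:M - Pm) *m Z); rewrite !e//; first last.
- by rewrite mulmxBl !mul1mx mulmxBr mulmx1 iP subrr subr0.
- by rewrite linearB/= sP trmx1.
rewrite mulmxBr mulmx1 mulmxBl linearB/= /frob; lra.
Qed.

Lemma frob_proj2 n (Pm Z : 'M[R]_n) : Pm^T = Pm -> Pm *m Pm = Pm ->
  frob (Pm *m Z *m Pm) <= frob Z.
Proof.
move=> sP iP; rewrite -mulmxA; apply: le_trans (frob_proj _ sP iP) _.
by rewrite -frob_tr trmx_mul sP -[leRHS]frob_tr frob_proj.
Qed.

End frobenius.

(** * The centred direction matrix *)

Section direction.
Context {R : realType} (n : nat) (Pm : 'M[R]_n).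
Hypotheses (Psym : Pm^T = Pm) (Pidem : Pm *m Pm = Pm).
Implicit Types (v : 'I_n -> R) (Z : 'M[R]_n).

Definition mxfun Z : 'I_n * 'I_n -> R := fun p => Z p.1 p.2.

Lemma ip_mxfun A Z : ip (mxfun A) (mxfun Z) = \tr (A^T *m Z).
Proof.
rewrite /ip -(pair_bigA _ (fun k l => A k l * Z k l))/= exchange_big.
by apply: eq_bigr => l _ /=; rewrite mxE; apply: eq_bigr => k _; rewrite !mxE.
Qed.

Lemma frob_mxfun Z : ip (mxfun Z) (mxfun Z) = frob Z.
Proof. exact: ip_mxfun. Qed.

(* [w w'] for [w = Pm v / |Pm v|], and the zero matrix when [Pm v = 0]. *)
Definition dirmx v : 'M[R]_n :=
  \matrix_(k, l) (lin Pm v k * lin Pm v l / qf Pm v).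

Definition cdir v : 'I_n * 'I_n -> R := mxfun (dirmx v - (\tr Pm)^-1 *: Pm).

Lemma tr_dirmx v Z : \tr ((dirmx v)^T *m Z) = qratio Pm (Pm *m Z *m Pm) v.
Proof.
transitivity (\sum_l \sum_k lin Pm v k * lin Pm v l / qf Pm v * Z k l).
  by apply: eq_bigr => l _; rewrite mxE; apply: eq_bigr => k _; rewrite !mxE.
have -> : qratio Pm (Pm *m Z *m Pm) v = (\sum_k lin Pm v k * lin (Z *m Pm) v k) / qf Pm v.
  by rewrite lin_dot Psym mulmxA.
rewrite exchange_big/= mulr_suml; apply: eq_bigr => k _.
have -> : lin (Z *m Pm) v k = \sum_l Z k l * lin Pm v l by rewrite /lin -mulmxA mxE.
by rewrite mulr_sumr mulr_suml; apply: eq_bigr => l _; ring.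
Qed.

Lemma qratio_proj v : qratio Pm Pm v = (qf Pm v != 0)%:R.
Proof.
by rewrite /qratio; have [->|q0] := eqVneq (qf Pm v) 0; rewrite ?mul0r ?divff.
Qed.

Lemma ip_cdir v Z :
  ip (cdir v) (mxfun Z) = qratio Pm (Pm *m Z *m Pm) v - \tr (Pm *m Z) / \tr Pm.
Proof.
rewrite ip_mxfun -tr_dirmx linearB/= mulmxBl mxtraceD linearZ/= Psym -scalemxAl.
by rewrite linearN/= linearZ/= mulrC.
Qed.

Lemma frob_dirmx v : frob (dirmx v) = qratio Pm Pm v.
Proof.
have s : \sum_k lin Pm v k * lin Pm v k = qf Pm v.
  by rewrite lin_dot Psym Pidem.
rewrite frobE /qratio; have [q0|q0] := eqVneq (qf Pm v) 0.
  rewrite q0 invr0 mulr0 big1// => k _; rewrite big1// => l _.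
  by rewrite mxE q0 invr0 mulr0 expr0n.
transitivity (\sum_k \sum_l (lin Pm v k * lin Pm v k) * (lin Pm v l * lin Pm v l) / (qf Pm v * qf Pm v)).
  by apply: eq_bigr => k _; apply: eq_bigr => l _; rewrite mxE; field.
under eq_bigr do rewrite -mulr_suml -mulr_sumr s.
by rewrite -!mulr_suml s; field.
Qed.

Lemma frob_projE : frob Pm = \tr Pm.
Proof. by rewrite /frob Psym Pidem. Qed.

Lemma qratio_proj_proj2 v : qratio Pm (Pm *m Pm *m Pm) v = qratio Pm Pm v.
Proof. by rewrite !Pidem. Qed.

Hypothesis rank_ge1 : 1 <= \tr Pm.

(** The squared norm is 1 - 1/m when Pm v is nonzero and 1/m when it is zero, where m is the
    rank. *)
Lemma cdir_le1 v : ip (cdir v) (cdir v) <= 1.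
Proof.
set c := (\tr Pm)^-1; have m0 : \tr Pm != 0 by rewrite gt_eqF// (lt_le_trans ltr01).
have c01 : 0 <= c <= 1.
  by rewrite invr_ge0 invf_le1 ?rank_ge1 ?(le_trans ler01) ?(lt_le_trans ltr01).
have -> : ip (cdir v) (cdir v) = qratio Pm Pm v - 2 * c * qratio Pm Pm v + c.
  rewrite /cdir frob_mxfun frobBZ frob_dirmx tr_dirmx qratio_proj_proj2 frob_projE -/c.
  by rewrite (expr2 c) -(mulrA c c) mulVf// mulr1.
rewrite qratio_proj; move: c01 => /andP[c0 c1].
by case: (_ != 0); rewrite /=; lra.
Qed.

End direction.

Section direction_measurable.
Context {R : realType} (n : nat) (Pm : 'M[R]_n).
Hypotheses (Psym : Pm^T = Pm) (Pidem : Pm *m Pm = Pm).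

Lemma bm_cdir (p : 'I_n * 'I_n) : bm (fun t : n.-tuple R => cdir Pm (tnth t) p).
Proof.
have ml k : measurable_fun [set: n.-tuple R] (fun t => lin Pm (tnth t) k).
  under eq_fun do rewrite linE; apply: measurable_sum => l.
  by apply: measurable_funM; [exact: measurable_cst|exact: measurable_tnth].
rewrite /cdir /mxfun; split.
  under eq_fun do rewrite !mxE; apply: measurable_funB; last exact: measurable_cst.
  apply: measurable_funM; first by apply: measurable_funM; exact: ml.
  rewrite (_ : (fun _ => _) = (fun t : n.-tuple R => qf Pm (tnth t) `^ (-1))); last first.
    by apply/funext => w; rewrite powR_inv1// qf_proj_ge0.
  apply: (@measurableT_comp _ _ _ _ _ _ (@powR R ^~ (-1))); first exact: measurable_powR.
  under eq_fun do rewrite (qf_proj_sum Psym Pidem).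
  by apply: measurable_sum => k; apply: measurable_funX; exact: ml.
exists (1 + `|((\tr Pm)^-1 *: Pm) p.1 p.2|) => t.
have -> : (dirmx Pm (tnth t) - (\tr Pm)^-1 *: Pm) p.1 p.2 =
    dirmx Pm (tnth t) p.1 p.2 - ((\tr Pm)^-1 *: Pm) p.1 p.2 by rewrite !mxE.
apply: le_trans (ler_normB _ _) _; rewrite lerD2r.
suff : `|dirmx Pm (tnth t) p.1 p.2| ^+ 2 <= 1 by rewrite expr_le1.
rewrite real_normK ?num_real//; apply: le_trans (_ : frob (dirmx Pm (tnth t)) <= _).
  rewrite frobE (bigD1 p.1)//= (bigD1 p.2)//= -addrA lerDl addr_ge0//.
    by apply: sumr_ge0 => ? _; exact: sqr_ge0.
  by do 2 (apply: sumr_ge0 => ? _); exact: sqr_ge0.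
by rewrite frob_dirmx// qratio_proj//; case: (_ != 0).
Qed.

End direction_measurable.

(** * Second and fourth moments of the centred direction *)

Section direction_moments.
Context {R : realType} (s : R) (s0 : 0 < s).
Context d (Om : measurableType d) (P : probability Om R) (n : nat)
  (X : {RV P >-> n.-tuple R}).
Hypothesis X_normal : has_mvnormal_distribution X 0 ((s ^+ 2)%:M).
Variable Pm : 'M[R]_n.
Hypotheses (Psym : Pm^T = Pm) (Pidem : Pm *m Pm = Pm) (rank_ge1 : 1 <= \tr Pm).
Implicit Types (v : 'I_n -> R) (Z : 'M[R]_n).

Let m := \tr Pm.
Let m_gt0 : 0 < m. Proof. exact: lt_le_trans ltr01 rank_ge1. Qed.
Let m_neq0 : m != 0. Proof. by rewrite gt_eqF. Qed.
Let Xv w : 'I_n -> R := tnth (X w).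
Let cP : carried Pm Pm. Proof. by []. Qed.

Definition symm_part Z : 'M[R]_n := 2^-1 *: (Z + Z^T).

Definition shadow Z : 'M[R]_n := Pm *m symm_part Z *m Pm.

(* The part of [Z] seen by [cdir], namely the projection of [Z] on the
   symmetric trace-free matrices of the form [Pm A Pm]. *)
Definition traceless Z : 'M[R]_n := shadow Z - (\tr (Pm *m Z) / m) *: Pm.

Let qf_shadow v Z : qf (Pm *m Z *m Pm) v = qf (shadow Z) v.
Proof.
rewrite /shadow /symm_part -scalemxAr -scalemxAl qfZ mulmxDr mulmxDl qfD.
rewrite -[X in _ = _ * (_ + X)]qf_tr !trmx_mul trmxK Psym mulmxA; lra.
Qed.

Let shadow_sym Z : (shadow Z)^T = shadow Z.
Proof. by rewrite /shadow !trmx_mul Psym mulmxA linearZ/= linearD/= trmxK addrC. Qed.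

Let shadow_carried Z : carried Pm (shadow Z).
Proof. by split; rewrite /shadow ?mulmxA ?Pidem// -!mulmxA Pidem. Qed.

Let tr_shadow Z : \tr (shadow Z) = \tr (Pm *m Z).
Proof.
rewrite /shadow mxtrace_mulC mulmxA Pidem /symm_part -scalemxAr linearZ/=.
rewrite mulmxDr linearD/= -[X in _ * (_ + X)]mxtrace_tr trmx_mul trmxK Psym.
rewrite (mxtrace_mulC Z); lra.
Qed.

Lemma traceless_sym Z : (traceless Z)^T = traceless Z.
Proof. by rewrite /traceless linearB/= linearZ/= shadow_sym Psym. Qed.

Lemma traceless_carried Z : carried Pm (traceless Z).
Proof.
have [PS SP] := shadow_carried Z.
by split; rewrite /traceless ?mulmxBr ?mulmxBl -?scalemxAr -?scalemxAl ?PS ?SP Pidem.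
Qed.

Lemma tr_traceless Z : \tr (traceless Z) = 0.
Proof. by rewrite /traceless linearB/= linearZ/= tr_shadow divfK// subrr. Qed.

Lemma tracelessB1 Z c : traceless (Z - c%:M) = traceless Z.
Proof.
have sE : symm_part (Z - c%:M) = symm_part Z - c%:M.
  by apply/matrixP => k l; rewrite !mxE eq_sym; lra.
rewrite /traceless /shadow sE.
have -> : \tr (Pm *m (Z - c%:M)) = \tr (Pm *m Z) - c * m.
  by rewrite mulmxBr raddfB/= mul_mx_scalar mxtraceZ.
rewrite mulmxBr mulmxBl mul_mx_scalar -scalemxAl Pidem.
by rewrite mulrBl mulfK// scalerBl opprB addrA subrK.
Qed.

Lemma frob_traceless Z :
  frob (traceless Z) = frob (shadow Z) - \tr (Pm *m Z) ^+ 2 / m.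
Proof.
rewrite /traceless frobBZ shadow_sym (shadow_carried Z).2 tr_shadow.
by rewrite (frob_projE Psym Pidem) -/m; field.
Qed.

Lemma frob_traceless_le Z : frob (traceless Z) <= frob Z.
Proof.
rewrite frob_traceless lerBlDr; apply: ler_wpDr.
  by rewrite divr_ge0// ?sqr_ge0// ltW.
apply: le_trans (frob_proj2 _ Psym Pidem) _; rewrite !frobE.
have -> : \sum_k \sum_l Z k l ^+ 2 = \sum_k \sum_l (Z k l ^+ 2 + Z l k ^+ 2) / 2.
  under [RHS]eq_bigr do rewrite -mulr_suml big_split/=.
  rewrite -mulr_suml big_split/= [X in (_ + X) / _]exchange_big/=; lra.
apply: ler_sum => k _; apply: ler_sum => l _; rewrite !mxE.
by have := sqr_ge0 (Z k l - Z l k); lra.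
Qed.

(** Indicator of the event that the projected vector vanishes, where division by zero makes [cdir]
    equal to - Pm / m. The first-moment formula gives it mean 0, so it drops out of every moment. *)
Let U v : R := 1 - qratio Pm Pm v.

Let ip_cdir_traceless v Z : ip (cdir Pm v) (mxfun Z) =
  qratio Pm (traceless Z) v - \tr (Pm *m Z) / m * U v.
Proof.
rewrite ip_cdir// -/m /U /qratio qf_shadow /traceless -[X in _ = qf (_ + X) _ / _ - _]scaleNr qfD qfZ; ring.
Qed.

Let qU A v : qratio Pm A v * U v = 0.
Proof.
rewrite /U qratio_proj /qratio; have [->|_] := eqVneq (qf Pm v) 0.
  by rewrite invr0 mulr0 mul0r.
by rewrite subrr mulr0.
Qed.

Let UU v : U v * U v = U v.
Proof. by rewrite /U qratio_proj; case: (_ != 0) => /=; ring. Qed.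

Let bmq A : carried Pm A -> bm (fun w => qratio Pm A (Xv w)).
Proof. exact: bm_qratio. Qed.

Let bmU : bm (fun w => U (Xv w)).
Proof. by apply: bmB; [exact: bm_cst|exact: bmq]. Qed.

Let mean_qratio A : A^T = A -> carried Pm A ->
  mean P (fun w => qratio Pm A (Xv w)) = \tr A / m.
Proof.
move=> sA cA; have := mean_qratio_rec s0 X_normal Psym Pidem 0 sA cA sA cA.
under eq_mean do rewrite expr0 mulr1.
under [X in _ = _ * X + _]eq_mean do rewrite expr0.
rewrite mean_cst !(mulr0, mul0r, addr0, mulr1) => e.
by rewrite -e mulrC mulKf.
Qed.

Let mean_U : mean P (fun w => U (Xv w)) = 0.
Proof.
rewrite meanB; [|exact: bm_cst|exact: bmq].
by rewrite mean_cst mean_qratio// divff// subrr.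
Qed.

(** The two terms have disjoint supports, so the power splits, and the part carried by [U] has mean
    0. *)
Let mean_powU A c j : A^T = A -> carried Pm A ->
  mean P (fun w => (qratio Pm A (Xv w) - c * U (Xv w)) ^+ j.+1) =
  mean P (fun w => qratio Pm A (Xv w) ^+ j.+1).
Proof.
move=> sA cA.
have e v : (qratio Pm A v - c * U v) ^+ j.+1 =
    qratio Pm A v ^+ j.+1 + (- c) ^+ j.+1 * U v.
  elim: j => [|j IH]; first by rewrite !expr1; ring.
  rewrite exprS IH [in RHS]exprS [(- c) ^+ _.+2]exprS.
  transitivity (qratio Pm A v * qratio Pm A v ^+ j.+1 + (- c) * (- c) ^+ j.+1 * (U v * U v)
     + qratio Pm A v * U v * ((- c) ^+ j.+1 - c * qratio Pm A v ^+ j)).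
    by rewrite exprS; ring.
  by rewrite qU UU mul0r addr0.
under eq_mean do rewrite e.
rewrite meanD; [|by apply: bmX; exact: bmq|by apply: bmM => //; exact: bm_cst].
by rewrite meanZ// mean_U mulr0 addr0.
Qed.

Let mean_qratio2 A : A^T = A -> carried Pm A ->
  mean P (fun w => qratio Pm A (Xv w) ^+ 2) = (\tr A ^+ 2 + 2 * frob A) / (m * (m + 2)).
Proof.
move=> sA cA; have [PA AP] := cA.
have cAA : carried Pm (A *m A) by split; rewrite ?mulmxA ?PA// -mulmxA AP.
have sAA : (A *m A)^T = A *m A by rewrite trmx_mul sA.
have := mean_qratio_rec s0 X_normal Psym Pidem 1 sA cA sA cA.
under [X in _ = _ * X + _]eq_mean do rewrite expr1.
under [X in _ = _ + _ * X]eq_mean do rewrite expr0 mulr1.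
rewrite !mean_qratio// -/m mulr1.
under eq_mean do rewrite expr1 -expr2.
rewrite /frob sA; set t2 := \tr (A *m A); set y := mean _ _ => e.
have m2 : m + 2 != 0 by rewrite gt_eqF// addr_gt0.
apply: (mulfI m2); rewrite e; field.
by rewrite m2 m_neq0.
Qed.

(** For zero trace the recursion with l = 3 reads (m + 6) Y = 6 V. AM-GM with weight c = (m + 6) / 6
    bounds V by the second moment [V2] of the ratio of A^2 plus a multiple of Y that is absorbed, so
    Y <= 36 V2 / (m + 6)^2. The second-moment formula bounds V2 by 3 |A|^4 / (m (m + 2)), and 36
    times 3 is 108. *)
Let mean_qratio4 A : A^T = A -> carried Pm A -> \tr A = 0 ->
  mean P (fun w => qratio Pm A (Xv w) ^+ 4) <= 108 / m ^+ 4 * frob A ^+ 2.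
Proof.
move=> sA cA trA; have [PA AP] := cA.
have cAA : carried Pm (A *m A) by split; rewrite ?mulmxA ?PA// -mulmxA AP.
have sAA : (A *m A)^T = A *m A by rewrite trmx_mul sA.
have := mean_qratio_rec s0 X_normal Psym Pidem 3 sA cA sA cA.
under eq_mean do rewrite -exprS.
rewrite trA mul0r add0r /= -/m.
set Y := mean P _; set V := mean P _ => e.
have bA := bmq cA; have bAA := bmq cAA.
pose c := (m + 6) / 6; have c0 : 0 < c by rewrite divr_gt0// addr_gt0.
pose V2 := mean P (fun w => qratio Pm (A *m A) (Xv w) ^+ 2).
have VY : 2 * V <= c^-1 * V2 + c * Y.
  have bA2 := bmX 2 bA; have bA4 := bmX 4 bA; have bAA2 := bmX 2 bAA.
  have bV := bmM bAA bA2; have bc x := bm_cst Om x.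
  rewrite /V /V2 /Y -!meanZ// -meanD; [|exact: bmM..].
  apply: ler_mean; [exact: bmM|by apply: bmD; exact: bmM|].
  move=> w; set a := qratio _ _ _; set b := qratio _ _ _.
  rewrite -subr_ge0 (_ : _ - _ = c^-1 * (a - c * b ^+ 2) ^+ 2).
    by rewrite mulr_ge0 ?sqr_ge0// invr_ge0 ltW.
  by field; rewrite gt_eqF.
have V2le : V2 <= 3 * frob A ^+ 2 / (m * (m + 2)).
  rewrite /V2 mean_qratio2// ler_pM2r ?invr_gt0 ?mulr_gt0 ?addr_gt0//.
  have := frob_mul A A.
  have -> : \tr (A *m A) = frob A by rewrite /frob sA.
  rewrite -expr2; lra.
have F0 := sqr_ge0 (frob A).
have Y1 : (m + 6) / 2 * Y <= 18 / (m + 6) * V2.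
  have -> : 18 / (m + 6) * V2 = 3 * (c^-1 * V2).
    by rewrite /c; field; rewrite gt_eqF// addr_gt0.
  by rewrite /c in VY *; lra.
have m6 : 0 < m + 6 by rewrite addr_gt0.
have Y2 : Y <= 36 / (m + 6) ^+ 2 * (3 * frob A ^+ 2 / (m * (m + 2))).
  have -> : Y = ((m + 6) / 2)^-1 * ((m + 6) / 2 * Y).
    by field; rewrite gt_eqF.
  apply: le_trans (_ : ((m + 6) / 2)^-1 * (18 / (m + 6) * V2) <= _).
    by rewrite ler_pM2l// invr_gt0 divr_gt0.
  rewrite mulrA (_ : _ * (18 / _) = 36 / (m + 6) ^+ 2); last by field; rewrite gt_eqF.
  by rewrite ler_wpM2l// divr_ge0// sqr_ge0.
apply: le_trans Y2 _.
rewrite (_ : 36 / _ * _ = 108 / ((m + 6) ^+ 2 * (m * (m + 2))) * frob A ^+ 2); last first.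
  by field; rewrite m_neq0 !gt_eqF// addr_gt0.
rewrite ler_wpM2r// ler_pM2l// lef_pV2 ?posrE ?exprn_gt0 ?mulr_gt0 ?addr_gt0//.
rewrite (_ : m ^+ 4 = m ^+ 2 * (m * m)); last by ring.
have mm := ltW m_gt0.
apply: ler_pM; rewrite ?exprn_ge0 ?mulr_ge0 ?lerXn2r ?nnegrE ?addr_ge0 ?lerDl//.
by rewrite ler_wpM2l// lerDl.
Qed.

Lemma mean_ip_cdir Z : mean P (fun w => ip (cdir Pm (Xv w)) (mxfun Z)) = 0.
Proof.
have sA := traceless_sym Z; have cA := traceless_carried Z.
under eq_mean do rewrite ip_cdir_traceless -[_ - _]expr1.
rewrite mean_powU//; under eq_mean do rewrite expr1.
by rewrite mean_qratio// tr_traceless mul0r.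
Qed.

Lemma mean_ip_cdir2 Z : mean P (fun w => ip (cdir Pm (Xv w)) (mxfun Z) ^+ 2) =
  2 / (m * (m + 2)) * frob (traceless Z).
Proof.
have sA := traceless_sym Z; have cA := traceless_carried Z.
under eq_mean do rewrite ip_cdir_traceless.
rewrite mean_powU// mean_qratio2// tr_traceless expr0n add0r; lra.
Qed.

(* Almost surely [cdir] is orthogonal to the identity matrix, so [Z] may be
   shifted by a scalar matrix. *)
Lemma mean_ip_cdir2_le Z c : mean P (fun w => ip (cdir Pm (Xv w)) (mxfun Z) ^+ 2) <=
  2 / m ^+ 2 * frob (Z - c%:M).
Proof.
rewrite mean_ip_cdir2 -(tracelessB1 Z c).
apply: ler_pM => //; [|exact: frob_ge0| |exact: frob_traceless_le].
  by rewrite divr_ge0// mulr_ge0 ?addr_ge0// ltW.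
rewrite ler_pM2l// lef_pV2 ?posrE ?mulr_gt0 ?exprn_gt0 ?addr_gt0//.
by rewrite expr2 ler_pM2l// lerDl.
Qed.

Lemma mean_ip_cdir4_le Z : mean P (fun w => ip (cdir Pm (Xv w)) (mxfun Z) ^+ 4) <=
  108 / m ^+ 4 * frob Z ^+ 2.
Proof.
have sA := traceless_sym Z; have cA := traceless_carried Z.
under eq_mean do rewrite ip_cdir_traceless.
rewrite mean_powU//; apply: le_trans (mean_qratio4 sA cA (tr_traceless Z)) _.
rewrite ler_wpM2l ?divr_ge0 ?exprn_ge0 ?(ltW m_gt0)//.
by rewrite lerXn2r ?nnegrE ?frob_ge0// frob_traceless_le.
Qed.

End direction_moments.

(** * Residual projections and the normalization *)

Section residual_projection.
Context {R : realType} (T p : nat) (x : 'M[R]_(T, p)).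
Hypothesis x_unit : x^T *m x \in unitmx.

Let Pm := residual_maker x.

Lemma residual_maker_sym : (residual_maker x)^T = residual_maker x.
Proof.
by rewrite /residual_maker linearB/= trmx1 !trmx_mul trmx_inv trmx_mul !trmxK mulmxA.
Qed.

Let hat_idem (H := x *m invmx (x^T *m x) *m x^T) : H *m H = H.
Proof. by rewrite /H !mulmxA -(mulmxA _ x^T x) mulmxKV. Qed.

Lemma residual_maker_idem : residual_maker x *m residual_maker x = residual_maker x.
Proof.
rewrite /residual_maker mulmxBl !mulmxBr !mul1mx mulmx1 hat_idem subrr subr0 //.
Qed.

Let tr_hat : \tr (x *m invmx (x^T *m x) *m x^T) = p%:R.
Proof. by rewrite mxtrace_mulC mulmxA mulmxV// mxtrace1. Qed.

Lemma tr_residual_maker : \tr (residual_maker x) = T%:R - p%:R.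
Proof. by rewrite /residual_maker raddfB/= mxtrace1 tr_hat. Qed.

(** The hat matrix is a projection of rank [p]. That this norm does not grow with T is what makes
    the linear terms small. *)
Lemma frob_residual_makerB1 : frob (residual_maker x - 1%:M) = p%:R.
Proof.
rewrite /frob /residual_maker addrAC subrr add0r.
have -> : (- (x *m invmx (x^T *m x) *m x^T))^T = - (x *m invmx (x^T *m x) *m x^T).
  by rewrite linearN/= !trmx_mul trmx_inv trmx_mul !trmxK mulmxA.
by rewrite mulNmx mulmxN opprK hat_idem tr_hat.
Qed.

End residual_projection.

(** * Traces of products of two projections *)

Section pair_of_projections.
Context {R : realType} (T : nat) (A B : 'M[R]_T) (m r : R).
Hypotheses (sA : A^T = A) (iA : A *m A = A) (sB : B^T = B) (iB : B *m B = B).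
Hypotheses (trA : \tr A = m) (trB : \tr B = m) (corank : frob (B - 1%:M) = r).

Lemma frob_mul_proj : frob (A *m B) = \tr (A *m B).
Proof. by rewrite /frob trmx_mul sA sB mulmxA -(mulmxA B) iA mxtrace_mulC mulmxA iB mxtrace_mulC. Qed.

Lemma tr_mul_proj_ge0 : 0 <= \tr (A *m B).
Proof. by rewrite -frob_mul_proj frob_ge0. Qed.

Lemma tr_mul_proj_le : \tr (A *m B) <= m.
Proof.
rewrite -frob_mul_proj; apply: le_trans (frob_proj _ sA iA) _.
by rewrite /frob sB iB trB.
Qed.

(** The defect tr(A (1 - B)) is the squared norm of A (1 - B), at most that of 1 - B, which is
    [r]. *)
Lemma tr_mul_proj_ge : m - r <= \tr (A *m B).
Proof.
have -> : \tr (A *m B) = m + \tr (A *m (B - 1%:M)).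
  by rewrite mulmxBr mulmx1 raddfB/= trA addrC subrK.
rewrite lerD2l -corank.
have -> : \tr (A *m (B - 1%:M)) = - frob (A *m (B - 1%:M)).
  set Z := B - 1%:M.
  have sZ : Z^T = Z by rewrite /Z [LHS]linearB/= sB trmx1.
  have ZZ : Z *m Z = - Z.
    by rewrite /Z mulmxBl mul1mx mulmxBr mulmx1 iB subrr sub0r.
  rewrite /frob trmx_mul sA sZ mulmxA -(mulmxA Z A A) iA [X in _ = - X]mxtrace_mulC mulmxA ZZ.
  by rewrite mulNmx linearN/= opprK mxtrace_mulC.
by rewrite lerN2 frob_proj.
Qed.

Lemma tr_mul_proj2 : \tr (A *m B *m (A *m B)) = frob (A *m B *m A).
Proof.
by rewrite /frob !trmx_mul sA sB !mulmxA -(mulmxA (A *m B) A A) iA [RHS]mxtrace_mulC !mulmxA iA.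
Qed.

Lemma tr_mul_proj2_ge0 : 0 <= \tr (A *m B *m (A *m B)).
Proof. by rewrite tr_mul_proj2 frob_ge0. Qed.

Lemma tr_mul_proj2_le : \tr (A *m B *m (A *m B)) <= m.
Proof.
rewrite tr_mul_proj2; apply: le_trans (frob_proj2 _ sA iA) _.
by rewrite /frob sB iB trB.
Qed.

End pair_of_projections.

(** * Size of the normalizing variance *)

Section normalization.
Context {R : realType}.

(** The numerator (m - 8)(m + 2) + 24 factors as (m - 2)(m - 4), which cancels the poles at 2 and
    4. *)
Lemma a2E (m : R) : 4 < m -> a2 m = 3 / (m + 2) ^+ 2.
Proof.
move=> m4; rewrite /a2; field.
by apply/and3P; split; rewrite gt_eqF//; lra.
Qed.

(** With t = m the first term is 3 (m / (m + 2))^2 - 1, which lies between 2 - 12/m and 2. Passing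
    to t >= m - r costs a relative 2 r/m, hence 4 r/m; the second term lies between 0 and 6/m. The
    threshold on [m] keeps the coefficient of t^2 nonnegative. *)
Lemma v_rho_sqr_bounds (m r t u : R) : 0 <= r -> 12 + 4 * r <= m ->
  m - r <= t <= m -> 0 <= u <= m ->
  `|a1 m * t ^+ 2 + 2 * a2 m * u - 2| <= (12 + 4 * r) / m.
Proof.
move=> r0 mr /andP[t1 t2] /andP[u1 u2].
have m0 : 0 < m by lra.
have m12 : 12 <= m by lra.
rewrite /a1 a2E; last by lra.
pose y := (m + 2)^-1; pose z := m^-1.
have z0 : 0 < z by rewrite invr_gt0.
have y0 : 0 < y by rewrite invr_gt0; lra.
have mz : m * z = 1 by rewrite mulfV// gt_eqF.
have my : (m + 2) * y = 1 by rewrite mulfV// gt_eqF//; lra.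
have yz : y <= z by rewrite lef_pV2 ?posrE//; lra.
have -> : (3 / (m + 2) ^+ 2 - 1 / m ^+ 2) * t ^+ 2 + 2 * (3 / (m + 2) ^+ 2) * u =
    (3 * y ^+ 2 - z ^+ 2) * t ^+ 2 + 6 * y ^+ 2 * u.
  by rewrite -!exprVn -/y -/z; ring.
rewrite -/z.
have a1m : (3 * y ^+ 2 - z ^+ 2) * m ^+ 2 = 3 * (m * y) ^+ 2 - 1.
  by rewrite mulrBl -exprMn (mulrC z) mz expr1n; ring.
have myE : m * y = 1 - 2 * y by lra.
have a1lo : 2 - 12 * z <= (3 * y ^+ 2 - z ^+ 2) * m ^+ 2.
  rewrite a1m myE; have := sqr_ge0 y; lra.
have a1hi : (3 * y ^+ 2 - z ^+ 2) * m ^+ 2 <= 2.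
  have y1 : y <= 1 by apply: le_trans yz _; rewrite invf_le1//; lra.
  have := ler_wpM2l (ltW y0) y1; rewrite a1m myE -expr2; lra.
have a1_ge0 : 0 <= 3 * y ^+ 2 - z ^+ 2.
  have z12 : 12 * z <= 1 by have := ler_wpM2r (ltW z0) m12; rewrite mz.
  by rewrite -(@pmulr_lge0 _ (m ^+ 2)) ?exprn_gt0//; apply: le_trans a1lo; lra.
have t0 : 0 <= t by lra.
have hi : (3 * y ^+ 2 - z ^+ 2) * t ^+ 2 <= 2.
  apply: le_trans a1hi; rewrite ler_wpM2l// lerXn2r ?nnegrE//; lra.
have lo : 2 - (12 + 4 * r) * z <= (3 * y ^+ 2 - z ^+ 2) * t ^+ 2.
  have tt : m ^+ 2 * (1 - 2 * r * z) <= t ^+ 2.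
    apply: le_trans (_ : (m - r) ^+ 2 <= _); last first.
      by rewrite lerXn2r ?nnegrE//; lra.
    rewrite (_ : m ^+ 2 * (1 - 2 * r * z) = m ^+ 2 - 2 * r * m * (m * z)); last by ring.
    by rewrite mz; have := sqr_ge0 r; lra.
  apply: le_trans (ler_wpM2l a1_ge0 tt).
  rewrite mulrA.
  have rz : 0 <= r * z by rewrite mulr_ge0// ltW.
  have rz2 : 0 <= 1 - 2 * r * z.
    have -> : 1 - 2 * r * z = (m - 2 * r) * z by rewrite mulrBl mz.
    by apply: mulr_ge0; lra.
  apply: le_trans (ler_wpM2r rz2 a1lo).
  have : 0 <= z * (r * z) by rewrite mulr_ge0// ltW.
  lra.
have ulo : 0 <= 6 * y ^+ 2 * u by rewrite !mulr_ge0// ltW.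
have uhi : 6 * y ^+ 2 * u <= 6 * z.
  rewrite -mulrA ler_pM2l//; apply: le_trans (_ : y ^+ 2 * m <= _).
    by rewrite ler_wpM2l// sqr_ge0.
  rewrite (_ : y ^+ 2 * m = (m * y) * y); last by ring.
  rewrite myE; have := sqr_ge0 y; lra.
have rz : 0 <= r * z by rewrite mulr_ge0// ltW.
by rewrite ler_norml; apply/andP; split; lra.
Qed.

(** Rationalizing leaves the factor 1 / (a b (a + b)), at most 1 because both roots are at least
    1. *)
Lemma inv_sqrt_dist (w e : R) : 1 <= w -> `|w - 2| <= e ->
  `|(Num.sqrt w)^-1 - (Num.sqrt 2)^-1| <= e.
Proof.
move=> w1 we; set a := Num.sqrt w; set b := Num.sqrt 2.
have a1 : 1 <= a by rewrite -(sqrtr1 R) ler_sqrt//; lra.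
have b1 : 1 <= b by rewrite -(sqrtr1 R) ler_sqrt//; lra.
have aw : a ^+ 2 = w by rewrite sqr_sqrtr//; lra.
have b2 : b ^+ 2 = 2 by rewrite sqr_sqrtr//; lra.
have a0 : 0 < a by lra.
have b0 : 0 < b by lra.
have -> : a^-1 - b^-1 = - (w - 2) * (a * b * (a + b))^-1.
  by rewrite -aw -[in RHS]b2; field; rewrite !gt_eqF//; lra.
rewrite normrM normrN -[leRHS]mulr1; apply: ler_pM => //.
rewrite ger0_norm; last by rewrite invr_ge0 !mulr_ge0 ?addr_ge0 ?ltW.
rewrite invf_le1; last by rewrite !mulr_gt0 ?addr_gt0.
have ab : 1 <= a * b by rewrite mulr_ege1.
by rewrite mulr_ege1//; lra.
Qed.

End normalization.

(** * How much of one centred direction another projection sees *)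

Section traceless_lower_bound.
Context {R : realType} (T : nat) (A B D : 'M[R]_T) (m : R).
Hypotheses (sA : A^T = A) (iA : A *m A = A) (sB : B^T = B) (iB : B *m B = B).
Hypotheses (sD : D^T = D) (iD : D *m D = D) (D_le1 : frob D <= 1).
Hypotheses (trA : \tr A = m) (trB : \tr B = m) (m_ge1 : 1 <= m).

Lemma cauchy_schwarz_frob (U V : 'M[R]_T) : \tr (U^T *m V) ^+ 2 <= frob U * frob V.
Proof. by rewrite -!frob_mxfun -ip_mxfun cauchy_schwarz_ip. Qed.

(** [D] stands for the direction matrix of the other vector. Cauchy-Schwarz against [D] bounds the
    squared norm of A D A below by r^2; the cross term with B / m costs at most 2/m, and removing
    the trace at most 1/m. *)
Lemma frob_traceless_ge :
  \tr (D *m A) ^+ 2 - 3 / m <= frob (traceless A (D - m^-1 *: B)).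
Proof.
have m0 : 0 < m by exact: lt_le_trans ltr01 m_ge1.
have m_n0 : m != 0 by rewrite gt_eqF.
have frobAD : frob (A *m D) = \tr (D *m A).
  rewrite /frob trmx_mul sA sD mulmxA -(mulmxA D A A) iA mxtrace_mulC mulmxA iD.
  by rewrite mxtrace_mulC.
set r := \tr (D *m A).
have r0 : 0 <= r by rewrite /r -frobAD frob_ge0.
have r1 : r <= 1 by rewrite /r -frobAD (le_trans (frob_proj _ sA iA)).
set Z := D - m^-1 *: B.
have sZ : symm_part Z = Z.
  have ZT : Z^T = Z by rewrite /Z [LHS]linearB/= linearZ/= sD sB.
  by rewrite /symm_part ZT; apply/matrixP => k l; rewrite [LHS]mxE [(Z + Z) _ _]mxE; lra.
rewrite frob_traceless; [|exact: sA|exact: iA|by rewrite trA]; rewrite trA.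
set t := \tr (A *m B).
have t0 : 0 <= t by exact: tr_mul_proj_ge0.
have tm : t <= m by exact: tr_mul_proj_le.
have trAZ : \tr (A *m Z) = r - t / m.
  by rewrite /Z mulmxBr raddfB/= -scalemxAr mxtraceZ mxtrace_mulC mulrC.
have AZ_le1 : \tr (A *m Z) ^+ 2 <= 1.
  have tm1 : t / m <= 1 by rewrite ler_pdivrMr// mul1r.
  have tm0 : 0 <= t / m by rewrite divr_ge0// ltW.
  have n1 : `|r - t / m| <= 1 by rewrite ler_norml; apply/andP; split; lra.
  by rewrite trAZ -(real_normK (num_real _)) expr_le1.
have lo : r ^+ 2 - 2 / m <= frob (shadow A Z).
  have -> : shadow A Z = A *m D *m A - m^-1 *: (A *m B *m A).
    by rewrite /shadow sZ /Z mulmxBr mulmxBl -scalemxAr -scalemxAl.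
  rewrite frobBZ.
  have f1 : r ^+ 2 <= frob (A *m D *m A).
    have e1 : frob (A *m D *m A) = frob (D *m A *m D).
      by rewrite -!tr_mul_proj2// !mulmxA mxtrace_mulC !mulmxA.
    have e2 : r = \tr (D^T *m (D *m A *m D)).
      by rewrite sD !mulmxA iD mxtrace_mulC mulmxA iD.
    rewrite e1 e2; apply: le_trans (cauchy_schwarz_frob _ _) _.
    by rewrite ler_piMl// frob_ge0.
  have f2 : \tr ((A *m D *m A)^T *m (A *m B *m A)) <= 1.
    have -> : \tr ((A *m D *m A)^T *m (A *m B *m A)) = frob (B *m (A *m D)).
      rewrite /frob !trmx_mul sA sB sD !mulmxA -(mulmxA _ A A) iA.
      rewrite -(mulmxA _ B B) iB mxtrace_mulC !mulmxA iA.
      by rewrite [RHS]mxtrace_mulC !mulmxA iD [RHS]mxtrace_mulC !mulmxA.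
    apply: le_trans (frob_proj _ sB iB) _.
    by apply: le_trans (frob_proj _ sA iA) _.
  have f3 : 0 <= m^-1 ^+ 2 * frob (A *m B *m A).
    by rewrite mulr_ge0 ?sqr_ge0 ?frob_ge0.
  have mi : 0 < m^-1 by rewrite invr_gt0.
  have := ler_wpM2l (ltW mi) f2; lra.
have := ler_wpM2r (ltW (_ : 0 < m^-1)) AZ_le1; rewrite invr_gt0 => /(_ m0); lra.
Qed.

End traceless_lower_bound.

Section dirmx_projection.
Context {R : realType} (n : nat) (Pm : 'M[R]_n) (v : 'I_n -> R).
Hypotheses (Psym : Pm^T = Pm) (Pidem : Pm *m Pm = Pm).

Lemma dirmx_sym : (dirmx Pm v)^T = dirmx Pm v.
Proof. by apply/matrixP => k l; rewrite !mxE [lin _ _ l * _]mulrC. Qed.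

Lemma dirmx_idem : dirmx Pm v *m dirmx Pm v = dirmx Pm v.
Proof.
apply/matrixP => k l; rewrite !mxE.
have [q0|q0] := eqVneq (qf Pm v) 0.
  by rewrite q0 invr0 mulr0 big1// => j _; rewrite !mxE q0 invr0 !mulr0.
transitivity (\sum_j (lin Pm v k * lin Pm v l / qf Pm v ^+ 2) * lin Pm v j ^+ 2).
  by apply: eq_bigr => j _; rewrite !mxE; field.
by rewrite -mulr_sumr -(qf_proj_sum Psym Pidem); field.
Qed.

Lemma frob_dirmx_le1 : frob (dirmx Pm v) <= 1.
Proof. by rewrite frob_dirmx// qratio_proj; case: (_ != 0). Qed.

End dirmx_projection.

(** * The statistic *)

Lemma sum_lt_offdiag (R : realType) (N : nat) (F : 'I_N -> 'I_N -> R) :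
  (forall i j, F i j = F j i) ->
  \sum_(i < N) \sum_(j < N | (i < j)%N) F i j =
  2^-1 * \sum_(q : 'I_N * 'I_N | q.1 != q.2) F q.1 q.2.
Proof.
move=> sF; rewrite -(pair_big_dep xpredT (fun i j => i != j) F)/=.
have e : \sum_(i < N) \sum_(j < N | i != j) F i j =
    \sum_(i < N) \sum_(j < N | (i < j)%N) F i j + \sum_(i < N) \sum_(j < N | (j < i)%N) F i j.
  rewrite -big_split; apply: eq_bigr => i _ /=.
  rewrite (bigID (fun j : 'I_N => (i < j)%N))/=; congr (_ + _); apply: eq_bigl => j.
    by rewrite -val_eqE /= neq_ltn; case: ltngtP.
  by rewrite -val_eqE /= neq_ltn; case: ltngtP.
rewrite e.
have <- : \sum_(i < N) \sum_(j < N | (i < j)%N) F i j =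
    \sum_(i < N) \sum_(j < N | (j < i)%N) F i j.
  rewrite (exchange_big_dep xpredT)//=; apply: eq_bigr => i _.
  by apply: eq_bigr => j _; exact: sF.
lra.
Qed.

Lemma sqr_sum_le (R : realType) (N : nat) (P : pred 'I_N) (a : 'I_N -> R) :
  (\sum_(j | P j) a j) ^+ 2 <= N%:R * \sum_(j | P j) a j ^+ 2.
Proof.
have := cauchy_schwarz_ip (fun=> 1) (fun j => if P j then a j else 0).
have -> : ip (fun=> 1) (fun j => if P j then a j else 0) = \sum_(j | P j) a j.
  by rewrite [RHS]big_mkcond; apply: eq_bigr => j _; rewrite mul1r.
have -> : ip (fun _ : 'I_N => 1) (fun=> 1) = N%:R :> R.
  rewrite /ip; under eq_bigr do rewrite mulr1.
  by rewrite sumr_const card_ord.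
rewrite (_ : ip _ _ = \sum_(j | P j) a j ^+ 2)// [RHS]big_mkcond.
by apply: eq_bigr => j _; case: ifP; rewrite ?mulr0// -expr2.
Qed.

Lemma frob_sum_le (R : realType) (N T : nat) (P : pred 'I_N) (A : 'I_N -> 'M[R]_T) :
  frob (\sum_(j | P j) A j) <= N%:R * \sum_(j | P j) frob (A j).
Proof.
have -> : \sum_(j | P j) frob (A j) = \sum_k \sum_l \sum_(j | P j) A j k l ^+ 2.
  under eq_bigr do rewrite frobE.
  rewrite exchange_big; apply: eq_bigr => k _ /=; exact: exchange_big.
rewrite frobE mulr_sumr; apply: ler_sum => k _; rewrite mulr_sumr.
by apply: ler_sum => l _; rewrite summxE sqr_sum_le.
Qed.

(** Squaring turns the correlation into an inner product of two rank-one matrices. If a residual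
    vector vanishes, the convention x / 0 = 0 makes both sides 0. *)
Lemma residual_corr_sqr (R : realType) (T : nat) (A B : 'M[R]_T) (t u : T.-tuple R) :
  A^T = A -> A *m A = A -> B^T = B -> B *m B = B ->
  residual_corr A B (col_of_tuple t) (col_of_tuple u) ^+ 2 =
  \tr ((dirmx A (tnth t))^T *m dirmx B (tnth u)).
Proof.
move=> sA iA sB iB.
have nE (M : 'M[R]_T) (s : T.-tuple R) : M^T = M -> M *m M = M ->
    eucl_norm (M *m col_of_tuple s) ^+ 2 = qf M (tnth s).
  move=> sM iM; rewrite /eucl_norm sqr_sqrtr; last by apply: sumr_ge0 => k _; exact: sqr_ge0.
  by rewrite qf_proj_sum.
rewrite /residual_corr exprMn exprVn exprMn !nE//.
have -> : ((col_of_tuple t)^T *m A *m B *m col_of_tuple u) 0 0 =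
    \sum_k lin A (tnth t) k * lin B (tnth u) k.
  rewrite -{1}sA -trmx_mul -mulmxA mxE; apply: eq_bigr => k _; congr (_ * _).
  by rewrite mxE.
rewrite -ip_mxfun /ip -(pair_bigA _ (fun k l => dirmx A (tnth t) k l * dirmx B (tnth u) k l))/=.
rewrite expr2 big_distrlr/= mulr_suml; apply: eq_bigr => k _.
rewrite mulr_suml; apply: eq_bigr => l _; rewrite !mxE invfM; ring.
Qed.

(** * Decomposition of the statistic *)

Section statistic.
Context {R : realType} (N T p : nat) (x : 'I_N -> 'M[R]_(T, p)).
Context d (Om : measurableType d) (Pr : probability Om R)
  (eps : 'I_N -> {RV Pr >-> T.-tuple R}).
Hypothesis p_lt : (p < T)%N.
Hypothesis x_unit : forall i, (x i)^T *m x i \in unitmx.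

Definition rank_resid : R := T%:R - p%:R.
Local Notation m := rank_resid.
Let Q i := residual_maker (x i).
Let sQ i : (Q i)^T = Q i. Proof. exact: residual_maker_sym. Qed.
Let iQ i : Q i *m Q i = Q i. Proof. exact: residual_maker_idem. Qed.
Let trQ i : \tr (Q i) = m. Proof. exact: tr_residual_maker. Qed.

Let m_ge1 : 1 <= m.
Proof. by rewrite /rank_resid -natrB ?(ltnW p_lt)// ler1n subn_gt0. Qed.
Let m_gt0 : 0 < m. Proof. exact: lt_le_trans ltr01 m_ge1. Qed.
Let m_neq0 : m != 0. Proof. by rewrite gt_eqF. Qed.

Definition dirvec i w : 'I_T * 'I_T -> R := cdir (residual_maker (x i)) (tnth (eps i w)).
Local Notation W := dirvec.
Let v i j := v_rho m (Q i) (Q j).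

Definition normalizer : R := Num.sqrt (2 / (N%:R * (N%:R - 1))).
Local Notation c0 := normalizer.

Let v_sym i j : v i j = v j i.
Proof.
rewrite /v /v_rho /v_rho_sqr (mxtrace_mulC (Q i)).
by rewrite -!mulmxA (mxtrace_mulC (Q i)) -!mulmxA.
Qed.

(** Each direction matrix is written as W + Q / m and the product is expanded; the constant term is
    [mu_rho]. *)
Lemma sqr_corr_decomposition i j w :
  m * residual_corr (Q i) (Q j) (col_of_tuple (eps i w)) (col_of_tuple (eps j w)) ^+ 2 -
    mu_rho m (Q i) (Q j) =
  m * ip (W i w) (W j w) + ip (W i w) (mxfun (Q j)) + ip (W j w) (mxfun (Q i)).
Proof.
rewrite residual_corr_sqr//; set A := dirmx _ _; set B := dirmx _ _.
have trC (M K : 'M[R]_T) : \tr (M^T *m K) = \tr (K^T *m M).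
  by rewrite -mxtrace_tr trmx_mul trmxK.
have trB (M K L : 'M[R]_T) c : \tr (M^T *m (K - c *: L)) = \tr (M^T *m K) - c * \tr (M^T *m L).
  by rewrite mulmxBr -scalemxAr raddfB/= mxtraceZ.
have e1 : ip (W i w) (W j w) = \tr (A^T *m B) - m^-1 * \tr (A^T *m Q j) -
    m^-1 * \tr (B^T *m Q i) + m^-1 ^+ 2 * \tr (Q i *m Q j).
  rewrite /dirvec /cdir -/(Q i) -/(Q j) !trQ ip_mxfun -/A -/B trB.
  by rewrite trC trB trC [in X in _ - m^-1 * X]trC trB [\tr ((Q j)^T *m A)]trC sQ (mxtrace_mulC (Q j)); ring.
have e2 : ip (W i w) (mxfun (Q j)) = \tr (A^T *m Q j) - m^-1 * \tr (Q i *m Q j).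
  by rewrite /dirvec /cdir -/(Q i) trQ ipC ip_mxfun -/A trB trC sQ (mxtrace_mulC (Q j)).
have e3 : ip (W j w) (mxfun (Q i)) = \tr (B^T *m Q i) - m^-1 * \tr (Q i *m Q j).
  by rewrite /dirvec /cdir -/(Q j) trQ ipC ip_mxfun -/B trB trC sQ.
by rewrite e1 e2 e3 /mu_rho; field.
Qed.

(** The doubly centred part of the statistic, with every [v] replaced by its limit sqrt 2. *)
Definition main_term w : R := qsum W (c0 * m / Num.sqrt 2) w.

Definition inner_remainder w : R := c0 * m / 2 *
  \sum_(q : 'I_N * 'I_N | q.1 != q.2) ((v q.1 q.2)^-1 - (Num.sqrt 2)^-1) * ip (W q.1 w) (W q.2 w).

(** The two linear terms of each pair i < j regroup into one sum over ordered pairs; fixing the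
    first index collects its coefficients in this matrix. *)
Definition linear_coef i : 'M[R]_T := \sum_(j | i != j) (v i j)^-1 *: Q j.

Definition linear_remainder w : R := c0 * \sum_i ip (W i w) (mxfun (linear_coef i)).

Lemma Q_stat_decomposition w :
  Q_stat x eps w = main_term w + inner_remainder w + linear_remainder w.
Proof.
rewrite /Q_stat -/m -/c0.
under eq_bigr do under eq_bigr do rewrite sqr_corr_decomposition.
rewrite (sum_lt_offdiag (F := fun i j => (m * ip (W i w) (W j w) + ip (W i w) (mxfun (Q j)) +
   ip (W j w) (mxfun (Q i))) / v i j)); last first.
  by move=> i j; rewrite (v_sym i) (ipC (W i w)) -!addrA (addrC (ip (W i w) _)).
have lin2 : \sum_(q : 'I_N * 'I_N | q.1 != q.2) (ip (W q.1 w) (mxfun (Q q.2)) / v q.1 q.2) =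
    \sum_i ip (W i w) (mxfun (linear_coef i)).
  rewrite -(pair_big_dep xpredT (fun i j => i != j) (fun i j => ip (W i w) (mxfun (Q j)) / v i j))/=.
  apply: eq_bigr => i _; rewrite /linear_coef /ip.
  under eq_bigr do rewrite mulr_suml.
  rewrite exchange_big; apply: eq_bigr => k _ /=.
  rewrite /mxfun summxE mulr_sumr; apply: eq_bigr => j _; rewrite [in RHS]mxE; ring.
have lin2' : \sum_(q : 'I_N * 'I_N | q.1 != q.2) (ip (W q.2 w) (mxfun (Q q.1)) / v q.1 q.2) =
    \sum_i ip (W i w) (mxfun (linear_coef i)).
  rewrite -lin2 (reindex_inj (h := fun q : 'I_N * 'I_N => (q.2, q.1))) /=; last first.
    by move=> [a b] [a' b'] /= [-> ->].
  by apply: eq_big => [q|q _] /=; [rewrite eq_sym|rewrite v_sym].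
rewrite /linear_remainder -lin2 /main_term /qsum /inner_remainder.
have -> : \sum_(q : 'I_N * 'I_N | q.1 != q.2) ((m * ip (W q.1 w) (W q.2 w) +
    ip (W q.1 w) (mxfun (Q q.2)) + ip (W q.2 w) (mxfun (Q q.1))) / v q.1 q.2) =
  m * \sum_(q : 'I_N * 'I_N | q.1 != q.2) ip (W q.1 w) (W q.2 w) / v q.1 q.2 +
  \sum_(q : 'I_N * 'I_N | q.1 != q.2) (ip (W q.1 w) (mxfun (Q q.2)) / v q.1 q.2) +
  \sum_(q : 'I_N * 'I_N | q.1 != q.2) (ip (W q.2 w) (mxfun (Q q.1)) / v q.1 q.2).
  rewrite mulr_sumr -!big_split/=; apply: eq_bigr => q _; ring.
rewrite lin2' lin2.
have -> : \sum_(q : 'I_N * 'I_N | q.1 != q.2)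
    ((v q.1 q.2)^-1 - (Num.sqrt 2)^-1) * ip (W q.1 w) (W q.2 w) =
  \sum_(q : 'I_N * 'I_N | q.1 != q.2) ip (W q.1 w) (W q.2 w) / v q.1 q.2 -
  (Num.sqrt 2)^-1 * \sum_(q : 'I_N * 'I_N | q.1 != q.2) ip (W q.1 w) (W q.2 w).
  by rewrite mulr_sumr -sumrB; apply: eq_bigr => q _; ring.
move: (\sum_(q | _) _) => a; move: (\sum_(q | _) _) => b; move: (\sum_(q | _) _) => c.
by field; rewrite sqrtr_eq0 -ltNge.
Qed.

Lemma fnof_dirvec i k : fnof (eps i) (fun w => W i w k).
Proof.
exists (fun t : T.-tuple R => cdir (Q i) (tnth t) k) => //.
exact: bm_cdir.
Qed.

Let bmW i k : bm (fun w => W i w k).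
Proof. by apply: (fnof_bm _ (fnof_dirvec i k)); exact: measurable_funPT. Qed.

Lemma bm_main_term : bm main_term.
Proof.
apply: (bm_qsum (Y := fun i => eps i)); first by move=> i; exact: measurable_funPT.
exact: fnof_dirvec.
Qed.

Lemma bm_inner_remainder : bm inner_remainder.
Proof.
apply: bmM; [exact: bm_cst|apply: bm_sum => q _]; apply: bmM; first exact: bm_cst.
exact: bm_ip.
Qed.

Lemma bm_linear_remainder : bm linear_remainder.
Proof.
apply: bmM; [exact: bm_cst|apply: bm_sum => i _]; apply: bm_ip => // k; exact: bm_cst.
Qed.

Lemma bm_Q_stat : bm (Q_stat x eps).
Proof.
rewrite (funext Q_stat_decomposition); apply: bmD; last exact: bm_linear_remainder.
by apply: bmD; [exact: bm_main_term|exact: bm_inner_remainder].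
Qed.

End statistic.

(** * Moment bounds for the three terms under normal errors *)

Section normal_errors.
Context {R : realType} (N T p : nat) (x : 'I_N -> 'M[R]_(T, p)).
Context d (Om : measurableType d) (Pr : probability Om R)
  (eps : 'I_N -> {RV Pr >-> T.-tuple R}) (sigma : 'I_N -> R).
Hypothesis p_lt : (p < T)%N.
Hypothesis x_unit : forall i, (x i)^T *m x i \in unitmx.
Hypothesis eps_indep : mutually_independent eps.
Hypothesis sigma_gt0 : forall i, 0 < sigma i.
Hypothesis eps_normal : forall i,
  has_mvnormal_distribution (eps i) 0 ((sigma i ^+ 2)%:M).

Local Notation m := (@rank_resid R T p).
Let Q i := residual_maker (x i).
Let sQ i : (Q i)^T = Q i. Proof. exact: residual_maker_sym. Qed.
Let iQ i : Q i *m Q i = Q i. Proof. exact: residual_maker_idem. Qed.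
Let trQ i : \tr (Q i) = m. Proof. exact: tr_residual_maker. Qed.
Let m_ge1 : 1 <= m.
Proof. by rewrite /rank_resid -natrB ?(ltnW p_lt)// ler1n subn_gt0. Qed.
Let trQ_ge1 i : 1 <= \tr (Q i). Proof. by rewrite trQ. Qed.
Let m_gt0 : 0 < m. Proof. exact: lt_le_trans ltr01 m_ge1. Qed.
Let m_neq0 : m != 0. Proof. by rewrite gt_eqF. Qed.

Local Notation W := (dirvec x eps).
Let Zo := others eps [tuple of nseq T 0].

Let mY i : measurable_fun [set: Om] (eps i). Proof. exact: measurable_funPT. Qed.

Let mZo i : measurable_fun [set: Om] (Zo i). Proof. exact: measurable_others. Qed.

Let XY i k : fnof (eps i) (fun w => W i w k). Proof. exact: fnof_dirvec. Qed.

Let XZo i j k : j != i -> fnof (Zo i) (fun w => W j w k).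
Proof.
move=> ji; have [mc [C bC]] := bm_cdir (sQ j) (iQ j) k.
exists (fun t : N.-tuple (T.-tuple R) => cdir (Q j) (tnth (tnth t j)) k).
  split; last by exists C => t; exact: bC.
  apply: (@measurableT_comp _ _ _ _ _ _ (fun t : T.-tuple R => cdir (Q j) (tnth t) k)) => //.
  exact: measurable_tnth.
by move=> w; rewrite tnth_others.
Qed.

Let indep i (V U : Om -> R) : fnof (eps i) V -> fnof (Zo i) U ->
  mean Pr (fun w => V w * U w) = mean Pr V * mean Pr U.
Proof.
move=> [phi bphi /funext ->] [g bg /funext ->].
exact: (mean_factor _ eps_indep).
Qed.

Let bmW i k : bm (fun w => W i w k). Proof. exact: fnof_bm (XY i k). Qed.

Let X_le1 i w : ip (W i w) (W i w) <= 1.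
Proof. exact: (cdir_le1 (sQ i) (iQ i) (trQ_ge1 i)). Qed.

Let mxfunE (z : 'I_T * 'I_T -> R) : z = mxfun (\matrix_(k, l) z (k, l)).
Proof. by apply/funext => -[k l]; rewrite /mxfun mxE. Qed.

Let X_mean0' i Z : mean Pr (fun w => ip (W i w) (mxfun Z)) = 0.
Proof. exact: (mean_ip_cdir (sigma_gt0 i) (eps_normal i) (sQ i) (iQ i) (trQ_ge1 i)). Qed.

Let X_mean0 i k : mean Pr (fun w => W i w k) = 0.
Proof.
rewrite -(X_mean0' i (\matrix_(a, b) (k == (a, b))%:R)); apply: eq_mean => w.
rewrite -(mxfunE (fun q => (k == q)%:R)) /ip (bigD1 k)//= eqxx mulr1.
by rewrite big1 ?addr0// => q /negbTE; rewrite eq_sym => ->; rewrite mulr0.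
Qed.

Definition kap : R := 2 / m ^+ 2.
Let kap_gt0 : 0 < kap. Proof. by rewrite divr_gt0// exprn_gt0. Qed.

Let X_mean2' i Z c : mean Pr (fun w => ip (W i w) (mxfun Z) ^+ 2) <= kap * frob (Z - c%:M).
Proof.
have := mean_ip_cdir2_le (sigma_gt0 i) (eps_normal i) (sQ i) (iQ i) (trQ_ge1 i) Z c.
by rewrite trQ.
Qed.

Let X_mean2 i z : mean Pr (fun w => ip (W i w) z ^+ 2) <= kap * ip z z.
Proof.
by rewrite (mxfunE z) (le_trans (X_mean2' _ _ 0))// raddf0 subr0 frob_mxfun.
Qed.

Let X_mean4 i z : mean Pr (fun w => ip (W i w) z ^+ 4) <= 108 / m ^+ 4 * ip z z ^+ 2.
Proof.
rewrite (mxfunE z) frob_mxfun.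
have := mean_ip_cdir4_le (sigma_gt0 i) (eps_normal i) (sQ i) (iQ i) (trQ_ge1 i).
by rewrite trQ; exact.
Qed.

Hypothesis m_large : 12 + 4 * p%:R <= m.
Let p_ge0 : 0 <= p%:R :> R. Proof. exact: ler0n. Qed.

Let mean_pair_le i j : i != j -> mean Pr (fun w => ip (W i w) (W j w) ^+ 2) <= kap.
Proof.
move=> ij; have h : forall k, fnof (Zo i) (fun w => W j w k).
  by move=> k; apply: XZo; rewrite eq_sym.
apply: le_trans (mean_ip2_le mY mZo XY indep X_mean2 h) _.
rewrite -[leRHS]mulr1 ler_pM2l//; apply: mean_le_cst => //.
exact: bm_ip.
Qed.

(** Given W_j, the second moment over W_i is exact and [frob_traceless_ge] bounds it below through r
    = w_j' P_i w_j. Jensen's inequality and E r = tr(P_i P_j) / m >= 1 - p/m then give 1 - 2 p/m -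
    3/m. *)
Let mean_pair_ge i j : i != j ->
  2 / (m * (m + 2)) * (1 - (2 * p%:R + 3) / m) <= mean Pr (fun w => ip (W i w) (W j w) ^+ 2).
Proof.
move=> ij; have h : forall k, fnof (Zo i) (fun w => W j w k).
  by move=> k; apply: XZo; rewrite eq_sym.
have m2 : 0 < m + 2 by rewrite addr_gt0.
have c_gt0 : 0 < 2 / (m * (m + 2)) by rewrite divr_gt0// mulr_gt0.
have -> : mean Pr (fun w => ip (W i w) (W j w) ^+ 2) =
    mean Pr (fun w => mean Pr (fun u => ip (W i u) (W j w) ^+ 2)).
  have := mean_ip2 mY mZo XY indep h (fnof_cst (Zo i) 1).
  by under eq_mean do rewrite mulr1; under [RHS]eq_mean do rewrite mulr1.
pose t := \tr (Q i *m Q j).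
pose r w := ip (W j w) (mxfun (Q i)) + t / m.
have rE w : r w = \tr (dirmx (Q j) (tnth (eps j w)) *m Q i).
  rewrite /r /dirvec ip_cdir ?sQ ?iQ// trQ /t (mxtrace_mulC (Q i)) subrK.
  by rewrite -tr_dirmx ?sQ// dirmx_sym.
have lo w : 2 / (m * (m + 2)) * (r w ^+ 2 - 3 / m) <=
    mean Pr (fun u => ip (W i u) (W j w) ^+ 2).
  rewrite /dirvec {2}/cdir.
  rewrite (mean_ip_cdir2 (sigma_gt0 i) (eps_normal i) (sQ i) (iQ i) (trQ_ge1 i)).
  rewrite -/(Q i) -/(Q j) !trQ ler_pM2l// rE.
  by apply: frob_traceless_ge; rewrite ?sQ ?iQ ?trQ ?dirmx_sym ?dirmx_idem ?frob_dirmx_le1.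
have bl : bm (fun w => ip (W j w) (mxfun (Q i))) by apply: bm_ip => // k; exact: bm_cst.
have br : bm r by apply: bmD => //; exact: bm_cst.
have br2 : bm (fun w => r w ^+ 2) by exact: bmX.
apply: le_trans (_ : mean Pr (fun w => 2 / (m * (m + 2)) * (r w ^+ 2 - 3 / m)) <= _); last first.
  apply: ler_mean => //.
    by apply: bmM; [exact: bm_cst|apply: bmB => //; exact: bm_cst].
  exact: (fnof_bm (mZo i) (fnof_mean_ip2 Pr mY XY i h)).
rewrite meanZ; last by apply: bmB => //; exact: bm_cst.
rewrite ler_pM2l// meanB//; last exact: bm_cst.
rewrite mean_cst.
have mr : mean Pr r = t / m.
  by rewrite meanD//; [rewrite X_mean0' add0r mean_cst|exact: bm_cst].
have mr2 : (t / m) ^+ 2 <= mean Pr (fun w => r w ^+ 2).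
  have : 0 <= mean Pr (fun w => r w ^+ 2 - (2 * (t / m) * r w - (t / m) ^+ 2)).
    apply: mean_ge0 => w; have := sqr_ge0 (r w - t / m); lra.
  rewrite meanB//; last first.
    by apply: bmB; [apply: bmM => //; exact: bm_cst|exact: bm_cst].
  rewrite meanB; [|by apply: bmM => //; exact: bm_cst|exact: bm_cst].
  rewrite meanZ// mr mean_cst; lra.
have tm : 1 - p%:R / m <= t / m.
  have := tr_mul_proj_ge (sQ i) (iQ i) (sQ j) (iQ j) (trQ i) (frob_residual_makerB1 (x_unit j)).
  by rewrite -/t => tm; rewrite -[X in X - _](divff m_neq0) -mulrBl ler_pM2r ?invr_gt0.
have p0 := p_ge0; have mL := m_large.
have pm : p%:R / m <= 1 by rewrite ler_pdivrMr// mul1r; lra.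
have pm0 : 0 <= p%:R / m by rewrite divr_ge0// ltW.
apply: le_trans (_ : (t / m) ^+ 2 - 3 / m <= _); last by rewrite lerD2r.
have t2 : (1 - p%:R / m) ^+ 2 <= (t / m) ^+ 2 by rewrite lerXn2r ?nnegrE//; lra.
rewrite mulrDl; have := sqr_ge0 (p%:R / m); lra.
Qed.

Hypothesis N_gt1 : (1 < N)%N.
Local Notation c0 := (@normalizer R N).
Let n : R := N%:R.
Let n_ge2 : 2 <= n. Proof. by rewrite /n ler_nat. Qed.

Let c0_sqr : c0 ^+ 2 = 2 / (n * (n - 1)).
Proof. by have n2 := n_ge2; rewrite sqr_sqrtr// divr_ge0// mulr_ge0//; lra. Qed.

Let c0n : c0 ^+ 2 * n ^+ 2 <= 4.
Proof.
have n2 := n_ge2; rewrite c0_sqr mulrAC ler_pdivrMr; last by rewrite mulr_gt0; lra.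
have : 0 <= n * (n - 2) by rewrite mulr_ge0//; lra.
by lra.
Qed.

Let card_offdiag : \sum_(q : 'I_N * 'I_N | q.1 != q.2) 1 = n * (n - 1) :> R.
Proof.
rewrite -(pair_big_dep xpredT (fun i j : 'I_N => i != j) (fun _ _ => 1))/=.
under eq_bigr => i _.
  rewrite (_ : \sum_(j | i != j) 1 = n - 1); last first.
    have : \sum_(j < N) 1 = n by rewrite sumr_const card_ord.
    rewrite (bigD1 i)//= => <-; rewrite addrAC subrr add0r.
    by apply: eq_bigl => j; rewrite eq_sym.
  over.
by rewrite sumr_const card_ord -[LHS]mulr_natl.
Qed.

(** The upper bound [kap] on each pair makes the total at most 1 exactly. In the lower bound the
    factor m / (m + 2) loses 2/m on top of (2 p + 3) / m. *)
Let mean_var : `|(c0 * m / Num.sqrt 2) ^+ 2 / 2 *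
  (\sum_(q : 'I_N * 'I_N | q.1 != q.2) mean Pr (fun w => ip (W q.1 w) (W q.2 w) ^+ 2)) - 1|
  <= (2 * p%:R + 5) / m.
Proof.
have p0 := p_ge0; have mL := m_large; have n2 := n_ge2.
set S := \sum_(_ | _) _.
pose lo := 2 / (m * (m + 2)) * (1 - (2 * p%:R + 3) / m).
have Slo : n * (n - 1) * lo <= S.
  rewrite -card_offdiag mulr_suml; apply: ler_sum => q q12; rewrite mul1r.
  exact: mean_pair_ge.
have Shi : S <= n * (n - 1) * kap.
  rewrite -card_offdiag mulr_suml; apply: ler_sum => q q12; rewrite mul1r.
  exact: mean_pair_le.
have nn : 0 < n * (n - 1) by rewrite mulr_gt0; lra.
have -> : (c0 * m / Num.sqrt 2) ^+ 2 / 2 = m ^+ 2 / 2 / (n * (n - 1)).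
  rewrite exprMn exprVn sqr_sqrtr// exprMn c0_sqr; field.
  by rewrite !gt_eqF//; lra.
set c := m ^+ 2 / 2 / _.
have c_ge0 : 0 < c by rewrite divr_gt0// divr_gt0// exprn_gt0.
have hi1 : c * S <= 1.
  apply: le_trans (ler_wpM2l (ltW c_ge0) Shi) _; rewrite le_eqVlt; apply/orP; left; apply/eqP.
  by rewrite /c /kap; field; rewrite m_neq0 !gt_eqF//; lra.
have lo1 : 1 - (2 * p%:R + 5) / m <= c * S.
  apply: le_trans (ler_wpM2l (ltW c_ge0) Slo).
  have m2 : 0 < m + 2 by rewrite addr_gt0.
  have -> : c * (n * (n - 1) * lo) = m / (m + 2) * (1 - (2 * p%:R + 3) / m).
    by rewrite /c /lo; field; rewrite m_neq0 !gt_eqF//; lra.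
  have mm : 1 - 2 / m <= m / (m + 2).
    rewrite -subr_ge0 (_ : _ - _ = 4 / (m * (m + 2))); last first.
      by field; rewrite m_neq0 gt_eqF.
    by rewrite divr_ge0// mulr_ge0// ltW.
  have u0 : 0 <= (2 * p%:R + 3) / m by rewrite divr_ge0 ?(ltW m_gt0)//; lra.
  have u1 : (2 * p%:R + 3) / m <= 1 by rewrite ler_pdivrMr// mul1r; lra.
  have u2 : 0 <= 2 / m by rewrite divr_ge0// ltW.
  have := ler_wpM2r (_ : 0 <= 1 - (2 * p%:R + 3) / m) mm; rewrite subr_ge0 => /(_ u1).
  have := mulr_ge0 u2 u0.
  rewrite (_ : (2 * p%:R + 5) / m = (2 * p%:R + 3) / m + 2 / m); first lra.
  by rewrite -mulrDl; congr (_ / _); lra.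
by rewrite ler_norml; apply/andP; split; lra.
Qed.

(** Here beta = 4 by [c0n], K = 27 because 108 / m^4 = 27 [kap]^2, and 1956 = (3/2) (2 beta + 3 K
    beta^2). *)
Lemma main_term_stein f g L : lipschitz_deriv f g L ->
  `|mean Pr (fun w => main_term x eps w * f (main_term x eps w)) -
    mean Pr (fun w => g (main_term x eps w))| <=
  L * (1956 / Num.sqrt n + ((2 * p%:R + 5) / m + 4 * Num.sqrt (n^-1 + kap))).
Proof.
move=> [[cf cg] L0 gL lip taylor]; have p0 := p_ge0; have mL := m_large.
have kap1 : kap <= 1.
  rewrite /kap ler_pdivrMr ?exprn_gt0// mul1r expr2.
  have : 12 * m <= m * m by rewrite ler_pM2r//; lra.
  lra.
have beta_ge : (c0 * m / Num.sqrt 2) ^+ 2 * kap * N%:R ^+ 2 <= 4.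
  apply: le_trans c0n; rewrite le_eqVlt; apply/orP; left; apply/eqP.
  rewrite exprMn exprVn sqr_sqrtr// exprMn /kap; by field.
have k4 : 108 / m ^+ 4 <= 27 * kap ^+ 2.
  by rewrite le_eqVlt; apply/orP; left; apply/eqP; rewrite /kap; field.
have N0 : (0 < N)%N by exact: ltnW.
have := quadratic_form_stein mY mZo XY XZo indep X_le1 X_mean0 kap_gt0 kap1 X_mean2 X_mean4
  N0 cf cg L0 taylor lip beta_ge k4 _ gL mean_var.
have -> : 3 / 2 * (2 * 4 + 3 * 27 * 4 ^+ 2) = 1956 :> R by field.
by apply; lra.
Qed.

Let t_bounds i j : m - p%:R <= \tr (Q i *m Q j) <= m.
Proof.
rewrite (tr_mul_proj_ge (sQ i) (iQ i) (sQ j) (iQ j) (trQ i) (frob_residual_makerB1 (x_unit j))).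
by rewrite (tr_mul_proj_le (sQ i) (iQ i) (sQ j) (iQ j)).
Qed.

Let C : R := 12 + 4 * p%:R.

Lemma v_rho_sqr_dist i j : `|v_rho_sqr m (Q i) (Q j) - 2| <= C / m.
Proof.
apply: v_rho_sqr_bounds => //.
rewrite (tr_mul_proj2_ge0 (sQ i) (iQ i) (sQ j)).
by rewrite (tr_mul_proj2_le (sQ i) (iQ i) (sQ j) (iQ j)).
Qed.

Lemma v_rho_sqr_ge1 i j : 1 <= v_rho_sqr m (Q i) (Q j).
Proof.
have := v_rho_sqr_dist i j; have : C / m <= 1 by rewrite ler_pdivrMr// mul1r.
by rewrite ler_norml => ? /andP[? ?]; lra.
Qed.

(** Each weight is at most C / m by [inv_sqrt_dist]. The factor 2 [kap] = 4 / m^2 of the degenerate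
    sum cancels the square of m / 2, and c0^2 n^2 <= 4 handles the number of pairs. *)
Let mean_inner_remainder :
  mean Pr (fun w => inner_remainder x eps w ^+ 2) <= 4 * C ^+ 2 / m ^+ 2.
Proof.
have p0 := p_ge0; have mL := m_large.
pose a (q : 'I_N * 'I_N) : R := (v_rho m (Q q.1) (Q q.2))^-1 - (Num.sqrt 2)^-1.
have bS : bm (fun w => \sum_(q : 'I_N * 'I_N | q.1 != q.2) a q * ip (W q.1 w) (W q.2 w)).
  by apply: bm_sum => q _; apply: bmM; [exact: bm_cst|exact: bm_ip].
under eq_mean do rewrite exprMn.
rewrite meanZ; last exact: bmX.
have := mean_weighted_sum_le mY mZo XY XZo indep X_le1 X_mean0 kap_gt0 X_mean2 a.
have aC : \sum_(q | q.1 != q.2) a q ^+ 2 <= n ^+ 2 * (C / m) ^+ 2.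
  apply: le_trans (_ : \sum_(q : 'I_N * 'I_N) (C / m) ^+ 2 <= _).
    rewrite [leLHS]big_mkcond; apply: ler_sum => q _.
    case: ifP => _; last exact: sqr_ge0.
    rewrite -(real_normK (num_real (a q))) lerXn2r ?nnegrE//.
      by rewrite divr_ge0 ?(ltW m_gt0)// /C; lra.
    exact: inv_sqrt_dist (v_rho_sqr_ge1 _ _) (v_rho_sqr_dist _ _).
  by rewrite sumr_const card_prod card_ord -[leLHS]mulr_natl natrM -expr2.
set E := mean _ _ => hE.
have hE2 : E <= 2 * kap * (n ^+ 2 * (C / m) ^+ 2).
  by apply: le_trans hE _; rewrite ler_pM2l// mulr_gt0.
have cc : 0 <= (c0 * m / 2) ^+ 2 by exact: sqr_ge0.
apply: le_trans (ler_wpM2l cc hE2) _.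
have -> : (c0 * m / 2) ^+ 2 * (2 * kap * (n ^+ 2 * (C / m) ^+ 2)) =
    (c0 ^+ 2 * n ^+ 2) * (C ^+ 2 / m ^+ 2).
  by rewrite /kap; field.
by rewrite -[leRHS]mulrA ler_wpM2r// divr_ge0 ?sqr_ge0.
Qed.

(** The summands are independent and centred, so their N variances add; each is at most [kap] n^2 p
    and c0^2 is of order 1 / n^2. The resulting n / m^2 is the only rate that asks for more than m
    -> oo. *)
Let mean_linear_remainder :
  mean Pr (fun w => linear_remainder x eps w ^+ 2) <= 8 * p%:R * n / m ^+ 2.
Proof.
have p0 := p_ge0; have mL := m_large; have n2 := n_ge2.
pose l i w := ip (W i w) (mxfun (linear_coef x i)).
have fl i : fnof (eps i) (l i) by apply: fnof_ip => // k; exact: fnof_cst.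
have flZ i j : j != i -> fnof (Zo i) (l j).
  by move=> ji; apply: fnof_ip => k; [exact: XZo|exact: fnof_cst].
have bl i : bm (l i) by exact: fnof_bm (fl i).
have bS : bm (fun w => \sum_i l i w) by exact: bm_sum.
under eq_mean do rewrite exprMn.
rewrite meanZ; last exact: bmX.
have -> : mean Pr (fun w => (\sum_i l i w) ^+ 2) = \sum_i mean Pr (fun w => l i w ^+ 2).
  under eq_mean do rewrite expr2 big_distrlr/=.
  rewrite mean_sum => [|i _]; last by apply: bm_sum => j _; exact: bmM.
  apply: eq_bigr => i _; rewrite mean_sum => [|j _]; last exact: bmM.
  rewrite (bigD1 i)//= [X in _ + X]big1 ?addr0; first by under eq_mean do rewrite -expr2.
  by move=> j ji; rewrite (indep (fl i) (flZ _ _ ji)) [X in X * _](X_mean0' i) mul0r.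
have l2 i : mean Pr (fun w => l i w ^+ 2) <= kap * (n * (n * p%:R)).
  (* The scalar shift allowed by [X_mean2'] is chosen to replace every [Q j] by [Q j - 1], whose
     squared norm is [p] instead of m. *)
  pose c := \sum_(j | i != j) (v_rho m (Q i) (Q j))^-1.
  apply: le_trans (X_mean2' _ _ c) _; rewrite ler_pM2l//.
  have -> : linear_coef x i - c%:M = \sum_(j | i != j) (v_rho m (Q i) (Q j))^-1 *: (Q j - 1%:M).
    have -> : c%:M = \sum_(j | i != j) (v_rho m (Q i) (Q j))^-1 *: 1%:M :> 'M[R]_T.
      by rewrite -scaler_suml scalemx1.
    by rewrite /linear_coef -sumrB; apply: eq_bigr => j _; rewrite [RHS]scalerBr.
  apply: le_trans (frob_sum_le _ _) _; rewrite ler_wpM2l//.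
  apply: le_trans (_ : \sum_(j < N) p%:R <= _); last first.
    by rewrite sumr_const card_ord /n [leRHS]mulr_natl.
  rewrite [leLHS]big_mkcond; apply: ler_sum => j _; case: ifP => // _.
  rewrite frobZ frob_residual_makerB1//.
  have v1 : 1 <= v_rho m (Q i) (Q j).
    by rewrite /v_rho -(sqrtr1 R) ler_sqrt ?v_rho_sqr_ge1// (le_trans ler01)// v_rho_sqr_ge1.
  have v2 : 0 <= (v_rho m (Q i) (Q j))^-1 <= 1.
    by rewrite invr_ge0 (le_trans ler01 v1) invf_le1 ?v1// (lt_le_trans ltr01).
  have /andP[v3 v4] := v2.
  by rewrite ler_piMl// expr_le1.
apply: le_trans (ler_wpM2l (sqr_ge0 _) (ler_sum _ (fun i _ => l2 i))) _.
rewrite sumr_const card_ord -[X in _ * X]mulr_natl -/n.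
have -> : c0 ^+ 2 * (n * (kap * (n * (n * p%:R)))) = (c0 ^+ 2 * n ^+ 2) * (2 * p%:R * n / m ^+ 2).
  by rewrite /kap; field.
rewrite (_ : 8 * p%:R * n / m ^+ 2 = 4 * (2 * p%:R * n / m ^+ 2)); last by field.
by rewrite ler_wpM2r// divr_ge0 ?sqr_ge0 ?mulr_ge0//; lra.
Qed.

Lemma mean_remainder_sqr :
  mean Pr (fun w => (Q_stat x eps w - main_term x eps w) ^+ 2) <=
  8 * C ^+ 2 / m ^+ 2 + 16 * p%:R * n / m ^+ 2.
Proof.
have b1 := bm_inner_remainder eps x_unit; have b2 := bm_linear_remainder eps x_unit.
have b12 := bmX 2 b1; have b22 := bmX 2 b2.
apply: le_trans (_ : mean Pr (fun w => 2 * inner_remainder x eps w ^+ 2 +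
    2 * linear_remainder x eps w ^+ 2) <= _).
  apply: ler_mean.
  - by apply: bmX; apply: bmB; [exact: bm_Q_stat|exact: bm_main_term].
  - by apply: bmD; apply: bmM => //; exact: bm_cst.
  move=> w; rewrite Q_stat_decomposition//.
  rewrite (_ : _ - main_term x eps w = inner_remainder x eps w + linear_remainder x eps w); last by ring.
  by have := sqr_ge0 (inner_remainder x eps w - linear_remainder x eps w); lra.
rewrite meanD; [|by apply: bmM => //; exact: bm_cst..].
rewrite !meanZ//; have := mean_inner_remainder; have := mean_linear_remainder; lra.
Qed.

End normal_errors.

(** * Asymptotics *)

Section growth.
Context {R : realType}.

Lemma sqrtn_ge1 N : (0 < N)%N -> 1 <= Num.sqrt (N%:R : R).
Proof. by move=> N0; rewrite -[leLHS]sqrtr1 ler_sqrt ?ler1n. Qed.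

Lemma cvg0_le (u b : nat -> R) : (\forall k \near \oo, `|u k| <= b k) ->
  b @ \oo --> 0 -> u @ \oo --> 0.
Proof.
move=> ub b0; apply/cvgrPdist_le => e e0.
move/cvgrPdist_le : b0 => /(_ _ e0) b0; near=> k.
have h1 : `|u k| <= b k by near: k.
have h2 : `|0 - b k| <= e by near: k.
move: h2; rewrite !sub0r !normrN => h2.
exact: le_trans h1 (le_trans (ler_norm _) h2).
Unshelve. all: by end_near. Qed.

Variables (p : nat) (T : nat -> nat).
Hypothesis p_lt : forall N, (p < T N)%N.
Hypothesis T_growth : (T N)%:R / Num.sqrt (N%:R : R) @[N --> \oo] --> +oo.
Let m N : R := rank_resid (T N) p.

(** Since sqrt N >= 1, the shift by [p] costs at most p sqrt N; hence the threshold A + p for T /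
    sqrt N. *)
Lemma rank_resid_growth (A : R) : 0 <= A ->
  \forall N \near \oo, (1 < N)%N /\ A * Num.sqrt N%:R <= m N.
Proof.
move=> A0; have := T_growth; move/cvgryPge => /(_ (A + p%:R)) h.
near=> N; have N1 : (1 < N)%N by near: N; exact: nbhs_infty_gt.
split => //; have s1 : 1 <= Num.sqrt (N%:R : R).
  by apply: sqrtn_ge1; exact: ltnW.
have s0 : 0 < Num.sqrt (N%:R : R) by exact: lt_le_trans ltr01 s1.
have : A + p%:R <= (T N)%:R / Num.sqrt (N%:R : R) by near: N.
rewrite ler_pdivlMr// /m /rank_resid => h1.
have : p%:R <= p%:R * Num.sqrt (N%:R : R) :> R by rewrite ler_peMr.
lra.
Unshelve. all: by end_near. Qed.

Lemma rank_resid_large (A : R) : 0 <= A -> \forall N \near \oo, (1 < N)%N /\ A <= m N.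
Proof.
move=> A0; have h := rank_resid_growth A0; near=> N.
have [N1 Am] : (1 < N)%N /\ A * Num.sqrt N%:R <= m N by near: N.
split => //; apply: le_trans Am; rewrite ler_peMr//.
by apply: sqrtn_ge1; exact: ltnW.
Unshelve. all: by end_near. Qed.

Let m_gt0 N : 0 < m N.
Proof. by rewrite /m /rank_resid subr_gt0 ltr_nat. Qed.

Lemma cvg_sqrt_rank : Num.sqrt N%:R / m N @[N --> \oo] --> 0.
Proof.
apply/cvgrPdist_le => e e0; have := rank_resid_growth (ltW (_ : 0 < e^-1)).
rewrite invr_gt0 => /(_ e0) h; near=> N.
have [_ h1] : (1 < N)%N /\ e^-1 * Num.sqrt N%:R <= m N by near: N.
rewrite sub0r normrN ger0_norm; last by rewrite divr_ge0 ?sqrtr_ge0// ltW.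
by rewrite ler_pdivrMr// -ler_pdivrMl.
Unshelve. all: by end_near. Qed.

Lemma cvg_rank_inv : (m N)^-1 @[N --> \oo] --> 0.
Proof.
apply: cvg0_le cvg_sqrt_rank; near=> N.
have N1 : (1 < N)%N by near: N; exact: nbhs_infty_gt.
rewrite ger0_norm ?invr_ge0 ?(ltW (m_gt0 _))// ler_peMl ?invr_ge0 ?(ltW (m_gt0 _))//.
by apply: sqrtn_ge1; exact: ltnW.
Unshelve. all: by end_near. Qed.

Lemma cvg_sqrt_inv : (Num.sqrt (N%:R : R))^-1 @[N --> \oo] --> 0.
Proof.
apply/cvgrPdist_le => e e0; near=> N.
have h : e^-1 ^+ 2 <= N%:R by near: N; exact: nbhs_infty_ger.
have ei : 0 < e^-1 by rewrite invr_gt0.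
have s : e^-1 <= Num.sqrt N%:R.
  by rewrite -(ger0_norm (ltW ei)) -sqrtr_sqr ler_sqrt.
rewrite sub0r normrN ger0_norm ?invr_ge0 ?sqrtr_ge0//.
by rewrite -[leRHS]invrK lef_pV2 ?posrE// (lt_le_trans ei).
Unshelve. all: by end_near. Qed.

Let cvg_mul0 (a : R) (u : nat -> R) : u @ \oo --> 0 -> a * u N @[N --> \oo] --> 0.
Proof. by move=> u0; rewrite -(mulr0 a); apply: cvgM => //; exact: cvg_cst. Qed.

Let cvg_sqr0 (u : nat -> R) : u @ \oo --> 0 -> u N ^+ 2 @[N --> \oo] --> 0.
Proof.
by move=> u0; under eq_fun do rewrite expr2; rewrite -(mulr0 (0 : R)); exact: cvgM.
Qed.

Let cvg_add0 (u w : nat -> R) : u @ \oo --> 0 -> w @ \oo --> 0 -> u N + w N @[N --> \oo] --> 0.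
Proof. by move=> u0 w0; rewrite -(addr0 (0 : R)); exact: cvgD. Qed.

Lemma cvg_stein_error (L a : R) :
  L * (1956 / Num.sqrt N%:R + (a / m N + 4 * Num.sqrt (N%:R^-1 + kap (T N) p))) @[N --> \oo] --> 0.
Proof.
apply: cvg_mul0; apply: cvg_add0; first by apply: cvg_mul0; exact: cvg_sqrt_inv.
apply: cvg_add0; first by apply: cvg_mul0; exact: cvg_rank_inv.
apply: cvg_mul0; rewrite -(sqrtr0 R).
apply: (@continuous_cvg _ _ _ _ _ _ Num.sqrt 0); first exact: sqrt_continuous.
apply: cvg_add0.
  rewrite (_ : (fun _ => _) = fun N => (Num.sqrt (N%:R : R))^-1 ^+ 2).
    by apply: cvg_sqr0; exact: cvg_sqrt_inv.
  by apply/funext => N; rewrite exprVn sqr_sqrtr.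
rewrite (_ : (fun _ => _) = fun N => 2 * (m N)^-1 ^+ 2).
  by apply: cvg_mul0; apply: cvg_sqr0; exact: cvg_rank_inv.
by apply/funext => N; rewrite /kap exprVn.
Qed.

Lemma cvg_remainder (a b : R) :
  a / m N ^+ 2 + b * N%:R / m N ^+ 2 @[N --> \oo] --> 0.
Proof.
apply: cvg_add0.
  under eq_fun do rewrite -exprVn.
  by apply: cvg_mul0; apply: cvg_sqr0; exact: cvg_rank_inv.
rewrite (_ : (fun _ => _) = fun N => b * (Num.sqrt N%:R / m N) ^+ 2).
  by apply: cvg_mul0; apply: cvg_sqr0; exact: cvg_sqrt_rank.
by apply/funext => N; rewrite exprMn exprVn sqr_sqrtr// mulrA.
Qed.

End growth.

Theorem theorem2 (R : realType) (p : nat) (T : nat -> nat)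
    (x : forall N : nat, 'I_N -> 'M[R]_(T N, p))
    (d : nat -> measure_display) (Om : forall N : nat, measurableType (d N))
    (Pr : forall N : nat, probability (Om N) R)
    (eps : forall N : nat, 'I_N -> {RV (Pr N) >-> (T N).-tuple R})
    (sigma : forall N : nat, 'I_N -> R) :
  (forall N : nat, (p < T N)%N) ->
  ((T N)%:R / Num.sqrt (N%:R : R) @[N --> \oo] --> +oo) ->
  (forall (N : nat) (i : 'I_N), (x N i)^T *m x N i \in unitmx) ->
  (forall N : nat, mutually_independent (eps N)) ->
  (forall (N : nat) (i : 'I_N), 0 < sigma N i) ->
  (forall (N : nat) (i : 'I_N),
    has_mvnormal_distribution (eps N i) 0 (((sigma N i) ^+ 2)%:M)) ->
  (\forall N \near \oo,
    let m : R := (T N)%:R - p%:R in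
    (m + 2) * (m - 2) * (m - 4) != 0 /\
    (forall i j : 'I_N, (i < j)%N ->
      0 < v_rho_sqr m (residual_maker (x N i)) (residual_maker (x N j)))) /\
  cvg_in_distribution
    (fun N : nat => Q_stat (x N) (fun i => eps N i) : {RV (Pr N) >-> R})
    (normal_prob 0 1).
Proof.
move=> p_lt T_growth x_unit eps_indep sigma_gt0 eps_normal.
have C0 : 0 <= 12 + 4 * p%:R :> R by rewrite addr_ge0// mulr_ge0.
have large := rank_resid_large p T_growth C0.
split.
  (* The threshold 12 + 4 p exceeds 4, so no factor of the denominator of [a2] vanishes, and it
     brings each squared normalizer within 1 of 2. *)
  near=> N; have [_ mC] : (1 < N)%N /\ 12 + 4 * p%:R <= rank_resid (T N) p :> R by near: N.
  split; last first.
    by move=> i j _; apply: lt_le_trans ltr01 _; apply: v_rho_sqr_ge1.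
  have p0 : 0 <= p%:R :> R by [].
  move: mC; rewrite /rank_resid; set m := _ - _ => mC.
  by rewrite !mulf_neq0// gt_eqF//; lra.
apply: (@cvg_in_distribution_normal _ _ _ _ _ (fun N => main_term (x N) (eps N))).
- by move=> N; exact: bm_Q_stat.
- by move=> N; exact: bm_main_term.
- move=> f g L fgL; apply: cvg0_le (cvg_stein_error p_lt T_growth L (2 * p%:R + 5)).
  near=> N; have [N1 mC] : (1 < N)%N /\ 12 + 4 * p%:R <= rank_resid (T N) p :> R by near: N.
  exact: (main_term_stein (p_lt N) (x_unit N) (eps_indep N) (sigma_gt0 N) (eps_normal N)).
- apply: cvg0_le (cvg_remainder p_lt T_growth (8 * (12 + 4 * p%:R) ^+ 2) (16 * p%:R)).
  near=> N; have [N1 mC] : (1 < N)%N /\ 12 + 4 * p%:R <= rank_resid (T N) p :> R by near: N.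
  rewrite ger0_norm; last by apply: mean_ge0 => w; exact: sqr_ge0.
  exact: (mean_remainder_sqr (p_lt N) (x_unit N) (eps_indep N) (sigma_gt0 N) (eps_normal N)).
Unshelve. all: by end_near. Qed.
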